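(* Let $K$ be an algebraically closed field, let $p,q,h\ge1$ be integers, and let $J_\infty(D_h)$ be the arc space of the determinantal variety $D_h$ of $p\times q$ matrices over $K$ all of whose $h$-minors vanish. Then the affine coordinate ring $K[J_\infty(D_h)]$ has a $K$-basis given by (the images of) the standard monomials of $\mathcal J_{h-1}$.
   Context: **Arc spaces.** For a scheme $X$ of finite type over $K$, $J_\infty(X)$ is the scheme with $\mathrm{Hom}(\mathrm{Spec}\,A,J_\infty(X))\cong\mathrm{Hom}(\mathrm{Spec}\,A[[t]],X)$ functorially for every $K$-algebra $A$. **Ring.** $\mathfrak R=\mathbb Z[x^{(k)}_{ij}\mid 1\le i\le p,\ 1\le j\le q,\ k\ge 0]$ with the derivation $\partial x^{(k)}_{ij}=(k+1)x^{(k+1)}_{ij}$. The normalized derivative $\bar\partial^n=\frac1{n!}\partial^n$ maps $\mathfrak R$ to itself. For $1\le u_1<\dots<u_h\le p$ and $1\le v_1<\dots<v_h\le q$, the symbol $(u_h,\dots,u_1|v_1,\dots,v_h)$ denotes the $h$-minor $\det\big(x^{(0)}_{u_iv_j}\big)_{1\le i,j\le h}$. $\mathfrak R[h]$ is the ideal of $\mathfrak R$ generated by all $\bar\partial^nB$, $n\ge 0$, $B$ an $h$-minor (zero if $h>\min(p,q)$); $\mathfrak R_h=\mathfrak R/\mathfrak R[h+1]$. **Determinantal variety.** $D_h=D_h(K)$ is the closed subscheme of the space $M_{p,q}$ of $p\times q$ matrices over $K$ defined by the ideal generated by all $h$-minors. One has the identification $K[J_\infty(D_h)]=\mathfrak R_{h-1}\otimes_{\mathbb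 Z}K$, where $\sum_k x_{ij}^{(k)}t^k$ is the $(i,j)$ entry of the universal arc. **$\bar\partial$-lists.** $\mathcal J$ is the set of symbols $J=\bar\partial^n(u_h,\dots,u_1|v_1,\dots,v_h)$, $n\ge0$, $h\ge1$, $u_i<u_{i+1}$, $v_i<v_{i+1}$, each representing the corresponding element of $\mathfrak R$; $wt(J)=n$, $sz(J)=h$; $\mathcal J_h=\{J\in\mathcal J\mid sz(J)\le h\}$. **The set $\mathcal E$.** $\mathcal E$ is the set of $E=((u_h,k_h),\dots,(u_1,k_1)|(v_1,l_1),\dots,(v_h,l_h))$ with $h\geq 1$, $1\le u_i\le p$, $1\le v_i\le q$, the $u_i$ pairwise distinct, the $v_i$ pairwise distinct, and $k_i,l_i\in\mathbb Z_{\ge0}$. Put $||E||=\bar\partial^n(u_{\sigma(h)},\dots,u_{\sigma(1)}|v_{\sigma'(1)},\dots,v_{\sigma'(h)})\in\mathcal J$, where $n=\sum k_i+\sum l_i$ and $\sigma,\sigma'$ are the permutations sorting the $u$'s and $v$'s increasingly. For $J\in\mathcal J$, $\mathcal E(J)=\{E\in\mathcal E\mid ||E||=J\}$. **Orders.** Pairs: $(u,k)\le(u',k')$ iff $k<k'$, or $k=k'$ and $u\le u'$. Partial order on $\mathcal E$: for $E=((u_h,k_h),\dots,(u_1,k_1)|(v_1,l_1),\dots,(v_h,l_h))$ and $E'=((u'_{h'},k'_{h'}),\dots,(u'_1,k'_1)|(v'_1,l'_1),\dots,(v'_{h'},l'_{h'}))$ in $\mathcal E$, $E\le E'$ iff $h'\le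 h$ and $(u_i,k_i)\le(u'_i,k'_i)$, $(v_i,l_i)\le(v'_i,l'_i)$ for $1\le i\le h'$. Total order on $\mathcal E$: $E\prec E'$ iff $h>h'$; or $h=h'$ and $\sum(k_i+l_i)<\sum(k'_i+l'_i)$; or these are equal and the word $(u_h,k_h)\cdots(u_1,k_1)(v_h,l_h)\cdots(v_1,l_1)$ is lexicographically smaller than $(u'_{h'},k'_{h'})\cdots(u'_1,k'_1)(v'_{h'},l'_{h'})\cdots(v'_1,l'_1)$. **Standard monomials.** An ordered product $E_1\cdots E_m$ of elements of $\mathcal E$ is standard if (1) $E_a\le E_{a+1}$ for $1\le a<m$; (2) $E_1$ is the largest element of $\mathcal E(||E_1||)$ under $\prec$; (3) for each $a$, $E_{a+1}$ is the largest (under $\prec$) among those elements $F$ of $\mathcal E(||E_{a+1}||)$ with $E_a\le F$. An ordered product $J_1\cdots J_m$ of elements of $\mathcal J$ is standard (a standard monomial) if there is a standard $E_1\cdots E_m$ with $E_i\in\mathcal E(J_i)$ for all $i$. The empty product $1$ ($m=0$) is counted as standard. A standard monomial of $\mathcal J_{h-1}$ is one with all factors in $\mathcal J_{h-1}$ (for $h=1$ only the empty product). *)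

(* Defs.v *)
From HB Require Import structures.
From mathcomp Require Import all_boot all_order all_algebra.
From mathcomp Require Import finmap boolp.
From mathcomp Require Import monalg.

Set Implicit Arguments.
Unset Strict Implicit.
Unset Printing Implicit Defensive.

Import Order.TTheory GRing.Theory.
Import Order.DefaultProdLexiOrder Order.DefaultSeqLexiOrder.

Local Open Scope fset_scope.
Local Open Scope ring_scope.

(* The power series ring A[[t]]; a record, because the library puts pointwise
   operations on functions. *)
Record fps (A : Type) := Fps { fps_coef :> nat -> A }.

Lemma fpsP (A : Type) (f g : fps A) : (forall n, f n = g n) <-> f = g.
Proof.
split=> [|-> //]; case: f g => [f] [g] /= fg.
by congr Fps; apply/funext.
Qed.

HB.instance Definition _ (A : Type) := gen_eqMixin (fps A).
HB.instance Definition _ (A : Type) := gen_choiceMixin (fps A).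

Section FpsZmod.
Variable A : zmodType.
Implicit Types f g : fps A.

Definition fps_zero : fps A := Fps (fun=> 0).
Definition fps_opp f : fps A := Fps (fun n => - f n).
Definition fps_add f g : fps A := Fps (fun n => f n + g n).

Fact fps_addA : associative fps_add.
Proof. by move=> f g h; apply/fpsP=> n; apply: addrA. Qed.
Fact fps_addC : commutative fps_add.
Proof. by move=> f g; apply/fpsP=> n; apply: addrC. Qed.
Fact fps_add0 : left_id fps_zero fps_add.
Proof. by move=> f; apply/fpsP=> n; apply: add0r. Qed.
Fact fps_addN : left_inverse fps_zero fps_opp fps_add.
Proof. by move=> f; apply/fpsP=> n; apply: addNr. Qed.

HB.instance Definition _ :=
  GRing.isZmodule.Build (fps A) fps_addA fps_addC fps_add0 fps_addN.
End FpsZmod.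

Section FpsRing.
Variable A : comNzRingType.
Implicit Types f g h : fps A.

Definition fps_one : fps A := Fps (fun n => (n == 0%N)%:R).
Definition fps_mul f g : fps A :=
  Fps (fun n => \sum_(i < n.+1) f i * g (n - i)%N).

Lemma fps_mul_poly f g (a b : {poly A}) n :
  (forall i, (i <= n)%N -> f i = a`_i) -> (forall i, (i <= n)%N -> g i = b`_i) ->
  fps_mul f g n = (a * b)`_n.
Proof.
move=> fa gb; rewrite coefM /=; apply: eq_bigr => i _.
by rewrite fa ?gb ?leq_subr // -ltnS.
Qed.

Let trunc n f := \poly_(i < n.+1) f i.

Let truncE n f i : (i <= n)%N -> f i = (trunc n f)`_i.
Proof. by move=> le_in; rewrite coef_poly ltnS le_in. Qed.

Let truncM n f g i : (i <= n)%N -> fps_mul f g i = (trunc n f * trunc n g)`_i.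
Proof.
by move=> le_in; apply: fps_mul_poly => j le_ji; apply: truncE; apply: leq_trans le_in.
Qed.

Fact fps_mulA : associative fps_mul.
Proof.
move=> f g h; apply/fpsP=> n.
rewrite (fps_mul_poly (a := trunc n f) (b := trunc n g * trunc n h)).
- rewrite mulrA; apply/esym/fps_mul_poly => i le_in; first exact: truncM.
  exact: truncE.
- by move=> i le_in; apply: truncE.
- by move=> i le_in; apply: truncM.
Qed.

Fact fps_mulC : commutative fps_mul.
Proof.
move=> f g; apply/fpsP=> n.
by rewrite !(@truncM n) // mulrC.
Qed.

Fact fps_mul1 : left_id fps_one fps_mul.
Proof.
move=> f; apply/fpsP=> n /=; rewrite big_ord_recl /= mul1r subn0.
by rewrite big1 ?addr0 // => i _; rewrite mul0r.
Qed.

Fact fps_mulDl : left_distributive fps_mul (@fps_add A).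
Proof.
move=> f g h; apply/fpsP=> n /=; rewrite -big_split /=.
by apply: eq_bigr => i _; rewrite mulrDl.
Qed.

Fact fps_one_neq0 : fps_one != 0.
Proof.
apply/eqP => /fpsP /(_ 0%N) /= /eqP; by rewrite oner_eq0.
Qed.

HB.instance Definition _ := GRing.Zmodule_isComNzRing.Build (fps A)
  fps_mulA fps_mulC fps_mul1 fps_mulDl fps_one_neq0.
End FpsRing.

Definition fps_map (A B : Type) (f : A -> B) (g : fps A) : fps B :=
  Fps (fun n => f (g n)).

Section FpsMap.
Variables (A B : comNzRingType) (f : {rmorphism A -> B}).

Fact fps_map_is_zmod_morphism : zmod_morphism (fps_map f).
Proof. by move=> g h; apply/fpsP=> n /=; rewrite rmorphB. Qed.

Fact fps_map_is_monoid_morphism : monoid_morphism (fps_map f).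
Proof.
split; first by apply/fpsP=> n /=; rewrite rmorph_nat.
move=> g h; apply/fpsP=> n /=; rewrite rmorph_sum /=.
by apply: eq_bigr => i _; rewrite rmorphM.
Qed.

HB.instance Definition _ := GRing.isZmodMorphism.Build (fps A) (fps B)
  (fps_map f) fps_map_is_zmod_morphism.
HB.instance Definition _ := GRing.isMonoidMorphism.Build (fps A) (fps B)
  (fps_map f) fps_map_is_monoid_morphism.
End FpsMap.

Definition minor (A : comNzRingType) (p q h : nat) (u : 'I_h -> 'I_p)
    (v : 'I_h -> 'I_q) (X : 'M[A]_(p, q)) : A :=
  \det (mxsub u v X).

Definition increasing (h n : nat) (u : 'I_h -> 'I_n) : Prop :=
  forall i j : 'I_h, (i < j)%N -> (u i < u j)%N.

(* The A-points Hom(Spec A, D_h) of the determinantal variety. *)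
Definition in_D (p q h : nat) (A : comNzRingType) (X : 'M[A]_(p, q)) : Prop :=
  forall (u : 'I_h -> 'I_p) (v : 'I_h -> 'I_q),
    increasing u -> increasing v -> minor u v X = 0.

(* (B, U) is the coordinate ring of the arc space of D_h together with its
   universal arc: Hom_K(B, A) = D_h(A[[t]]) via f |-> f(U), for every K-algebra
   A.  The zero algebra, which is not a comAlgType, imposes no
   condition. *)
Definition is_arc_ring (K : fieldType) (p q h : nat) (B : comAlgType K)
    (U : 'M[fps B]_(p, q)) : Prop :=
  in_D h U /\
  forall (A : comAlgType K) (X : 'M[fps A]_(p, q)), in_D h X ->
    exists f : {lrmorphism B -> A},
      map_mx (fps_map f) U = X /\
      forall g : {lrmorphism B -> A}, map_mx (fps_map g) U = X -> g =1 f.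

Section Monomials.
Variable V : choiceType.
Implicit Types (m : {cmonom V}) (w : V).

Lemma cmonom_divK w m : w \in finsupp m -> m = mmul (ucm w) (divcm m (ucm w)).
Proof.
rewrite -cmE_neq0 => mw; apply/eqP/cmP=> i; rewrite cmM divcmE cmU.
by case: eqVneq => [<-|_]; rewrite ?subn0 // subnKC // lt0n.
Qed.

Lemma cmonom_ind (P : {cmonom V} -> Prop) :
  P mone -> (forall w m, P m -> P (mmul (ucm w) m)) -> forall m, P m.
Proof.
move=> P1 PU m; move: {2}(mdeg m) (erefl (mdeg m)) => n.
elim: n m => [|n IHn] m; first by move/mdeg_eq0I=> ->.
move=> mS; have: finsupp m != fset0.
  by apply/eqP=> m0; move: mS; rewrite mdegE m0 big_seq_fset0.
case/fset0Pn=> w /cmonom_divK eq_m; rewrite eq_m; apply: PU; apply: IHn.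
by move: mS; rewrite {1}eq_m mdegM mdegU => -[].
Qed.

Variables (R : comNzRingType).

Lemma malgUM m1 m2 :
  << mmul m1 m2 >> = << m1 >> * << m2 >> :> {malg R[{cmonom V}]}.
Proof. by rewrite malgM_def fgmulUU mulr1. Qed.

Lemma malgCU (c : R) m : c%:MP * << m >> = << c *g m >> :> {malg R[{cmonom V}]}.
Proof. by rewrite malgM_def fgmulUU mulr1 mul1m. Qed.

Lemma malg_ind (P : {malg R[{cmonom V}]} -> Prop) :
  P 0 -> (forall f g, P f -> P g -> P (f + g)) ->
  (forall c m, P (c%:MP * << m >>)) -> forall f, P f.
Proof.
move=> P0 PD PU f; rewrite (monalgE f); elim/big_ind: _ => // m _.
by rewrite -malgCU; apply: PU.
Qed.

End Monomials.

Section Evaluation.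
Variables (V : choiceType) (A B : comNzRingType) (x : V -> B).

Definition eval_monom (m : {cmonom V}) : B := \prod_(w <- finsupp m) x w ^+ m w.

Lemma eval_monomEw (d : {fset V}) (m : {cmonom V}) :
  finsupp m `<=` d -> eval_monom m = \prod_(w <- d) x w ^+ m w.
Proof.
move=> le; rewrite /eval_monom; apply: big_fset_incl => // w _.
by rewrite -cmE_eq0 => /eqP->; rewrite expr0.
Qed.

Fact eval_monom_is_mmorphism : mmorphism eval_monom.
Proof.
split=> [m1 m2|]; last by rewrite /eval_monom mdom1 big_seq_fset0.
rewrite (@eval_monomEw (finsupp m1 `|` finsupp m2) m1) ?fsubsetUl //.
rewrite (@eval_monomEw (finsupp m1 `|` finsupp m2) m2) ?fsubsetUr //.
rewrite /eval_monom mdomD -big_split /=.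
by apply: eq_bigr => w _; rewrite cmM exprD.
Qed.

HB.instance Definition _ :=
  isMultiplicative.Build {cmonom V} B eval_monom eval_monom_is_mmorphism.

Variable phi : {rmorphism A -> B}.

(* Substitution of x for the variables, along phi on the coefficients. *)
Definition eval (f : {malg A[{cmonom V}]}) : B := mmap phi eval_monom f.

HB.instance Definition _ := GRing.RMorphism.copy eval (mmap phi eval_monom).

Lemma eval_var w : eval << ucm w >> = x w.
Proof.
transitivity (phi 1 * eval_monom (ucm w)); first exact: mmapU.
by rewrite rmorph1 mul1r /eval_monom mdomU big_seq_fset1 cmUU expr1.
Qed.

Lemma eval_const c : eval c%:MP = phi c.
Proof. exact: mmapC. Qed.

End Evaluation.

(* (i, j, k) stands for the variable x_ij^(k). *)
Definition var (p q : nat) : choiceType := ('I_p * 'I_q * nat)%type.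

Definition diffring (p q : nat) : comNzRingType := {malg int[{cmonom var p q}]}.

Section DiffRing.
Variables p q : nat.
Local Notation V := (var p q).
Local Notation R := (diffring p q).
Implicit Types (f g : R) (m : {cmonom V}) (w : V).

Definition xvar w : R := << ucm w >>.

Definition next w : V := (w.1, w.2.+1).

(* The derivation sending x_ij^(k) to (k+1) x_ij^(k+1). *)
Definition der_monom m : R :=
  \sum_(w <- finsupp m)
    (w.2.+1 * m w)%:R * (<< divcm m (ucm w) >> * xvar (next w)).

Definition der f : R := mmap (@malgC {cmonom V} int) der_monom f.

(* (1/n!) der^n; the division is exact, see dbarE. *)
Definition dbar n f : R :=
  \sum_(m <- msupp (iter n der f)) << ((iter n der f)@_m %/ n`!)%Z *g m >>.

Lemma derD f g : der (f + g) = der f + der g.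
Proof. exact: mmapD. Qed.

Lemma derMn f n : der (f *+ n) = der f *+ n.
Proof. exact: mmapMn. Qed.

Lemma derCU (c : int) m : der (c%:MP * << m >>) = c%:MP * der_monom m.
Proof.
by rewrite malgCU /der mmapU.
Qed.

Lemma der_monomEw (d : {fset V}) m : finsupp m `<=` d ->
  der_monom m =
    \sum_(w <- d) (w.2.+1 * m w)%:R * (<< divcm m (ucm w) >> * xvar (next w)).
Proof.
move=> le; rewrite /der_monom; apply: big_fset_incl => // w _.
by rewrite -cmE_eq0 => /eqP->; rewrite muln0 mul0r.
Qed.

Lemma der_monomM m1 m2 :
  der_monom (mmul m1 m2) = der_monom m1 * << m2 >> + << m1 >> * der_monom m2.
Proof.
set d := finsupp m1 `|` finsupp m2.
pose T m w : R := (w.2.+1 * m w)%:R * (<< divcm m (ucm w) >> * xvar (next w)).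
transitivity (\sum_(w <- d) (T m1 w * << m2 >> + << m1 >> * T m2 w)); last first.
  rewrite (@der_monomEw d m1) ?fsubsetUl // (@der_monomEw d m2) ?fsubsetUr //.
  rewrite big_split /=; congr (_ + _); first exact/esym/mulr_suml.
  exact/esym/mulr_sumr.
rewrite (@der_monomEw d (mmul m1 m2)) ?mdomD //.
apply: eq_bigr => w _.
have H m m' : (w.2.+1 * m w)%:R * << divcm (mmul m m') (ucm w) >> =
    (w.2.+1 * m w)%:R * (<< divcm m (ucm w) >> * << m' >>) :> R.
  case mw: (m w) => [|k]; first by rewrite muln0 !mul0r.
  congr (_ * _); have <- := malgUM int (divcm m (ucm w)) m'.
  apply: (congr1 (fun k => << k >> : R)).
  apply/eqP/cmP=> i.
  rewrite !(cmM, divcmE) cmU addnBAC //.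
  by case: eqVneq => [<-|//]; rewrite mw.
have alg (S : comNzRingType) (a1 a2 b b1 b2 c1 c2 x : S) :
    a1 * b = a1 * (b1 * c2) -> a2 * b = a2 * (b2 * c1) ->
    (a1 + a2) * (b * x) = a1 * (b1 * x) * c2 + c1 * (a2 * (b2 * x)).
  move=> E1 E2; rewrite mulrDl !mulrA E1 E2 !mulrA.
  by congr (_ + _); [exact: mulrAC | rewrite -(mulrA c1) (mulrC c1)].
have H1 := H m1 m2.
have H2 := H m2 m1.
rewrite (mulmC m2) in H2.
have := alg R _ _ _ _ _ _ _ (xvar (next w)) H1 H2.
rewrite /T.
have -> : (w.2.+1 * mmul m1 m2 w)%:R = (w.2.+1 * m1 w)%:R + (w.2.+1 * m2 w)%:R :> R.
  by rewrite cmM mulnDr natrD.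
by [].
Qed.

Lemma derM f g : der (f * g) = der f * g + f * der g.
Proof.
pose leib (S : comNzRingType) (D : S -> S) a b := D (a * b) = D a * b + a * D b.
have leibC (S : comNzRingType) (D : S -> S) a b : leib S D a b -> leib S D b a.
  by rewrite /leib mulrC => ->; rewrite addrC [a * _]mulrC [D a * _]mulrC.
have leib0 (S : comNzRingType) (D : S -> S) a : D 0 = 0 -> leib S D 0 a.
  by move=> D0; rewrite /leib !mul0r D0 mul0r addr0.
have leibD (S : comNzRingType) (D : S -> S) a1 a2 b :
    (forall x y, D (x + y) = D x + D y) ->
    leib S D a1 b -> leib S D a2 b -> leib S D (a1 + a2) b.
  by move=> DD; rewrite /leib mulrDl !DD => -> ->; rewrite !mulrDl addrACA.
have leibU (S : comNzRingType) (D : S -> S) (c c' a b e da db de : S) :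
    D (c * a) = c * da -> D (c' * b) = c' * db -> e = a * b ->
    de = da * b + a * db -> D (c * c' * e) = c * c' * de ->
    leib S D (c * a) (c' * b).
  rewrite /leib mulrACA => -> -> -> -> ->.
  by rewrite mulrDr; congr (_ + _); exact: mulrACA.
have der0 : der 0 = 0 by exact: mmap0.
rewrite -/(leib R der f g).
elim/malg_ind: f => [|f1 f2 IH1 IH2|c m]; first exact: leib0.
  exact: (leibD R der _ _ _ derD).
apply: (leibC R der).
elim/malg_ind: g => [|f1 f2 IH1 IH2|c' m']; first exact: leib0.
  exact: (leibD R der _ _ _ derD).
have cc : (c' * c)%:MP = c'%:MP * c%:MP :> R by exact: mpolyCM.
have D3 := derCU (c' * c) (mmul m' m); rewrite cc in D3.
exact: (leibU R der _ _ _ _ _ _ _ _ (derCU c' m') (derCU c m)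
  (malgUM _ m' m) (der_monomM m' m) D3).
Qed.

Lemma der_var w : der (xvar w) = xvar (next w) *+ w.2.+1.
Proof.
rewrite -[xvar w]mul1r -(mpolyC1E _ int) derCU mpolyC1E mul1r /der_monom.
rewrite mdomU big_seq_fset1 cmUU muln1 mulr_natl.
rewrite (_ : divcm _ _ = mone) ?mul1r //.
by apply/eqP/cmP=> i; rewrite divcmE subnn cm1.
Qed.

Lemma der_nat n : der n%:R = 0.
Proof.
have der1 : der 1 = 0.
  by apply: (addrI (der 1)); rewrite addr0 -{3}[1]mulr1 derM mulr1 mul1r.
by rewrite derMn der1 mul0rn.
Qed.

Let divided f := exists2 d : nat -> R, d 0%N = f &
  forall n, der (d n) = d n.+1 *+ n.+1.

Let dividedP f : divided f.
Proof.
have dividedC (c : int) : divided c%:MP.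
  exists (fun n => if n is 0 then c%:MP else 0) => // n.
  have -> : c%:MP = c%:~R :> R by rewrite -[in LHS](intz c) rmorph_int.
  case: n => [|n]; last by rewrite mul0rn (der_nat 0).
  rewrite mul0rn; case: c => n.
    exact: der_nat.
  rewrite NegzE rmorphN /= -[- _]mulN1r derM (der_nat n.+1) mulr0 addr0.
  have /eqP := der_nat 0; rewrite -[0%:R](subrr 1) derD (der_nat 1) add0r.
  by move=> /eqP->; rewrite mul0r.
have dividedM f1 f2 : divided f1 -> divided f2 -> divided (f1 * f2).
  move=> [d1 <- D1] [d2 <- D2].
  exists (fun n => \sum_(i < n.+1) d1 i * d2 (n - i)%N) => [|n].
    by rewrite big_ord1.
  have derMn2 (a a' b b' : R) i k : der a = a' *+ i -> der b = b' *+ k ->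
      der (a * b) = (a' * b) *+ i + (a * b') *+ k.
    by rewrite derM => -> ->; rewrite mulrnAl mulrnAr.
  have cauchy (F : nat -> R) : (\sum_(i < n.+2) F i) *+ n.+1 =
      \sum_(i < n.+1) (F i.+1 *+ i.+1 + F i *+ (n.+1 - i)).
    transitivity (\sum_(i < n.+2) (F i *+ i + F i *+ (n.+1 - i))).
      rewrite -sumrMnl; apply: eq_bigr => i _.
      by rewrite -mulrnDr subnKC // -ltnS.
    rewrite !big_split /= [X in X + _ = _]big_ord_recl mulr0n add0r.
    by rewrite [X in _ + X = _]big_ord_recr /= subnn mulr0n addr0.
  rewrite (cauchy (fun i => d1 i * d2 (n.+1 - i)%N)) (big_morph der derD (der_nat 0)).
  apply: eq_bigr => i _; have := D2 (n - i)%N.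
  have -> : (n - i).+1 = (n.+1 - i)%N by rewrite subSn // -ltnS.
  exact: derMn2 (D1 i).
elim/malg_ind: f => [|f1 f2 [d1 <- D1] [d2 <- D2]|c m].
- by have := dividedC 0; rewrite malgC0E.
- exists (fun n => d1 n + d2 n) => // n.
  by rewrite derD D1 D2 mulrnDl.
- apply: (dividedM _ _); first exact: (dividedC _).
  elim/cmonom_ind: m => [|w m IH]; first exact: (dividedC 1).
  have -> : << mmul (ucm w) m >> = xvar w * << m >> :> R by exact: malgUM.
  apply: (dividedM _ _); last exact: IH.
  exists (fun n => xvar (w.1, (w.2 + n)%N) *+ 'C(w.2 + n, n)) => [|n].
    by rewrite addn0 bin0 mulr1n; case: (w).
  rewrite derMn der_var /next /= -!mulrnA addnS; congr (_ *+ _).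
  by rewrite [RHS]mulnC -(mul_bin_diag (w.2 + n).+1 n).
Qed.

Lemma dbarE n f : dbar n f *+ n`! = iter n der f.
Proof.
have [d <- D] := dividedP f.
have E : iter n der (d 0%N) = d n *+ n`!.
  elim: n => [|n IHn] //=; rewrite IHn derMn D -mulrnA factS mulnC //.
rewrite /dbar E [in RHS](monalgE (d n *+ n`!)) -sumrMnl.
apply: eq_bigr => m _; rewrite -monalgUMn mcoeffMn; congr << _ *g _ >>.
rewrite -[(d n)@_m *+ _]mulr_natr natz mulzK; last first.
  by case: (n`!) (fact_gt0 n).
by rewrite -mulr_natr natz.
Qed.

End DiffRing.

Definition arc_coef (B : Type) (p q : nat) (U : 'M[fps B]_(p, q))
  (w : var p q) : B := U w.1.1 w.1.2 w.2.

(* The ring homomorphism Z[x_ij^(k)] -> B sending x_ij^(k) to the coefficient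
   of t^k in the (i, j) entry of U. *)
Definition arc_eval (B : comNzRingType) (p q : nat) (U : 'M[fps B]_(p, q)) :
  diffring p q -> B := eval (arc_coef U) ( *~%R 1).

Lemma map_arc_minor (A B : comNzRingType) (f : {rmorphism A -> B})
    (p q h : nat) (u : 'I_h -> 'I_p) (v : 'I_h -> 'I_q) (X : 'M[fps A]_(p, q)) :
  minor u v (map_mx (fps_map f) X) = fps_map f (minor u v X).
Proof. by rewrite /minor -det_map_mx map_mxsub. Qed.

(* is_arc_ring is satisfiable: the quotient of K[x_ij^(k)] by the polynomials
   vanishing at all arcs satisfies it; see arc_ring_exists. *)

(* S as an algebra along phi. *)
Definition alg_along (K S : comNzRingType) (phi : {rmorphism K -> S}) : Type := S.

Section AlgAlong.
Variables (K S : comNzRingType) (phi : {rmorphism K -> S}).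
Local Notation A := (alg_along phi).

HB.instance Definition _ := GRing.ComNzRing.on A.

Definition along_scale (a : K) (v : A) : A := (phi a : A) * v.

Fact along_scaleA a b v : along_scale a (along_scale b v) = along_scale (a * b) v.
Proof. by rewrite /along_scale rmorphM mulrA. Qed.
Fact along_scale1 : left_id 1 along_scale.
Proof. by move=> v; rewrite /along_scale rmorph1 mul1r. Qed.
Fact along_scaleDr : right_distributive along_scale +%R.
Proof. by move=> a u v; rewrite /along_scale mulrDr. Qed.
Fact along_scaleDl v : {morph along_scale^~ v : a b / a + b}.
Proof. by move=> a b; rewrite /along_scale rmorphD mulrDl. Qed.
HB.instance Definition _ := GRing.Zmodule_isLmodule.Build K A
  along_scaleA along_scale1 along_scaleDr along_scaleDl.
Fact along_scaleAl (a : K) (u v : A) : a *: (u * v) = (a *: u) * v.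
Proof. exact: mulrA. Qed.
HB.instance Definition _ := GRing.Lmodule_isLalgebra.Build K A along_scaleAl.
HB.instance Definition _ := GRing.Lalgebra_isComAlgebra.Build K A.

Lemma alg_alongE a : (phi a : A) = a *: 1.
Proof. by rewrite -[LHS]mulr1. Qed.
End AlgAlong.

Section ArcRing.
Variables (K : fieldType) (p q h : nat).
Local Notation P := {malg K[{cmonom var p q}]}.

Definition arc_polyeval (A : comAlgType K) (X : 'M[fps A]_(p, q)) : P -> A :=
  eval (arc_coef X) (in_alg A).
HB.instance Definition _ (A : comAlgType K) (X : 'M[fps A]_(p, q)) :=
  GRing.RMorphism.copy (arc_polyeval X) (eval (arc_coef X) (in_alg A)).

Definition arc_ideal : pred P := fun f =>
  `[< forall (A : comAlgType K) (X : 'M[fps A]_(p, q)),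
        in_D h.+1 X -> arc_polyeval X f = 0 >].

Lemma arc_idealP (f : P) : reflect
  (forall (A : comAlgType K) (X : 'M[fps A]_(p, q)),
        in_D h.+1 X -> arc_polyeval X f = 0) (arc_ideal f).
Proof. exact: asboolP. Qed.

Fact arc_ideal_closed : idealr_closed arc_ideal.
Proof.
split=> [||a f g /arc_idealP f0 /arc_idealP g0].
- by apply/arc_idealP=> A X _; rewrite rmorph0.
- apply/negP => /arc_idealP /(_ K^o 0) H.
  have /H/eqP : in_D h.+1 (0 : 'M[fps K^o]_(p, q)).
    move=> u v _ _; rewrite /minor (expand_det_row _ ord0) big1 // => i _.
    by rewrite !mxE mul0r.
  by rewrite rmorph1 oner_eq0.
- apply/arc_idealP=> A X DX.
  by rewrite rmorphD rmorphM /= f0 // g0 // mulr0 addr0.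
Qed.
HB.instance Definition _ := isIdealr.Build P arc_ideal arc_ideal_closed.

Definition arc_ring : comNzRingType := {ideal_quot (arc_ideal : idealr P)}.

Definition arc_pi0 : P -> arc_ring := \pi_{ideal_quot (arc_ideal : idealr P)}%qT.
HB.instance Definition _ := GRing.RMorphism.copy arc_pi0
  (\pi_{ideal_quot (arc_ideal : idealr P)}%qT).

Definition arc_quot := alg_along (arc_pi0 \o @malgC {cmonom var p q} K).
HB.instance Definition _ := GRing.ComAlgebra.on arc_quot.

Definition arc_pi : P -> arc_quot := arc_pi0.
HB.instance Definition _ := GRing.RMorphism.copy arc_pi arc_pi0.

Lemma arc_pi_eq f g : arc_pi f = arc_pi g <-> arc_ideal (f - g).
Proof.
split=> [/eqP|fg]; first by rewrite -(Quotient.idealrBE (arc_ideal : idealr P)).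
by apply/eqP; rewrite -(Quotient.idealrBE (arc_ideal : idealr P)).
Qed.

Lemma arc_pi_const c : arc_pi c%:MP = c *: 1.
Proof. exact: alg_alongE. Qed.

Definition arc_repr (b : arc_quot) : P :=
  repr (b : {ideal_quot (arc_ideal : idealr P)}).

Lemma arc_reprK b : arc_pi (arc_repr b) = b.
Proof. exact: reprK. Qed.

Definition univ_arc : 'M[fps arc_quot]_(p, q) :=
  \matrix_(i, j) Fps (fun k => arc_pi << ucm (i, j, k) >>).

Lemma univ_arc_in_D : in_D h.+1 univ_arc.
Proof.
move=> u v incu incv.
pose X0 : 'M[fps P]_(p, q) := \matrix_(i, j) Fps (fun k => << ucm (i, j, k) >>).
have -> : univ_arc = map_mx (fps_map arc_pi) X0.
  by apply/matrixP=> i j; rewrite !mxE.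
rewrite map_arc_minor; apply/fpsP=> n /=.
rewrite -(rmorph0 arc_pi); apply/arc_pi_eq; rewrite subr0.
apply/arc_idealP=> A X DX.
have <- : minor u v X n = 0 by rewrite DX.
have -> : minor u v X = fps_map (arc_polyeval X) (minor u v X0); last by [].
rewrite -map_arc_minor; congr minor; apply/matrixP=> i j; rewrite !mxE.
by apply/fpsP=> k /=; rewrite /arc_polyeval eval_var.
Qed.

Section Lift.
Variables (A : comAlgType K) (X : 'M[fps A]_(p, q)) (DX : in_D h.+1 X).

Definition arc_lift_of of in_D h.+1 X := fun b : arc_quot =>
  arc_polyeval X (arc_repr b).
Local Notation arc_lift := (arc_lift_of DX).

Lemma arc_lift_pi f : arc_lift (arc_pi f) = arc_polyeval X f.
Proof.
apply/eqP; rewrite -subr_eq0 -rmorphB; apply/eqP.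
have /arc_idealP : arc_ideal (arc_repr (arc_pi f) - f); last exact.
by apply/arc_pi_eq; rewrite arc_reprK.
Qed.

Fact arc_lift_is_zmod_morphism : zmod_morphism arc_lift.
Proof.
move=> b c; rewrite -(arc_reprK b) -(arc_reprK c) -rmorphB !arc_lift_pi.
exact: rmorphB.
Qed.
Fact arc_lift_is_monoid_morphism : monoid_morphism arc_lift.
Proof.
split=> [|b c]; first by rewrite -(rmorph1 arc_pi) arc_lift_pi rmorph1.
rewrite -(arc_reprK b) -(arc_reprK c) -rmorphM !arc_lift_pi; exact: rmorphM.
Qed.
HB.instance Definition _ :=
  GRing.isZmodMorphism.Build arc_quot A arc_lift arc_lift_is_zmod_morphism.
HB.instance Definition _ :=
  GRing.isMonoidMorphism.Build arc_quot A arc_lift arc_lift_is_monoid_morphism.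
Fact arc_lift_is_scalable : scalable arc_lift.
Proof.
move=> a b; rewrite rmorphM /= arc_lift_pi /arc_polyeval eval_const.
by rewrite /= -scalerAl mul1r.
Qed.
HB.instance Definition _ :=
  GRing.isScalable.Build K arc_quot A *:%R arc_lift arc_lift_is_scalable.

Lemma arc_lift_univ : map_mx (fps_map arc_lift) univ_arc = X.
Proof.
apply/matrixP=> i j; rewrite !mxE; apply/fpsP=> k /=.
by rewrite arc_lift_pi /arc_polyeval eval_var.
Qed.

Lemma arc_lift_unique (g : {lrmorphism arc_quot -> A}) :
  map_mx (fps_map g) univ_arc = X -> g =1 arc_lift.
Proof.
move=> gX b; rewrite -(arc_reprK b) arc_lift_pi.
elim/malg_ind: (arc_repr b) => [|f1 f2 IH1 IH2|c m].
- by rewrite !rmorph0.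
- by rewrite !rmorphD /= IH1 IH2.
rewrite !rmorphM /=; congr (_ * _).
  by rewrite arc_pi_const /arc_polyeval eval_const linearZ /= rmorph1.
elim/cmonom_ind: m => [|w m IH]; first by rewrite !rmorph1.
rewrite malgUM !rmorphM /=; apply: congr2; last exact: IH.
rewrite /arc_polyeval eval_var -gX /arc_coef !mxE /=.
by case: w => [[i j] k].
Qed.
End Lift.

End ArcRing.

Theorem arc_ring_exists (K : fieldType) (p q h : nat) : (0 < h)%N ->
  exists (B : comAlgType K) (U : 'M[fps B]_(p, q)), is_arc_ring h U.
Proof.
case: h => // h _; exists (arc_quot K p q h), (univ_arc K p q h).
split=> [|A X DX]; first exact: univ_arc_in_D.
by exists (arc_lift_of DX); split; [apply: arc_lift_univ | apply: arc_lift_unique].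
Qed.

(* (n, [:: (u_1, v_1); ...; (u_h, v_h)]) stands for
   dbar^n (u_h, ..., u_1 | v_1, ..., v_h); indices start from 0. *)
Definition Jsym (p q : nat) : Type := (nat * seq ('I_p * 'I_q))%type.

Section Symbols.
Variables p q : nat.
Implicit Types J : Jsym p q.

Definition is_J J : bool :=
  (0 < size J.2)%N && sorted (fun a b : 'I_p * 'I_q => (a.1 < b.1)%N && (a.2 < b.2)%N) J.2.

Definition sz J : nat := size J.2.

Definition Jelt J : diffring p q :=
  dbar J.1 (minor (fun i => (tnth (in_tuple J.2) i).1)
                  (fun j => (tnth (in_tuple J.2) j).2)
                  (\matrix_(i, j) xvar (i, j, 0%N))).

(* [:: ((u_1, k_1), (v_1, l_1)); ...; ((u_h, k_h), (v_h, l_h))] stands for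
   ((u_h, k_h), ..., (u_1, k_1) | (v_1, l_1), ..., (v_h, l_h)). *)
Definition Esym : Type := seq (('I_p * nat) * ('I_q * nat)).
Implicit Types E F : Esym.

Definition is_E E : bool :=
  [&& (0 < size E)%N, uniq [seq e.1.1 | e <- E] & uniq [seq e.2.1 | e <- E]].

Definition wtE E : nat := (\sum_(e <- E) (e.1.2 + e.2.2))%N.

Definition normE E : Jsym p q :=
  (wtE E, zip (sort (fun i j : 'I_p => i <= j)%N [seq e.1.1 | e <- E])
              (sort (fun i j : 'I_q => i <= j)%N [seq e.2.1 | e <- E])).

(* Pairs (u, k) are compared lexicographically as (k, u). *)
Definition key (n : nat) (a : 'I_n * nat) : nat * nat := (a.2, a.1 : nat).

Definition leE E F : bool :=
  (size F <= size E)%N &&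
  all2 (fun e f => (key e.1 <= key f.1)%O && (key e.2 <= key f.2)%O)
    (take (size F) E) F.

Definition word E : seq (nat * nat) :=
  [seq key e.1 | e <- rev E] ++ [seq key e.2 | e <- rev E].

Definition precE E F : bool :=
  (size F < size E)%N ||
  (size E == size F) && ((wtE E < wtE F)%N ||
  (wtE E == wtE F) && (word E < word F)%O).

Definition largest (P : Esym -> Prop) E : Prop :=
  P E /\ forall F, P F -> F = E \/ precE F E.

Definition in_calE J E : Prop := is_E E /\ normE E = J.

Definition standardE (Es : seq Esym) : Prop :=
  let E a := nth [::] Es a in
  [/\ forall F, F \in Es -> is_E F,
      forall a, (a.+1 < size Es)%N -> leE (E a) (E a.+1),
      (0 < size Es)%N -> largest (in_calE (normE (E 0%N))) (E 0%N)
    & forall a, (a.+1 < size Es)%N ->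
        largest (fun F => in_calE (normE (E a.+1)) F /\ leE (E a) F) (E a.+1)].

Definition standard_monomial (Js : seq (Jsym p q)) : Prop :=
  exists Es : seq Esym, standardE Es /\ [seq normE E | E <- Es] = Js.

Definition standard_monomial_le (h : nat) (Js : seq (Jsym p q)) : Prop :=
  standard_monomial Js /\ forall J, J \in Js -> is_J J /\ (sz J <= h)%N.

Definition monomial (Js : seq (Jsym p q)) : diffring p q :=
  \prod_(J <- Js) Jelt J.

End Symbols.

(* The family (v i), indexed by the i satisfying P, is a basis of V. *)
Definition is_basis (K : fieldType) (V : lmodType K) (I : eqType)
    (P : I -> Prop) (v : I -> V) : Prop :=
  (forall (s : seq I) (c : I -> K), uniq s -> (forall i, i \in s -> P i) ->
     \sum_(i <- s) c i *: v i = 0 -> forall i, i \in s -> c i = 0) /\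
  (forall x : V, exists (s : seq I) (c : I -> K),
     (forall i, i \in s -> P i) /\ x = \sum_(i <- s) c i *: v i).

(* Main.v *)
From HB Require Import structures.
Require Import Defs.
From mathcomp Require Import all_boot all_order all_fingroup all_algebra.
From mathcomp Require Import finmap boolp monalg zify ring.

Set Implicit Arguments.
Unset Strict Implicit.
Unset Printing Implicit Defensive.

Import Order.TTheory GRing.Theory.
Import Order.DefaultProdLexiOrder Order.DefaultSeqLexiOrder.

Local Open Scope ring_scope.

(** Put r = h - 1. Reading the coefficients of the Taylor expansion of a minor as its
divided derivatives, the symbol dbar^n (u | v) becomes the coefficient of t^n in the minor
(u | v) of the universal arc U ([arc_eval_Jelt]). The statement then splits into a spanning
and an independence part, which are about power series matrices only.

Spanning. Call an element of the set E a refinement of its underlying symbol. The greedy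
procedure chooses for J_1, J_2, ... in turn the largest refinement lying above the previous
one; J_1 J_2 ... is standard when this never fails. In the polynomial ring in the x_ij^(k),
with no relation imposed, every product of symbols is a combination of products that are
standard from a given E0 or contain a symbol with no refinement above E0 ([all_straight]).
For E0 made of r copies of the least pairs, the latter symbols are those with more than r
rows, and they vanish on U ([large_symbol_vanishes]).

The straightening step ([straighten_pair]) concerns a symbol J1, of a size again written h,
its greedy refinement E1, and a symbol J2 of size h' <= h with no refinement above E1. Form
the square matrix X on the rows and columns of both, modulo its (h+1)-minors, and let a_m be
the sum, over the distributions of rows and columns that exchange only certain chosen ones,
of the signed products of a minor in degree N - m and the complementary minor in degree m.
Then sum_m C(m, i) a_m = 0 for all i below a bound k that counts the exchangeable rows and
columns ([moment_relation]). The proof substitutes t -> (1 + eps) t in one of the two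
minors: the sum of a_m (1 + eps)^m is a coefficient of the determinant of an interpolation
between X(t) and X((1 + eps) t), which differs from a matrix with zero (h+1)-minors by terms
divisible by eps, or by eps^2 where both row and column are exchangeable. Such relations
determine any k consecutive a_m from the others ([moment_window]). If the rows and columns
beyond suitable thresholds are multiplied by t, every term of the a_m outside a window of
length k, and every term but J1 J2 of the a_m that holds it, contains a symbol whose
refinements above E0 all precede E1; so do the multiples of (h+1)-minors. The existence of
such thresholds combines two facts. By a criterion of Hall's type for raising indexed
letters to prescribed indices ([lifting_exists]), the absence of a refinement of J2 above E1
means that one explicit inequality fails ([not_fits]). The maximality of E1 makes each of
its initial parts, up to exchanges of rows, as light as the constraint E0 permits
([greedy_gaps]). Induction on the total size and on E1 concludes.

Independence. Matrices X = A B, with A of size p x r and B of size r x q with generic power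
series entries, are arcs of D_h. To a chain E_1 <= E_2 <= ... attach the monomial which has,
for the j-th pair ((u, k), (v, l)) of each E_a, the factor a_uj^(k) b_jv^(l). If the
monomial of a chain occurs in the product of the symbols of a greedy chain, then the two
chains coincide or, where they first differ, the element of the former precedes that of the
latter ([facprod_support]); and the monomial of the greedy chain itself does occur
([facprod_lead]). So the products are triangular, hence independent. *)

(** * Determinants of sums of matrices *)

Section MaskedDeterminant.
Variable R : comNzRingType.

Lemma det_scale (n : nat) (a b : 'I_n -> R) (M : 'M[R]_n) :
  \det (\matrix_(i, j) (a i * M i j * b j)) = (\prod_i a i) * (\prod_i b i) * \det M.
Proof.
rewrite /determinant mulr_sumr; apply: eq_bigr => s _.
rewrite mulrCA; congr (_ * _).
have -> : \prod_i b i = \prod_i b (s i) by rewrite (reindex_inj (@perm_inj _ s)).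
rewrite -!big_split /=.
by apply: eq_bigr => i _; rewrite !mxE mulrAC.
Qed.

(** The summand of the expansion of [\det (A + B)] taking the rows in S from A, with columns
   T. *)
Definition masked (n : nat) (S T : {set 'I_n}) (A B : 'M[R]_n) : 'M[R]_n :=
  \matrix_(i, j) if i \in S then (if j \in T then A i j else 0)
                 else (if j \in T then 0 else B i j).

Lemma masked_prod0 (n : nat) (S T : {set 'I_n}) (A B : 'M[R]_n) (s : 'S_n) :
  T != s @: S -> \prod_i masked S T A B i (s i) = 0.
Proof.
move=> neq; have [i Hi] : exists i, (i \in S) != (s i \in T).
  apply/existsP; apply: contraNT neq; rewrite negb_exists => /forallP E.
  apply/eqP/setP => j; rewrite -(permKV s j) mem_imset; last exact: perm_inj.
  by have := E (s^-1%g j); rewrite negbK => /eqP ->.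
rewrite (bigD1 i) //= mxE.
by move: Hi; case: (i \in S); case: (s i \in T) => //= _; rewrite mul0r.
Qed.

Lemma masked_card (n : nat) (S T : {set 'I_n}) (A B : 'M[R]_n) :
  #|S| != #|T| -> \det (masked S T A B) = 0.
Proof.
move=> neq; rewrite /determinant big1 // => s _.
rewrite masked_prod0 ?mulr0 //; apply: contraNneq neq => ->.
by rewrite card_imset //; apply: perm_inj.
Qed.

(** Each permutation s contributes only to T = s @: S, so summing over all T costs nothing
   and makes rows and columns symmetric. *)
Lemma det_addE (n : nat) (A B : 'M[R]_n) :
  \det (A + B) = \sum_(S : {set 'I_n}) \sum_(T : {set 'I_n}) \det (masked S T A B).
Proof.
under eq_bigr => S _ do rewrite /determinant exchange_big /=.
rewrite /determinant exchange_big /=; apply: eq_bigr => s _.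
under [RHS]eq_bigr => S _ do rewrite -mulr_sumr.
rewrite -mulr_sumr; congr (_ * _).
under eq_bigr => i _ do rewrite mxE.
rewrite bigA_distr /=; apply: eq_bigr => S _.
rewrite (bigD1 (s @: S)) //= [X in _ + X]big1 ?addr0; last first.
  by move=> T neT; apply: masked_prod0.
apply: eq_bigr => i _; rewrite mxE mem_imset; last exact: perm_inj.
by case: (i \in S).
Qed.

Lemma det_mxsub_inj (n : nat) (f g : 'I_n -> 'I_n) :
  injective f -> injective g ->
  exists b : bool, forall M : 'M[R]_n, \det M = (-1) ^+ b * \det (mxsub f g M).
Proof.
move=> injf injg; exists (odd_perm (perm injf) (+) odd_perm (perm injg)) => M.
have -> : mxsub f g M = row_perm (perm injf) (col_perm (perm injg) M).
  by apply/matrixP=> i j; rewrite !mxE !permE.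
rewrite row_permE col_permE !det_mulmx !det_perm odd_permV signr_addb.
by case: (odd_perm (perm injf)); case: (odd_perm (perm injg));
  rewrite /= ?expr0 ?expr1 ?(mulr1, mul1r, mulN1r, mulrN1, opprK).
Qed.

Definition glue (n a b : nat) (f1 : 'I_a -> 'I_n) (f2 : 'I_b -> 'I_n)
  (k : 'I_(a + b)) : 'I_n := match split k with inl i => f1 i | inr j => f2 j end.

(** Laplace expansion. The sign depends on the enumerations of S and T but not on the
   matrices or the ring elements, so that one sign serves all A and B. *)
Lemma det_masked (n a b : nat) (S T : {set 'I_n})
    (f1 g1 : 'I_a -> 'I_n) (f2 g2 : 'I_b -> 'I_n) : n = (a + b)%N ->
    injective (glue f1 f2) -> injective (glue g1 g2) ->
    (forall i, f1 i \in S) -> (forall i, f2 i \notin S) ->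
    (forall i, g1 i \in T) -> (forall i, g2 i \notin T) ->
  exists e : bool, forall A B : 'M[R]_n, \det (masked S T A B) =
    (-1) ^+ e * (\det (mxsub f1 g1 A) * \det (mxsub f2 g2 B)).
Proof.
move=> e; move: S T f1 g1 f2 g2; rewrite e => S T f1 g1 f2 g2.
move=> injf injg S1 S2 T1 T2.
have [c E] := det_mxsub_inj injf injg; exists c => A B; rewrite E; congr (_ * _).
rewrite -(det_ublock _ 0); congr determinant.
apply/matrixP=> i j; rewrite !mxE /glue.
case: (split i) => i1; rewrite !mxE; case: (split j) => j1; rewrite ?mxE.
- by rewrite S1 T1.
- by rewrite S1 (negPf (T2 _)).
- by rewrite (negPf (S2 _)) T1.
- by rewrite (negPf (S2 _)) (negPf (T2 _)).
Qed.

Lemma minors_vanish_above (m n h a : nat) (A : 'M[R]_(m, n)) :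
    (forall (u : 'I_h -> 'I_m) (v : 'I_h -> 'I_n), \det (mxsub u v A) = 0) ->
    (h <= a)%N -> forall (u : 'I_a -> 'I_m) (v : 'I_a -> 'I_n), \det (mxsub u v A) = 0.
Proof.
move=> A0; elim: a => [|a IH].
  by rewrite leqn0 => /eqP h0; move: A0; rewrite h0.
rewrite leq_eqVlt => /orP [/eqP <- //|ha] u v.
rewrite (expand_det_row _ ord0) big1 // => j _.
rewrite [cofactor _ _ _](_ : _ = 0) ?mulr0 // /cofactor.
have -> : row' ord0 (col' j (mxsub u v A)) =
    mxsub (u \o lift ord0) (v \o lift j) A by apply/matrixP=> x y; rewrite !mxE.
by rewrite IH // mulr0.
Qed.

(** For sets S with h elements, the defaults of nth are never reached. *)
Definition selL (h h' : nat) (S : {set 'I_(h + h')}) (i : 'I_h) : 'I_(h + h') :=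
  nth (lshift h' i) (enum S) i.
Definition selR (h h' : nat) (S : {set 'I_(h + h')}) (i : 'I_h') : 'I_(h + h') :=
  nth (rshift h i) (enum (~: S)) i.

Lemma nth_enum_mem (n : nat) (S : {set 'I_n}) x0 k : (k < #|S|)%N ->
  nth x0 (enum S) k \in S.
Proof. by move=> kS; rewrite -mem_enum mem_nth // -cardE. Qed.

Lemma selL_in h h' (S : {set 'I_(h + h')}) i : #|S| = h -> selL S i \in S.
Proof. by move=> cS; apply: nth_enum_mem; rewrite cS. Qed.

Lemma selR_in h h' (S : {set 'I_(h + h')}) i : #|S| = h -> selR S i \notin S.
Proof.
move=> cS; rewrite -in_setC; apply: nth_enum_mem.
by have := cardsC S; rewrite card_ord cS => /addnI ->.
Qed.

Lemma sel_inj h h' (S : {set 'I_(h + h')}) : #|S| = h ->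
  injective (glue (selL S) (selR S)).
Proof.
move=> cS; have cS' : #|~: S| = h' by have := cardsC S; rewrite card_ord cS => /addnI.
move=> k1 k2; rewrite /glue -{2}(splitK k1) -{2}(splitK k2).
case: (split k1) => i; case: (split k2) => j /= E.
- congr (lshift _ _); apply/val_inj/eqP.
  move/eqP: E; rewrite /selL (set_nth_default (lshift h' j)) -?cardE ?cS //.
  by rewrite nth_uniq -?cardE ?cS ?enum_uniq.
- by have := selR_in j cS; rewrite -E selL_in.
- by have := selR_in i cS; rewrite E selL_in.
- congr (rshift _ _); apply/val_inj/eqP.
  move/eqP: E; rewrite /selR (set_nth_default (rshift h j)) -?cardE ?cS' //.
  by rewrite nth_uniq -?cardE ?cS' ?enum_uniq.
Qed.

Lemma det_masked_rank (n h : nat) (S T : {set 'I_n}) (A B : 'M[R]_n) :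
    (forall (u v : 'I_h.+1 -> 'I_n), \det (mxsub u v A) = 0) ->
  (h < #|S|)%N -> \det (masked S T A B) = 0.
Proof.
move=> A0 hS; have [eST|/masked_card //] := eqVneq #|S| #|T|.
have nE : n = (#|S| + #|~: S|)%N by rewrite cardsC card_ord.
move: nE (erefl #|S|) (esym eST) hS; move: {1 3 4 5}#|S| {1}#|~: S| => a b nE.
subst n => eSa eT ha.
have injS := sel_inj eSa; have injT := sel_inj eT.
have [e ->] := det_masked erefl injS injT (fun i => selL_in i eSa) (fun i => selR_in i eSa)
  (fun i => selL_in i eT) (fun i => selR_in i eT).
by rewrite (minors_vanish_above A0) // mul0r mulr0.
Qed.

(** A term with rows S taken from Y0 vanishes when S has more than h elements, as the minors
   of Y0 do. Otherwise at least n - h rows come from the perturbation, and all but those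
   outside y carry a factor eps; likewise for the columns. *)
Lemma det_perturb (n h : nat) (eps : R) (y z : pred 'I_n) (Y0 Q : 'M[R]_n) :
    (forall (u v : 'I_h.+1 -> 'I_n), \det (mxsub u v Y0) = 0) ->
  exists g, \det (Y0 + \matrix_(i, j) (eps ^+ y i * Q i j * eps ^+ z j)) =
    eps ^+ ((n - h - #|predC y|) + (n - h - #|predC z|)) * g.
Proof.
move=> Y00; set Qe := (X in Y0 + X); set k := (_ + _)%N.
suff [G HG] : exists G : {set 'I_n} -> {set 'I_n} -> R,
    forall S T, \det (masked S T Y0 Qe) = eps ^+ k * G S T.
  exists (\sum_S \sum_T G S T); rewrite det_addE mulr_sumr.
  by apply: eq_bigr => S _; rewrite mulr_sumr; apply: eq_bigr => T _.
(* The quotient is given explicitly: the determinant of Q with its scalings taken out. *)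
exists (fun S T : {set 'I_n} => if #|S| != #|T| then 0 else if (h < #|S|)%N then 0 else
  eps ^+ ((\sum_(i in ~: S) y i + \sum_(i in ~: T) z i) - k) * \det (masked S T Y0 Q)).
move=> S T; case: ifP => [/masked_card->|/negbFE/eqP eST]; first by rewrite mulr0.
case: ltnP => [hS|Sh]; first by rewrite (det_masked_rank _ _ Y00) // mulr0.
pose ex (U : {set 'I_n}) (w : pred 'I_n) i := if i \in U then 1 else eps ^+ w i.
have -> : masked S T Y0 Qe =
    \matrix_(i, j) (ex S y i * masked S T Y0 Q i j * ex T z j).
  apply/matrixP=> i j; rewrite !mxE /ex.
  by case: (i \in S); case: (j \in T); rewrite ?mulr0 ?mul0r ?mulr1 ?mul1r.
have exE (U : {set 'I_n}) w : \prod_i ex U w i = eps ^+ (\sum_(i in ~: U) w i).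
  rewrite -prodrXr [RHS]big_mkcond /=; apply: eq_bigr => i _.
  by rewrite /ex in_setC; case: (i \in U).
rewrite det_scale !exE -exprD mulrA -exprD subnKC //.
suff H (U : {set 'I_n}) (w : pred 'I_n) : (#|U| <= h)%N ->
    (n - h - #|predC w| <= \sum_(i in ~: U) w i)%N.
  by rewrite leq_add // H // -eST.
move=> Uh; rewrite -subnDA leq_subLR.
apply: (@leq_trans (#|U| + #|predC w| + \sum_(i in ~: U) w i)); last by rewrite leq_add2r leq_add2r.
rewrite -addnA -leq_subLR.
have -> : (n - #|U|)%N = #|~: U| by have := cardsC U; rewrite card_ord; lia.
have -> : (\sum_(i in ~: U) w i = #|[set i in ~: U | w i]|)%N.
  by rewrite -sum1dep_card big_mkcondr /=; apply: eq_bigr => i _; case: (w i).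
rewrite -(cardsID [set i | w i] (~: U)) addnC leq_add //.
  by rewrite subset_leq_card //; apply/subsetP => i; rewrite !inE => /andP [].
rewrite subset_leq_card //; apply/subsetP => i; rewrite !inE.
by case/andP=> -> ->.
Qed.

End MaskedDeterminant.

(** * Binomial moments of products of minors *)

Section Substitution.
Variables (B C : comNzRingType) (iota : {rmorphism B -> C}) (x : C).

(** The substitution t -> x t. *)
Definition fps_ev (f : fps B) : fps C := Fps (fun n => iota (f n) * x ^+ n).

Fact fps_ev_is_zmod_morphism : zmod_morphism fps_ev.
Proof. by move=> f g; apply/fpsP=> n /=; rewrite rmorphB mulrBl. Qed.
Fact fps_ev_is_monoid_morphism : monoid_morphism fps_ev.
Proof.
split=> [|f g]; apply/fpsP=> n /=.
  by case: n => [|n]; rewrite ?rmorph1 ?expr0 ?mulr1 //= rmorph0 mul0r.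
rewrite rmorph_sum mulr_suml; apply: eq_bigr => i _ /=.
rewrite rmorphM mulrACA -exprD subnKC //; exact: (ltn_ord i).
Qed.
HB.instance Definition _ := GRing.isZmodMorphism.Build (fps B) (fps C)
  fps_ev fps_ev_is_zmod_morphism.
HB.instance Definition _ := GRing.isMonoidMorphism.Build (fps B) (fps C)
  fps_ev fps_ev_is_monoid_morphism.
End Substitution.

Section Constants.
Variable C : comNzRingType.

Definition fpsC (c : C) : fps C := Fps (fun n => if n is 0%N then c else 0).

Lemma fpsCM c f n : (fpsC c * f) n = c * f n.
Proof.
by rewrite /= big_ord_recl /= subn0 big1 ?addr0 // => i _; rewrite mul0r.
Qed.

Fact fpsC_is_zmod_morphism : zmod_morphism fpsC.
Proof. by move=> a b; apply/fpsP=> [[|n]] //=; rewrite subr0. Qed.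
Fact fpsC_is_monoid_morphism : monoid_morphism fpsC.
Proof.
split=> [|a b]; apply/fpsP=> n; first by case: n.
by rewrite fpsCM; case: n => [|n] //=; rewrite mulr0.
Qed.
HB.instance Definition _ := GRing.isZmodMorphism.Build C (fps C)
  fpsC fpsC_is_zmod_morphism.
HB.instance Definition _ := GRing.isMonoidMorphism.Build C (fps C)
  fpsC fpsC_is_monoid_morphism.

Lemma fps_sumE (I : Type) (r : seq I) (P : pred I) (F : I -> fps C) n :
  (\sum_(i <- r | P i) F i) n = \sum_(i <- r | P i) F i n.
Proof. by rewrite (big_morph (fun f : fps C => f n) (fun _ _ => erefl) (erefl _)). Qed.

Lemma expr1D_mod2 (a : C) n : exists r, (1 + a) ^+ n = 1 + a *+ n + a ^+ 2 * r.
Proof.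
elim: n => [|n [r IH]]; first by exists 0; rewrite expr0 mulr0 !addr0.
exists (r + a * r + n%:R); rewrite exprS IH mulrSr -(mulr_natr a n).
by move: (n%:R : C) => m; ring.
Qed.

End Constants.

(** The series f(t), f((1 + eps) t) and f((1 + mu eps) t) agree to first order in eps, and
   the last one agrees to second order with the affine combination of the first two. *)
Lemma ev_interpolation (B C : comNzRingType) (iota : {rmorphism B -> C}) (mu eps : C)
    (f : fps B) : exists q1 q2 q3 : fps C,
  [/\ fps_ev iota 1 f = fps_ev iota (1 + mu * eps) f + fpsC eps * q1,
      fps_ev iota (1 + eps) f = fps_ev iota (1 + mu * eps) f + fpsC eps * q2
    & fpsC (1 - mu) * fps_ev iota 1 f + fpsC mu * fps_ev iota (1 + eps) f =
      fps_ev iota (1 + mu * eps) f + fpsC eps ^+ 2 * q3].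
Proof.
have [rt rtE] := choice (expr1D_mod2 (mu * eps)).
have [rs rsE] := choice (expr1D_mod2 eps).
exists (Fps (fun n => - (iota (f n) * (mu *+ n + mu ^+ 2 * eps * rt n)))).
exists (Fps (fun n => iota (f n) * (1 *+ n + eps * rs n - mu *+ n - mu ^+ 2 * eps * rt n))).
exists (Fps (fun n => iota (f n) * (mu * rs n - mu ^+ 2 * rt n))).
have fpsDE (g g' : fps C) n : (g + g') n = g n + g' n by [].
split; apply/fpsP=> n; rewrite -?rmorphXn !(fpsDE, fpsCM) /fps_ev /fps_coef /=.
- rewrite rtE expr1n -(mulr_natr mu) -(mulr_natr (mu * eps)).
  by move: (n%:R : C) (iota _) (rt _) => m c d; ring.
- rewrite rtE rsE -(mulr_natr mu) -(mulr_natr (mu * eps)) -(mulr_natr eps).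
  by move: (n%:R : C) (iota _) (rt _) (rs _) => m c d e; ring.
- rewrite rtE rsE expr1n -(mulr_natr (mu * eps)) -(mulr_natr eps).
  by move: (n%:R : C) (iota _) (rt _) (rs _) => m c d e; ring.
Qed.

(** The polynomials (1 - 'X)^(n-j) 'X^j are unitriangular with respect to the monomials
   'X^j, so that divisibility of a combination descends to its coefficients. *)
Lemma unitriangular_dvd (D : comNzRingType) (n : nat) (H : 'I_n.+1 -> D) (d : D)
    (g : {poly D}) :
    \sum_(j < n.+1) ((1 - 'X) ^+ (n - j) * 'X^j) * (H j)%:P = d%:P * g ->
  forall j, exists r, H j = d * r.
Proof.
move=> E j; have [m] := ubnP (val j); elim: m j => // m IH j /ltnSE jm.
have /choice [r rE] : forall i : 'I_n.+1, exists r, (i < j)%N -> H i = d * r.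
  move=> i; case: (ltnP i j) => [ij|_]; last by exists 0.
  by have [r] := IH i (leq_trans ij jm); exists r.
have c0 k : ((1 - 'X : {poly D}) ^+ k)`_0 = 1.
  by rewrite -horner_coef0 horner_exp !hornerE subr0 expr1n.
move/(congr1 (fun p : {poly D} => p`_j)): E; rewrite coefCM coef_sum.
have cE (i : 'I_n.+1) : ((1 - 'X) ^+ (n - i) * 'X^i * (H i)%:P)`_j =
    (if (j < i)%N then 0 else ((1 - 'X : {poly D}) ^+ (n - i))`_(j - i)) * H i.
  by rewrite coefMC coefMXn.
under eq_bigr => i _ do rewrite cE.
rewrite (bigD1 j) //= ltnn subnn c0 mul1r => EE.
exists (g`_j - \sum_(i < n.+1 | i != j)
  (if (j < i)%N then 0 else ((1 - 'X : {poly D}) ^+ (n - i))`_(j - i) * r i)).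
rewrite mulrBr -EE mulr_sumr -addrA -sumrB big1 ?addr0 // => i ne.
case: ltngtP => [|ij|/val_inj eij]; first by rewrite mul0r mulr0 subrr.
  by rewrite rE // mulrCA subrr.
by rewrite eij eqxx in ne.
Qed.

Section MomentRelation.
Variables (B : comNzRingType) (h h' : nat).
Local Notation I := 'I_(h + h').
Implicit Types (S T : {set I}) (rt rs ct cs : pred I) (X : 'M[fps B]_(h + h')).

(** Rows in S go to the first minor, which receives only rows satisfying rt; the others go
   to the second, which receives only rows satisfying rs. *)
Definition allowed rt rs S : bool :=
  (#|S| == h) && [forall i, if i \in S then rt i else rs i].

(** A Laplace expansion over the allowed distributions of rows and columns, with each of the
   two factors in one degree. *)
Definition shuffle rt rs ct cs (sg : {set I} -> {set I} -> bool) X (n m : nat) : B :=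
  \sum_(S | allowed rt rs S) \sum_(T | allowed ct cs T)
    (-1) ^+ sg S T * (\det (mxsub (@selL h h' S) (@selL h h' T) X) n *
                      \det (mxsub (@selR h h' S) (@selR h h' T) X) m).

(** Let A be X(t) restricted to the rows rt and columns ct, and A' be X((1 + eps) t)
   restricted to rs and cs. The part of degree (h, h') in 1 - mu and mu of det((1 - mu) A +
   mu A') is the sum of the shuffles, each weighted by (1 + eps)^m. The same matrix is, up
   to terms divisible by eps for each exchangeable row and again for each exchangeable
   column, X((1 + mu eps) t) with scaled rows and columns, all of whose (h+1)-minors vanish.
   So the sum is divisible by eps^k, and the coefficients of the lower powers of eps are the
   binomial moments. *)
Lemma moment_relation rt rs ct cs X :
    (forall i, rt i || rs i) -> (forall j, ct j || cs j) ->
    (forall u v : 'I_h.+1 -> I, \det (mxsub u v X) = 0) ->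
  exists sg, forall N i,
    (i < (h' - #|[predC predI rt rs]|) + (h' - #|[predC predI ct cs]|))%N ->
    \sum_(m < N.+1) shuffle rt rs ct cs sg X (N - m) m *+ 'C(m, i) = 0.
Proof.
move=> rtrs ctcs X0; set k := (h' - _ + _)%N.
have /choice [sg sgE] : forall ST : {set I} * {set I}, exists e : bool,
    #|ST.1| = h -> #|ST.2| = h -> forall A A' : 'M[fps {poly B}]_(h + h'),
    \det (masked ST.1 ST.2 A A') = (-1) ^+ e *
    (\det (mxsub (@selL h h' ST.1) (@selL h h' ST.2) A) *
     \det (mxsub (@selR h h' ST.1) (@selR h h' ST.2) A')).
  case=> S T /=; case: (eqVneq #|S| h) => [cS|nS]; last first.
    by exists false => cS; rewrite cS eqxx in nS.
  case: (eqVneq #|T| h) => [cT|nT]; last first.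
    by exists false => _ cT; rewrite cT eqxx in nT.
  have [e E] := det_masked (fps {poly B}) (S := S) (T := T) erefl (sel_inj cS) (sel_inj cT)
    (fun i => selL_in i cS) (fun i => selR_in i cS)
    (fun i => selL_in i cT) (fun i => selR_in i cT).
  by exists e => _ _.
exists (fun S T => sg (S, T)) => N i ik.
pose polyCB : {rmorphism B -> {poly B}} := @polyC B.
pose X1 := map_mx (fps_ev polyCB 1) X; pose Xs := map_mx (fps_ev polyCB (1 + 'X)) X.
pose A : 'M[fps {poly B}]_(h + h') := \matrix_(i, j) (X1 i j *+ (rt i && ct j)).
pose A' : 'M[fps {poly B}]_(h + h') := \matrix_(i, j) (Xs i j *+ (rs i && cs j)).
pose D S T := \det (masked S T A A').
have signE (R : comNzRingType) (b : bool) (f : fps R) n : ((-1) ^+ b * f) n = (-1) ^+ b * f n.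
  by case: b; rewrite ?expr0 ?mul1r // expr1 !mulN1r.
(* The Laplace expansion, with the substitution making each second factor of degree m a
   multiple of (1 + 'X)^m; here 'X is eps. *)
have step2 n : \sum_(S : {set I} | #|S| == h) \sum_(T : {set I}) (D S T) n =
    \sum_(m < n.+1) (shuffle rt rs ct cs (fun S T => sg (S, T)) X (n - m) m)%:P * (1 + 'X) ^+ m.
  under [RHS]eq_bigr => m _ do rewrite /shuffle rmorph_sum mulr_suml /=.
  rewrite [RHS]exchange_big /= /allowed [RHS]big_mkcondr /=; apply: eq_bigr => S /eqP cS.
  case: forallP => [okS|]; last first.
    move/forallP; rewrite negb_forall => /existsP [i0 Hi0]; apply: big1 => T _.
    suff -> : D S T = 0 by [].
    rewrite /D (expand_det_row _ i0) big1 // => j _.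
    rewrite !mxE; move: Hi0; case: (i0 \in S) => /negPf ->; rewrite ?mulr0n;
      by case: (j \in T); rewrite mul0r.
  under [RHS]eq_bigr => m _ do rewrite rmorph_sum mulr_suml /=.
  rewrite [RHS]exchange_big /= [RHS]big_mkcond /=; apply: eq_bigr => T _.
  case: ifP => [/andP [/eqP cT /forallP okT]|/negbT]; last first.
    rewrite negb_and => /orP [nT|]; first by rewrite /D masked_card // cS eq_sym.
    rewrite negb_forall => /existsP [j0 Hj0].
    suff -> : D S T = 0 by [].
    rewrite /D (expand_det_col _ j0) big1 // => i1 _.
    rewrite !mxE; move: Hj0; case: (j0 \in T) => /negPf ->; rewrite ?andbF ?mulr0n;
      by case: (i1 \in S); rewrite mul0r.
  rewrite /D (sgE (S, T)) // signE.
  have -> : mxsub (@selL h h' S) (@selL h h' T) A =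
      map_mx (fps_ev polyCB 1) (mxsub (@selL h h' S) (@selL h h' T) X).
    apply/matrixP=> a b; rewrite !mxE.
    have := okS (selL S a); have := okT (selL T b).
    by rewrite !selL_in // => -> ->.
  have -> : mxsub (@selR h h' S) (@selR h h' T) A' =
      map_mx (fps_ev polyCB (1 + 'X)) (mxsub (@selR h h' S) (@selR h h' T) X).
    apply/matrixP=> a b; rewrite !mxE.
    have := okS (selR S a); have := okT (selR T b).
    by rewrite !(negPf (selR_in _ _)) // => -> ->.
  rewrite !det_map_mx mulrC [_ * fps_ev _ _ _]mulrC mulr_suml /=.
  apply: eq_bigr => m _; rewrite expr1n mulr1 !rmorphM rmorphXn rmorphN1 /=.
  rewrite [LHS]mulrC -!mulrA; congr (_ * _).
  by rewrite [RHS]mulrCA; congr (_ * _); rewrite mulrC.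
(* Divisibility by eps^k, seen in a further variable mu. *)
have step1 n : exists r, \sum_(S : {set I} | #|S| == h) \sum_(T : {set I}) (D S T) n = 'X^k * r.
  pose C : comNzRingType := {poly {poly B}}.
  pose P2 : {rmorphism {poly B} -> C} := @polyC {poly B}.
  pose mu : C := 'X; pose eps : C := 'X%:P.
  pose M := (\matrix_(i, j) (fpsC (1 - mu) * map_mx (fps_map P2) A i j)) +
            (\matrix_(i, j) (fpsC mu * map_mx (fps_map P2) A' i j)).
  have detM : \det M = \sum_(S : {set I}) \sum_(T : {set I})
      fpsC ((1 - mu) ^+ #|S| * mu ^+ (h + h' - #|S|)) * fps_map P2 (D S T).
    rewrite det_addE; apply: eq_bigr => S _; apply: eq_bigr => T _.
    rewrite /D -det_map_mx.
    have -> : masked S T (\matrix_(i, j) (fpsC (1 - mu) * map_mx (fps_map P2) A i j))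
        (\matrix_(i, j) (fpsC mu * map_mx (fps_map P2) A' i j)) =
      \matrix_(i, j) ((if i \in S then fpsC (1 - mu) else fpsC mu) *
         map_mx (fps_map P2) (masked S T A A') i j * 1).
      apply/matrixP=> a b; rewrite !mxE mulr1.
      by case: (a \in S); case: (b \in T); rewrite ?mxE // rmorph0 mulr0.
    rewrite det_scale big1_eq mulr1; congr (_ * _).
    rewrite (bigID (mem S)) /= rmorphM !rmorphXn /=; congr (_ * _).
      by rewrite (eq_bigr (fun=> fpsC (1 - mu))) => [|a ->//]; rewrite prodr_const.
    rewrite (eq_bigr (fun=> fpsC mu)) => [|a /negPf ->//]; rewrite prodr_const.
    congr (_ ^+ _); have -> : (h + h' - #|S|)%N = #|~: S|.
      by have := cardsC S; rewrite card_ord; lia.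
    by apply: eq_card => a; rewrite !inE.
  pose iota : {rmorphism B -> C} := (P2 \o polyCB)%FUN.
  pose Y0 : 'M[fps C]_(h + h') := \matrix_(i, j)
    (fpsC ((1 - mu) *+ rt i + mu *+ rs i) * map_mx (fps_ev iota (1 + mu * eps)) X i j *
     fpsC ((1 - mu) *+ ct j + mu *+ cs j)).
  have Y00 (u v : 'I_h.+1 -> I) : \det (mxsub u v Y0) = 0.
    have -> : mxsub u v Y0 = \matrix_(i, j) (fpsC ((1 - mu) *+ rt (u i) + mu *+ rs (u i)) *
        map_mx (fps_ev iota (1 + mu * eps)) (mxsub u v X) i j *
        fpsC ((1 - mu) *+ ct (v j) + mu *+ cs (v j))) by apply/matrixP=> a b; rewrite !mxE.
    by rewrite det_scale det_map_mx X0 rmorph0 mulr0.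
  have [Q QE] : exists Q : I * I -> fps C, forall ij : I * I,
      fpsC (1 - mu) * map_mx (fps_map P2) A ij.1 ij.2 +
        fpsC mu * map_mx (fps_map P2) A' ij.1 ij.2 =
      Y0 ij.1 ij.2 + fpsC eps ^+ (rt ij.1 && rs ij.1) * Q ij * fpsC eps ^+ (ct ij.2 && cs ij.2).
    suff /choice [Q HQ] : forall ij : I * I, exists q, fpsC (1 - mu) * map_mx (fps_map P2) A ij.1 ij.2 +
        fpsC mu * map_mx (fps_map P2) A' ij.1 ij.2 =
      Y0 ij.1 ij.2 + fpsC eps ^+ (rt ij.1 && rs ij.1) * q * fpsC eps ^+ (ct ij.2 && cs ij.2).
      by exists Q.
    case=> a b /=; rewrite !mxE /=.
    have evP (x : {poly B}) (f : fps B) : fps_map P2 (fps_ev polyCB x f) = fps_ev iota (P2 x) f.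
      by apply/fpsP=> l /=; rewrite rmorphM rmorphXn.
    rewrite !rmorphMn /= !evP !rmorphD !rmorphMn !rmorph1 /= -/mu -/eps.
    have [q1 [q2 [q3 []]]] := ev_interpolation iota mu eps (X a b).
    rewrite rmorphB rmorph1 rmorphN /=.
    move: (fps_ev iota 1 (X a b)) (fps_ev iota (1 + eps) (X a b))
      (fps_ev iota (1 + mu * eps) (X a b)) (fpsC mu) (fpsC eps) => xa xb xc m e.
    move=> E1 E2 E3.
    have := rtrs a; have := ctcs b.
    case: (rt a); case: (rs a); case: (ct b); case: (cs b) => //= _ _; rewrite ?mulr1n ?mulr0n ?mulr0 ?addr0 ?add0r.
    - by exists q3; rewrite E3; ring.
    - by exists ((1 - m) * q1); rewrite E1; ring.
    - by exists (m * q2); rewrite E2; ring.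
    - by exists ((1 - m) * q1); rewrite E1; ring.
    - by exists ((1 - m) * xa - (1 - m) * xc * (1 - m)); ring.
    - by exists (- (1 - m) * xc * m); ring.
    - by exists (m * q2); rewrite E2; ring.
    - by exists (- (m * xc * (1 - m))); ring.
    - by exists (m * xb - m * xc * m); ring.
  have [g gE] : exists g, \det M = fpsC eps ^+ k * g.
    pose Qm := \matrix_(i < h + h', j < h + h') Q (i, j).
    have -> : M = Y0 + \matrix_(i, j) (fpsC eps ^+ (predI rt rs i) * Qm i j * fpsC eps ^+ (predI ct cs j)).
      apply/matrixP=> a b; rewrite /M [LHS]mxE [X in X + _]mxE [X in _ + X]mxE (QE (a, b)) /=.
      by rewrite [RHS]mxE; congr (_ + _); rewrite !mxE.
    have [g ->] := det_perturb (fpsC eps) (predI rt rs) (predI ct cs) Qm Y00.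
    by exists g; rewrite /k !addKn.
  move: gE; rewrite detM => /(congr1 (fun f : fps C => f n)).
  rewrite -rmorphXn fpsCM /eps -rmorphXn => E.
  have nS (S : {set I}) : (h + h' - #|S| < (h + h').+1)%N by rewrite ltnS leq_subr.
  pose Hs (j : 'I_(h + h').+1) : {poly B} :=
    \sum_(S : {set I} | Ordinal (nS S) == j) \sum_(T : {set I}) D S T n.
  have hj : (h' < (h + h').+1)%N by rewrite ltnS leq_addl.
  have E' : \sum_(j < (h + h').+1) ((1 - 'X) ^+ (h + h' - j) * 'X^j) * (Hs j)%:P = ('X^k)%:P * g n.
    rewrite -E fps_sumE.
    rewrite [RHS](partition_big (fun S => Ordinal (nS S)) predT) //=; apply: eq_bigr => j _.
    rewrite /Hs rmorph_sum mulr_sumr; apply: eq_bigr => S /eqP <- /=.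
    rewrite rmorph_sum mulr_sumr fps_sumE; apply: eq_bigr => T _.
    rewrite fpsCM subKn //; by have := max_card (mem S); rewrite card_ord.
  (* The index h' is that of the sets S with h elements. *)
  have [r rE] := unitriangular_dvd E' (Ordinal hj).
  exists r; rewrite -rE; apply: eq_bigl => S; rewrite -val_eqE /=.
  by have := max_card (mem S); rewrite card_ord; lia.
have [r] := step1 N; rewrite step2 => /(congr1 (fun p : {poly B} => p`_i)).
rewrite coefXnM ik coef_sum => E; rewrite -[RHS]E; apply: eq_bigr => m _.
rewrite coefCM -mulr_natr; congr (_ * _); rewrite exprDn coef_sum.
under eq_bigr => j _ do rewrite expr1n mul1r coefMn coefXn.
case: (ltnP i m.+1) => [im|mi].
  rewrite (bigD1 (Ordinal im)) //= eqxx big1 ?addr0 // => j ne.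
  by case: eqP => [ij|_]; [rewrite -val_eqE /= ij eqxx in ne | rewrite mul0rn].
rewrite bin_small // big1 // => j _.
by case: eqP => [ij|_]; [have := ltn_ord j; rewrite -ij; lia | rewrite mul0rn].
Qed.
End MomentRelation.

(** * Raising letters to prescribed indices *)

Section Keys.
Variable n : nat.
Local Notation letter := ('I_n * nat)%type.
Implicit Types (a b : letter) (s t : seq letter).

Definition leK a b : bool := (key a <= key b)%O.

(** A letter below (v, l) with index u has second component at most l, and less than l when
   v < u: moving to a smaller index is paid by one unit. *)
Lemma leKE a b : leK a b = (a.2 + (b.1 < a.1) <= b.2)%N.
Proof.
case: a b => [u k] [v l]; rewrite /leK /key /= lexi_pair !leEnat implybE.
by case: (ltngtP k l); case: (ltngtP u v); lia.
Qed.

Lemma leK_refl : reflexive leK. Proof. by move=> a; exact: lexx. Qed.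
Lemma leK_trans : transitive leK. Proof. by move=> b a c; exact: le_trans. Qed.

Lemma key_inj : injective (@key n).
Proof. by case=> [u k] [v l] [-> /val_inj ->]. Qed.

Definition sumk s : nat := (\sum_(a <- s) a.2)%N.
Definition geq_count (d : nat) (w : seq 'I_n) : nat := count (fun u : 'I_n => d <= u)%N w.
(** Costs increase with the letters ([all2_leK_cost]): for s below t letterwise, the cost of
   s bounds the weight of t from below in terms of the indices of t alone. *)
Definition cost (d : nat) s : nat := (sumk s + geq_count d (map fst s))%N.

Lemma sumk_cons a s : sumk (a :: s) = (a.2 + sumk s)%N.
Proof. by rewrite /sumk big_cons. Qed.
Lemma sumk_cat s t : sumk (s ++ t) = (sumk s + sumk t)%N.
Proof. by rewrite /sumk big_cat. Qed.
Lemma sumk_perm s t : perm_eq s t -> sumk s = sumk t.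
Proof. exact: perm_big. Qed.
Lemma geq_count_perm d w w' : perm_eq w w' -> geq_count d w = geq_count d w'.
Proof. by rewrite /geq_count => /seq.permP ->. Qed.
Lemma cost_cons d a s : cost d (a :: s) = (a.2 + (d <= a.1) + cost d s)%N.
Proof. by rewrite /cost sumk_cons /geq_count /=; lia. Qed.
Lemma cost_perm d s t : perm_eq s t -> cost d s = cost d t.
Proof.
by move=> st; rewrite /cost (sumk_perm st) (@geq_count_perm d _ (map fst t)) ?perm_map.
Qed.
Lemma geq_count_top w : geq_count n w = 0%N.
Proof. by apply/eqP; rewrite -leqn0 leqNgt -has_count; apply/hasP => -[u _]; have := ltn_ord u; lia. Qed.
Lemma geq_count0 w : geq_count 0 w = size w.
Proof. by rewrite /geq_count (eq_count (a2 := predT)) ?count_predT. Qed.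
Lemma geq_count_cat d w w' : geq_count d (w ++ w') = (geq_count d w + geq_count d w')%N.
Proof. exact: count_cat. Qed.
Lemma geq_count_le d d' w : (d <= d')%N -> (geq_count d' w <= geq_count d w)%N.
Proof. by move=> le; apply: sub_count => u /=; apply: leq_trans. Qed.
Lemma geq_count_size d w : (geq_count d w <= size w)%N.
Proof. exact: count_size. Qed.
Lemma cost_top s : cost n s = sumk s.
Proof. by rewrite /cost geq_count_top addn0. Qed.

Lemma all2_leK_cost d s t : all2 leK s t -> (cost d s <= cost d t)%N.
Proof.
elim: s t => [|a s IH] [|b t] //= /andP [ab /IH]; rewrite !cost_cons.
by move: ab; rewrite leKE; case: ltnP; lia.
Qed.

Lemma all2_perm (T1 T2 : eqType) (r : T1 -> T2 -> bool)
    (s s' : seq T1) (t : seq T2) : perm_eq s s' -> all2 r s t ->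
  exists2 t', perm_eq t t' & all2 r s' t'.
Proof.
move=> ps st; have sz : size s = size t by move: st; rewrite all2E => /andP [/eqP].
have pz : perm_eq s' (unzip1 (zip s t)) by rewrite unzip1_zip ?sz // perm_sym.
have [z pzz ez] : exists2 z, perm_eq z (zip s t) & unzip1 z = s'.
  elim: s' (zip s t) pz {ps} => [|x s' IH] z pz.
    by exists [::]; move/perm_size: pz => //=; case: z.
  have /mapP [y yz xy] : x \in unzip1 z by rewrite -(perm_mem pz) mem_head.
  have [|z' pz' ez'] := IH (rem y z).
    rewrite -(perm_cons x) (perm_trans pz) // xy.
    by rewrite -[_ :: _]/(map fst (y :: rem y z)) perm_map // perm_to_rem.
  exists (y :: z'); last by rewrite /= ez' xy.
  by rewrite (permPr (perm_to_rem yz)) perm_cons.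
exists (unzip2 z).
  by rewrite -(unzip2_zip (s := s) (t := t)) ?sz // perm_map // perm_sym.
rewrite -ez; move: st; rewrite !all2E !size_map eqxx /= => /andP [_ /allP st].
by apply/allP => x; rewrite zip_unzip (perm_mem pzz) => /st.
Qed.

Lemma seq_max_key (T : eqType) (f : T -> nat) (s : seq T) : s != [::] ->
  exists2 x, x \in s & forall y, y \in s -> (f y <= f x)%N.
Proof.
elim: s => [//|a [|b s] IH] _.
  by exists a; rewrite ?mem_head // => y; rewrite inE => /eqP ->.
have [x xs H] := IH isT.
case: (leqP (f a) (f x)) => [ax|xa].
  by exists x; [rewrite inE xs orbT | move=> y; rewrite inE => /orP [/eqP ->|/H]].
exists a; rewrite ?mem_head // => y; rewrite inE => /orP [/eqP -> //|/H]; lia.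
Qed.

Lemma seq_min_key (T : eqType) (f : T -> nat) (s : seq T) : s != [::] ->
  exists2 x, x \in s & forall y, y \in s -> (f x <= f y)%N.
Proof.
elim: s => [//|a [|b s] IH] _.
  by exists a; rewrite ?mem_head // => y; rewrite inE => /eqP ->.
have [x xs H] := IH isT.
case: (leqP (f x) (f a)) => [ax|xa].
  by exists x; [rewrite inE xs orbT | move=> y; rewrite inE => /orP [/eqP ->|/H]].
exists a; rewrite ?mem_head // => y; rewrite inE => /orP [/eqP -> //|/H]; lia.
Qed.

(** A criterion of the type of Hall's theorem, with the costs as the only obstructions. The
   letter with the largest index is matched with the largest available index if this is not
   smaller, which is free; otherwise every index is smaller, one unit must be paid, and the
   smallest index is the best to give away. *)
Lemma lifting_exists s (w : seq 'I_n) (e : nat) : size s = size w ->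
    (forall d, (d <= n)%N -> (cost d s <= e + geq_count d w)%N) ->
  exists t, [/\ all2 leK s t, perm_eq (map fst t) w & (sumk t <= e)%N].
Proof.
have [m] := ubnP (size s); elim: m s w e => // m IH s w e.
case: (eqVneq s [::]) => [->|s0] sm sw H.
  exists [::]; split=> //; last by rewrite /sumk big_nil.
  by move: sw; case: w {H}.
have w0 : w != [::] by move: s0; rewrite -!size_eq0 sw.
have [x xs xmax] : exists2 x : letter, x \in s & forall c : letter, c \in s -> (c.1 <= x.1)%N.
  by have := seq_max_key (fun a : letter => a.1 : nat) s0.
have [y yw ymax] : exists2 y : 'I_n, y \in w & forall c : 'I_n, c \in w -> (c <= y)%N.
  by have := seq_max_key (fun a : 'I_n => a : nat) w0.
have [z zw zmin] : exists2 z : 'I_n, z \in w & forall c : 'I_n, c \in w -> (z <= c)%N.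
  by have := seq_min_key (fun a : 'I_n => a : nat) w0.
have px := perm_to_rem xs.
have szs : size (rem x s) = (size s).-1 by rewrite size_rem.
have step (c : 'I_n) : c \in w -> (x.2 + (c < x.1) <= e)%N ->
    (forall d, (d <= n)%N -> (cost d (rem x s) <= e - (x.2 + (c < x.1)) + geq_count d (rem c w))%N) ->
    exists t, [/\ all2 leK s t, perm_eq (map fst t) w & (sumk t <= e)%N].
  move=> cw ee' Hd; have [||t [st tw te]] := IH (rem x s) (rem c w) (e - (x.2 + (c < x.1)))%N _ _ Hd.
  - by rewrite szs; move: sm; case: (s) s0.
  - by rewrite szs size_rem // sw.
  have : all2 leK (x :: rem x s) ((c, (x.2 + (c < x.1))%N) :: t).
    by rewrite /= st leKE /= leqnn.
  case/(all2_perm (s' := s)); first by rewrite perm_sym.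
  move=> t' pt st'; exists t'; split=> //.
    rewrite (perm_trans (y := map fst ((c, (x.2 + (c < x.1))%N) :: t))) ?perm_map 1?perm_sym //=.
    by rewrite (permPl (perm_to_rem cw)) perm_cons perm_sym.
  by rewrite -(sumk_perm pt) sumk_cons /= -leq_subRL.
have cx d : cost d s = (x.2 + (d <= x.1) + cost d (rem x s))%N.
  by rewrite -cost_cons (cost_perm d px).
have gc v d : v \in w -> geq_count d w = ((d <= v) + geq_count d (rem v w))%N.
  by move=> cw; rewrite (geq_count_perm d (perm_to_rem cw)).
have big0 d : (x.1 < d)%N -> geq_count d (map fst (rem x s)) = 0%N.
  move=> xd; apply/eqP; rewrite -leqn0 leqNgt -has_count; apply/hasP => -[u /mapP [a /mem_rem ax ->]];
  by move=> da; have := leq_trans xd (leq_trans da (xmax _ ax)); rewrite ltnn.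
have Hn := H n (leqnn n); rewrite geq_count_top cx in Hn.
(* If x.1 <= y the raise is free; otherwise x moves to z and pays one unit. *)
case: (leqP x.1 y) => xy.
  apply: (step y) => //.
    by rewrite cost_top in Hn; lia.
  move=> d dn; have := H d dn; rewrite cx (gc y) //.
  case: (leqP d x.1) => dx; first by lia.
  rewrite /cost (big0 d) //.
  by move: Hn; rewrite cost_top; lia.
have zx : (z < x.1)%N by apply: leq_ltn_trans (ymax _ zw) xy.
have low : (sumk s < e)%N.
  have := H x.1 (ltnW (ltn_ord _)).
  have -> : geq_count x.1 w = 0%N.
    apply/eqP; rewrite -leqn0 leqNgt -has_count; apply/hasP => -[u /ymax] /=; lia.
  by rewrite cx leqnn (sumk_perm px) sumk_cons /cost; lia.
have sumx : sumk s = (x.2 + sumk (rem x s))%N by rewrite (sumk_perm px) sumk_cons.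
apply: (step z) => //; first by rewrite zx; lia.
move=> d dn; have := H d dn; rewrite cx (gc z) // zx.
case: (leqP d x.1) => dx; last first.
  by rewrite /cost (big0 d) //; lia.
case: (leqP d z) => dz; last by lia.
have -> : geq_count d (rem z w) = size (rem z w).
  apply/eqP; rewrite -all_count; apply/allP => u /mem_rem /zmin; lia.
have := geq_count_size d (map fst (rem x s)); rewrite size_map szs size_rem // -sw /cost.
move: low; rewrite sumx => low.
move: (sumk _) (geq_count _ _) low => a b low H1 _.
by rewrite leq_add ?leq_subRL; lia.
Qed.

End Keys.

(** * The orders on refinements *)

Section LexiWords.
Implicit Types (s t : seq (nat * nat)).

Lemma ltxi_catl s s' t t' : size s = size t -> (s < t)%O -> (s ++ s' < t ++ t')%O.
Proof.
elim: s t => [|x s IH] [|y t] //= [sz]; rewrite !ltxi_cons.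
by case/andP=> -> /=; case: (y <= x)%O => //=; apply: IH.
Qed.

Lemma ltxi_catr s t t' : (t < t')%O -> (s ++ t < s ++ t')%O.
Proof. by elim: s => [//|x s IH] /= /IH; rewrite eqhead_ltxiE. Qed.

Lemma all2_ltxi s t : all2 <=%O s t -> s != t -> (s < t)%O.
Proof.
elim: s t => [|x s IH] [|y t] //= /andP [xy st] ne; rewrite ltxi_cons xy /=.
apply/implyP => yx; apply: IH => //; apply: contraNneq ne => ->.
by rewrite eqseq_cons eqxx andbT eq_le xy.
Qed.

Lemma ltxi_total_size s t : [|| s == t, (s < t)%O | (t < s)%O].
Proof. by case: ltgtP => //=; rewrite ?orbT // => ->; rewrite eqxx. Qed.
End LexiWords.

Section Words.
Variables p q : nat.
Implicit Types (E F : Esym p q).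
Local Notation side n := (seq ('I_n * nat)).

(** The word of a refinement read from its two sides separately. *)
Definition word2 (A : side p) (B : side q) : seq (nat * nat) :=
  map (@key p) (rev A) ++ map (@key q) (rev B).

Lemma wordE E : word E = word2 (map fst E) (map snd E).
Proof. by rewrite /word /word2 -!map_rev -!map_comp. Qed.

Lemma all2_rcons (T1 T2 : Type) (r : T1 -> T2 -> bool) s t x y :
  all2 r (rcons s x) (rcons t y) = all2 r s t && r x y.
Proof.
elim: s t => [|a s IH] [|b t] //=; rewrite ?andbT ?andbF //.
- by case: t => [|c t]; rewrite /= ?andbF.
- by case: s {IH} => [|c s]; rewrite /= ?andbF.
- by rewrite IH andbA.
Qed.

Lemma rev_leK_ltxi n (A A' : side n) : all2 (@leK n) A A' -> A != A' ->
  (map (@key n) (rev A) < map (@key n) (rev A'))%O.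
Proof.
move=> le ne; apply: all2_ltxi; last first.
  by apply: contraNneq ne => /(inj_map (@key_inj n)) /(can_inj revK) ->.
elim: A A' le {ne} => [|a A IH] [|b A'] //= /andP [ab /IH le].
by rewrite !rev_cons !map_rcons all2_rcons le.
Qed.

(** The word lists the last letters first, so an increase at the end of the side outweighs
   any change before. *)
Lemma word2_ltl (A1 A2 A1' A2' : side p) (B B' : side q) :
  size A1 = size A1' -> all2 (@leK p) A2 A2' -> A2 != A2' ->
  (word2 (A1 ++ A2) B < word2 (A1' ++ A2') B')%O.
Proof.
move=> sz le ne; rewrite /word2 !rev_cat !map_cat -!catA.
apply: ltxi_catl; last exact: rev_leK_ltxi.
by move: le; rewrite all2E !size_map !size_rev => /andP [/eqP].
Qed.

Lemma word2_ltr (A : side p) (B1 B2 B1' B2' : side q) :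
  size B1 = size B1' -> all2 (@leK q) B2 B2' -> B2 != B2' ->
  (word2 A (B1 ++ B2) < word2 A (B1' ++ B2'))%O.
Proof.
move=> sz le ne; rewrite /word2; apply: ltxi_catr; rewrite !rev_cat !map_cat.
apply: ltxi_catl; last exact: rev_leK_ltxi.
by move: le; rewrite all2E !size_map !size_rev => /andP [/eqP].
Qed.

Lemma word2_lt (A A' : side p) (B B' : side q) :
  all2 (@leK p) A A' -> all2 (@leK q) B B' -> (A != A') || (B != B') ->
  (word2 A B < word2 A' B')%O.
Proof.
move=> leA leB; case: (eqVneq A A') => [<- /= neB|neA _].
  exact: (@word2_ltr A [::] B [::] B').
exact: (@word2_ltl [::] A [::] A').
Qed.

Lemma word_inj E F : size E = size F -> word E = word F -> E = F.
Proof.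
move=> sz; rewrite !wordE /word2 => /eqP; rewrite eqseq_cat ?size_map ?size_rev ?size_map //.
case/andP=> /eqP /(inj_map (@key_inj p)) /(can_inj revK) e1.
move=> /eqP /(inj_map (@key_inj q)) /(can_inj revK) e2.
by rewrite -(zip_unzip E) -(zip_unzip F) /unzip1 /unzip2 e1 e2.
Qed.

Lemma precE_irr E : precE E E = false.
Proof. by rewrite /precE !ltnn ltxx !andbF. Qed.

Lemma precE_trans F E G : precE E F -> precE F G -> precE E G.
Proof.
rewrite /precE.
case/orP=> [EF|/andP [/eqP EF]].
  by case/orP=> [FG|/andP [/eqP <- _]]; rewrite ?EF ?(ltn_trans FG EF).
rewrite EF; move=> H; case/orP=> [->//|/andP [->]] H'.
apply/orP; right; apply/andP; split=> //.
case/orP: H => [H|/andP [/eqP -> H]]; case/orP: H' => [H'|/andP [/eqP <- H']].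
- by rewrite (ltn_trans H H').
- by rewrite H.
- by rewrite H'.
- by rewrite eqxx (lt_trans H H') orbT.
Qed.

Lemma precE_total E F : E = F \/ precE E F \/ precE F E.
Proof.
rewrite /precE; case: (ltngtP (size E) (size F)) => [_|_|sz]; rewrite ?orbT /=; try by right; auto.
case: (ltngtP (wtE E) (wtE F)) => _ /=; try by right; auto.
by case/or3P: (ltxi_total_size (word E) (word F)) => [/eqP /(word_inj sz)|->|->]; auto.
Qed.

Lemma wtE_sides E : wtE E = (sumk (map fst E) + sumk (map snd E))%N.
Proof. by rewrite /wtE big_split /= /sumk !big_map. Qed.

Lemma leE_sides E F : leE E F =
  [&& (size F <= size E)%N, all2 (@leK p) (take (size F) (map fst E)) (map fst F)
    & all2 (@leK q) (take (size F) (map snd E)) (map snd F)].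
Proof.
rewrite /leE; case: leqP => //= sz; rewrite -!map_take.
elim: F E sz => [|f F IH] [|e E] //= sz.
by rewrite IH // andbACA.
Qed.

Lemma leE_size E F : leE E F -> (size F <= size E)%N. Proof. by case/andP. Qed.

Lemma all2_trans (T : Type) (r : rel T) : transitive r ->
  forall s t u : seq T, all2 r s t -> all2 r t u -> all2 r s u.
Proof.
move=> tr; elim=> [|x s IH] [|y t] [|z u] //= /andP [xy st] /andP [yz tu].
by rewrite (tr y) // (IH t).
Qed.

Lemma all2_take (T1 T2 : Type) (r : T1 -> T2 -> bool) k s t : all2 r s t ->
  all2 r (take k s) (take k t).
Proof.
elim: k s t => [|k IH] [|x s] [|y t] //= /andP [-> /IH //].
Qed.

Lemma leE_trans : transitive (@leE p q).
Proof.
move=> F E G; rewrite !leE_sides => /and3P [sFE a b] /and3P [sGF a' b'].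
rewrite (leq_trans sGF sFE) /=; apply/andP; split.
  apply: (all2_trans (@leK_trans p)) a'; have := all2_take (size G) a.
  by rewrite take_takel.
apply: (all2_trans (@leK_trans q)) b'; have := all2_take (size G) b.
by rewrite take_takel.
Qed.

Lemma sumk_all2 n (s t : side n) : all2 (@leK n) s t -> (sumk s <= sumk t)%N.
Proof. by move/(all2_leK_cost n); rewrite !cost_top. Qed.

(** A componentwise larger refinement of the same size has larger or equal weight, and a
   larger word when the weights agree. *)
Lemma leE_prec E F : leE E F -> size E = size F -> E = F \/ precE E F.
Proof.
rewrite leE_sides => /and3P [_ a b] sz.
rewrite -sz !take_oversize ?size_map // in a b.
case: (eqVneq E F) => [->|ne]; [by left | right].
rewrite /precE sz ltnn eqxx /= !wtE_sides.
have := sumk_all2 a; have := sumk_all2 b.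
case: ltngtP => //= [|e _ _]; first by lia.
rewrite !wordE; apply: word2_lt => //.
rewrite -negb_and; apply: contra ne => /andP [/eqP e1 /eqP e2].
by rewrite -(zip_unzip E) -(zip_unzip F) /unzip1 /unzip2 e1 e2.
Qed.

End Words.

Section Symbols.
Variables p q : nat.
Implicit Types (E F : Esym p q) (J : Jsym p q).

Lemma ord_sort_sorted n (w : seq 'I_n) (r := fun i j : 'I_n => (i <= j)%N) :
  sorted (fun i j : 'I_n => (i < j)%N) w -> forall w', perm_eq w' w -> sort r w' = w.
Proof.
move=> sw w' pw; have tr : transitive r by move=> a b c; apply: leq_trans.
have tot : total r by move=> a b; apply: leq_total.
have as_ : antisymmetric r by move=> a b /anti_leq /val_inj.
apply: (sorted_eq tr as_); first exact: sort_sorted.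
  by apply: sub_sorted sw => a b /=; apply: ltnW.
by rewrite (permPl (permEl (perm_sort _ _))).
Qed.

Lemma is_J_sides J : is_J J -> [/\ (0 < size J.2)%N,
  sorted (fun i j : 'I_p => (i < j)%N) (unzip1 J.2) &
  sorted (fun i j : 'I_q => (i < j)%N) (unzip2 J.2)].
Proof.
case/andP=> s0 sJ; split=> //.
  by rewrite sorted_map; apply: sub_sorted sJ => a b /andP [].
by rewrite sorted_map; apply: sub_sorted sJ => a b /andP [].
Qed.

Lemma sorted_ltn_uniq n (w : seq 'I_n) : sorted (fun i j : 'I_n => (i < j)%N) w -> uniq w.
Proof.
apply: sorted_uniq; first by move=> a b c; apply: ltn_trans.
by move=> a; apply: ltnn.
Qed.

Lemma in_calE_sides J E : is_J J -> in_calE J E <->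
  [/\ perm_eq (map fst (map fst E)) (unzip1 J.2), perm_eq (map fst (map snd E)) (unzip2 J.2)
    & (sumk (map fst E) + sumk (map snd E))%N = J.1].
Proof.
case/is_J_sides=> s0 s1 s2; rewrite -!map_comp; split.
  case=> /and3P [_ u1 u2] <- /=; rewrite wtE_sides.
  rewrite unzip1_zip ?size_sort ?size_map // unzip2_zip ?size_sort ?size_map //.
  by split=> //; rewrite perm_sym (permPl (permEl (perm_sort _ _))).
case=> p1 p2 w; split.
  rewrite /is_E (perm_uniq p1) (perm_uniq p2) !sorted_ltn_uniq // andbT.
  by rewrite andbT; move/perm_size: p1; rewrite !size_map => ->.
rewrite /normE wtE_sides w (ord_sort_sorted s1 p1) (ord_sort_sorted s2 p2) zip_unzip.
by case: (J).
Qed.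

Lemma in_calE_size J E : is_J J -> in_calE J E -> size E = size J.2.
Proof. by move=> HJ /(in_calE_sides _ HJ) [/perm_size]; rewrite !size_map. Qed.

Lemma in_calE_wt J E : in_calE J E -> wtE E = J.1.
Proof. by case=> _ <-. Qed.
End Symbols.

(** * Thresholds forced by maximality *)

Section GreedySide.
Variables (n : nat).
Local Notation letter := ('I_n * nat)%type.
Implicit Types (s t X : seq letter) (w : seq 'I_n).

Lemma cost_anti d d' s : (d <= d')%N -> (cost d' s <= cost d s)%N.
Proof. by move=> le; rewrite leq_add2l geq_count_le. Qed.

Lemma geq_count_rem d w (z : 'I_n) : z \in w ->
  geq_count d w = ((d <= z) + geq_count d (rem z w))%N.
Proof. by move=> zw; rewrite (geq_count_perm d (perm_to_rem zw)). Qed.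

Lemma geq_count_eq (d c : nat) w : (d <= c)%N ->
  (forall u : 'I_n, u \in w -> (u < c)%N -> (u < d)%N) -> geq_count d w = geq_count c w.
Proof.
move=> dc H; apply: eq_in_count => u uw /=; apply/idP/idP; last exact: leq_trans.
by rewrite (leqNgt c) (leqNgt d); apply: contra => /H; apply.
Qed.

Variables (h' : nat) (X first rest : seq letter).
Hypothesis szX : size X = h'.
Hypothesis szf : size first = h'.
Hypothesis leXf : all2 (@leK n) X first.
Hypothesis rest0 : rest != [::].
Hypothesis uniqU : uniq (map fst (first ++ rest)).
Hypothesis maximal : forall first' rest', all2 (@leK n) X first' ->
  all2 (@leK n) rest rest' -> rest != rest' ->
  perm_eq (map fst (first' ++ rest')) (map fst (first ++ rest)) ->
  sumk (first' ++ rest') = sumk (first ++ rest) -> False.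
Local Notation S := (map fst first).
Local Notation Rr := (map fst rest).
Local Notation U := (map fst (first ++ rest)).

Lemma all2_leK_refl s : all2 (@leK n) s s.
Proof. by elim: s => //= a s ->; rewrite leK_refl. Qed.

(** Otherwise the initial part could be made with y in place of z, saving weight for the
   rest, where z in place of y together with the saved weight gives a larger letter. *)
Lemma swap_bound (z y : 'I_n) e : z \in S -> y \in Rr ->
    (forall d, (d <= n)%N -> (cost d X <= e + geq_count d (y :: rem z S))%N) ->
  (sumk first < e + (z < y))%N.
Proof.
move=> zS yR He; rewrite ltnNge; apply/negP => lte.
have [|t [Xt tS te]] := lifting_exists (w := y :: rem z S) _ He.
  by rewrite /= size_rem // size_map prednK ?szX ?szf //; case: (first) szf zS => //= a l <-.
have neq : z != y.
  move: uniqU; rewrite map_cat cat_uniq => /and3P [_ /hasPn H _].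
  by apply: contraTneq zS => ->; apply: H.
case/mapP: yR => -[u k] yr /= yu; subst u.
have [r1 [r2 er]] : exists r1, exists r2, rest = r1 ++ (y, k) :: r2.
  by case/splitPr: yr => r1 r2; exists r1, r2.
apply: (maximal (first' := t)
  (rest' := r1 ++ (z, (k + (z < y) + (sumk first - sumk t - (z < y)))%N) :: r2)) => //.
- rewrite er; elim: (r1) => [|a l IH] /=; last by rewrite leK_refl.
  by rewrite leKE /= all2_leK_refl; lia.
- by rewrite er eqseq_cat // eqxx eqseq_cons xpair_eqE eq_sym (negPf neq).
- rewrite er !map_cat /= (perm_trans (y := (y :: rem z S) ++ map fst r1 ++ z :: map fst r2)) //.
    by rewrite perm_cat2r.
  rewrite /= -cat_cons -[y :: _]cat1s -!catA perm_sym.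
  rewrite (perm_trans (y := (z :: rem z S) ++ map fst r1 ++ y :: map fst r2)) //.
    by rewrite perm_cat2r perm_to_rem.
  by apply/seq.permP => P; rewrite /= !count_cat /=; lia.
- by rewrite er !sumk_cat !sumk_cons /=; lia.
Qed.

Lemma not_cover (e : nat) w : ~ (forall d, (d <= n)%N -> (cost d X <= e + geq_count d w)%N) ->
  exists2 d, (d <= n)%N & (e + geq_count d w < cost d X)%N.
Proof.
move=> H; apply: contrapT => H'; apply: H => d dn; rewrite leqNgt; apply/negP => lt.
by apply: H'; exists d.
Qed.

(** Some index of the rest is smaller than c; let y be the largest such one. The exchange of
   y with the smallest index z >= c of the initial part (or its smallest index, when there
   is none above c) is impossible, so the cost condition for this exchange fails at some
   threshold d. As [first] itself satisfies the conditions, it does so with equality at d,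
   and y < d; if d exceeds c, equality at d gives the claim at c. *)
Lemma gap_below (c : nat) : (c <= n)%N -> (exists2 y, y \in Rr & (y < c)%N) ->
  exists2 d, (d <= c)%N &
    (sumk first + geq_count c S + geq_count d U <= cost d X + geq_count c U)%N.
Proof.
move=> cn [y0 y0R y0c].
have [y yR [yc ymax]] : exists2 y : 'I_n, y \in Rr & (y < c)%N /\
    forall u : 'I_n, u \in Rr -> (u < c)%N -> (u <= y)%N.
  have ne : [seq u : 'I_n <- Rr | (u < c)%N] != [::].
    by rewrite -has_filter; apply/hasP; exists y0.
  have [y] := seq_max_key (fun u : 'I_n => u : nat) ne.
  rewrite mem_filter => /andP [yc yR] ymax; exists y => //; split=> // u uR uc.
  by apply: ymax; rewrite mem_filter uc.
have F0 d : (cost d X <= sumk first + geq_count d S)%N by have := all2_leK_cost d leXf.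
have RrE d : (d <= c)%N -> (y < d)%N -> geq_count d Rr = geq_count c Rr.
  move=> dc yd; apply: geq_count_eq => // u uR uc.
  exact: leq_ltn_trans (ymax _ uR uc) yd.
have UE d : geq_count d U = (geq_count d S + geq_count d Rr)%N by rewrite map_cat geq_count_cat.
(* The claim follows from a threshold above y where [first] attains the bound F0. *)
have tight d : (y < d)%N -> cost d X = (sumk first + geq_count d S)%N ->
    ((c < d)%N -> geq_count d S = geq_count c S) ->
    exists2 d, (d <= c)%N &
    (sumk first + geq_count c S + geq_count d U <= cost d X + geq_count c U)%N.
  move=> yd Hd Hc; case: (leqP d c) => dc.
    by exists d => //; rewrite Hd !UE RrE //; lia.
  exists c => //; have := cost_anti X (ltnW dc); rewrite Hd Hc //; lia.
have remE d (z : 'I_n) : z \in S ->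
    (geq_count d S + (d <= y) = (d <= z) + geq_count d (y :: rem z S))%N.
  by move=> zS; rewrite (geq_count_rem d zS) /geq_count /=; lia.
(* No index of the initial part is at least c: exchange y with its smallest index z, unless
   d = c already works. *)
have [T0|T1] := posnP (geq_count c S).
  case: (leqP (sumk first) (sumk X)) => sX.
    by exists c => //; rewrite /cost T0; lia.
  have S0 : S != [::].
    by apply: contraTneq sX => /(congr1 size); rewrite size_map /sumk => /size0nil ->; rewrite big_nil.
  have [z zS zmin] : exists2 z : 'I_n, z \in S & forall u : 'I_n, u \in S -> (z <= u)%N.
    by have := seq_min_key (fun u : 'I_n => u : nat) S0.
  have Sz d : (d <= z)%N -> geq_count d S = h'.
    move=> dz; rewrite -szf -(size_map fst); apply/eqP; rewrite -all_count; apply/allP => u /zmin /=.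
    exact: leq_trans.
  have [d dn Hd] : exists2 d, (d <= n)%N &
      (sumk first - (z < y) + geq_count d (y :: rem z S) < cost d X)%N.
    by apply: not_cover => /(swap_bound zS yR); lia.
  have := remE d z zS; have := F0 d => Hd0 Hr.
  case: (leqP d z) => dz.
    have := geq_count_size d (map fst X); rewrite size_map szX => HX.
    move: Hd; rewrite {1}/cost => Hd; move: Hr; rewrite Sz // dz.
    by case: (ltnP z y) Hd => zy; case: (leqP d y) => dy; lia.
  have [yd cd] : (y < d)%N /\ cost d X = (sumk first + geq_count d S)%N.
    have dzF : (d <= z)%N = false by apply/negbTE; rewrite -ltnNge.
    move: Hr; rewrite dzF; move: Hd.
    by case: (ltnP z y); case: (leqP d y); lia.
  apply: (tight d) => // lt; have := geq_count_le S (ltnW lt); lia.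
(* Exchange y with the smallest index z >= c; as y < z this needs no extra unit. *)
have [z zS [cz zmin]] : exists2 z : 'I_n, z \in S & (c <= z)%N /\
    forall u : 'I_n, u \in S -> (c <= u)%N -> (z <= u)%N.
  have ne : [seq u : 'I_n <- S | (c <= u)%N] != [::] by rewrite -has_filter has_count.
  have [z] := seq_min_key (fun u : 'I_n => u : nat) ne.
  rewrite mem_filter => /andP [cz zS] zmin; exists z => //; split=> // u uS cu.
  by apply: zmin; rewrite mem_filter cu.
have zy : (z < y)%N = false by apply/negbTE; rewrite -leqNgt (leq_trans (ltnW yc)).
have [d dn Hd] : exists2 d, (d <= n)%N & (sumk first + geq_count d (y :: rem z S) < cost d X)%N.
  by apply: not_cover => /(swap_bound zS yR); rewrite zy; lia.
have := remE d z zS; have := F0 d => Hd0 Hr.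
have [yd dz cd] : [/\ (y < d)%N, (d <= z)%N & cost d X = (sumk first + geq_count d S)%N].
  by move: Hr Hd; case: (leqP d y); case: (leqP d z) => ? ? ? ?; split; lia.
apply: (tight d) => // lt; apply/esym/geq_count_eq; first exact: ltnW.
by move=> u uS ud; rewrite ltnNge; apply/negP => /(zmin _ uS) zu; lia.
Qed.

(** The two alternatives are the two shapes of an exchange: with rows in [d, c) kept, resp.
   with only rows in [c, d) exchanged. When all indices below c are in the initial part,
   [gap_below] at the top threshold gives a d, on either side of c. *)
Lemma greedy_gap (c : nat) : (c <= n)%N -> exists2 d, (d <= n)%N &
  (d <= c)%N && (sumk first + geq_count c S + geq_count d U <= cost d X + geq_count c U)%N
  \/ (c <= d)%N &&
     (sumk first + geq_count c S + (size U - geq_count c U) + geq_count d U <= cost d X + h')%N.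
Proof.
move=> cn; case: (boolP (has (fun y : 'I_n => (y < c)%N) Rr)) => [/hasP [y yR yc]|/hasPn noy].
  have [d dc H] := gap_below cn (ex_intro2 _ _ y yR yc).
  by exists d; [exact: leq_trans cn | left; rewrite dc H].
have [d dn] : exists2 d, (d <= n)%N &
    (sumk first + geq_count n S + geq_count d U <= cost d X + geq_count n U)%N.
  apply: gap_below => //; case: (rest) rest0 => [//|a l] _.
  by exists a.1; rewrite /= ?mem_head.
rewrite !geq_count_top !addn0 => H; exists d => //.
have UE d' : geq_count d' U = (geq_count d' S + geq_count d' Rr)%N by rewrite map_cat geq_count_cat.
have cR : geq_count c Rr = size Rr.
  apply/eqP; rewrite -all_count; apply/allP => u /noy; rewrite -leqNgt //.
have sU : size U = (h' + size Rr)%N by rewrite map_cat size_cat size_map szf.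
have := geq_count_size c S; rewrite size_map szf => HS.
case: (leqP d c) => dc; [left | right]; rewrite /= ?(ltnW dc).
  by move: H; rewrite !UE; lia.
by move: H; rewrite sU !UE cR; lia.
Qed.

End GreedySide.

(** * Refinements lying above a given one *)

Section Fitting.
Variables p q : nat.
Implicit Types (E F : Esym p q) (J : Jsym p q).

Definition fits E J F : Prop := in_calE J F /\ leE E F.

(** Products containing such a symbol are closer to being straight: the greedy refinement of
   that symbol, if it has one above E0, precedes E1. Symbols with none qualify vacuously. *)
Definition below E0 E1 J : Prop := is_J J /\ forall F, fits E0 J F -> precE F E1.

Lemma fits_sides E0 J F : is_J J -> fits E0 J F <->
  [/\ perm_eq (map fst (map fst F)) (unzip1 J.2), perm_eq (map fst (map snd F)) (unzip2 J.2),
      (sumk (map fst F) + sumk (map snd F))%N = J.1 &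
    [/\ (size J.2 <= size E0)%N, all2 (@leK p) (take (size J.2) (map fst E0)) (map fst F)
      & all2 (@leK q) (take (size J.2) (map snd E0)) (map snd F)]].
Proof.
move=> HJ; rewrite /fits in_calE_sides // leE_sides; split.
  case=> -[p1 p2 w] /and3P [].
  by have <- : size F = size J.2 by have := perm_size p1; rewrite !size_map.
have sz : perm_eq (map fst (map fst F)) (unzip1 J.2) -> size F = size J.2.
  by move/perm_size; rewrite !size_map.
by case=> p1 p2 w []; rewrite -(sz p1) => -> -> ->.
Qed.

Lemma fits_bound E0 J F d d' : is_J J -> fits E0 J F ->
  (cost d (take (size J.2) (map fst E0)) + cost d' (take (size J.2) (map snd E0)) <=
   J.1 + geq_count d (unzip1 J.2) + geq_count d' (unzip2 J.2))%N.
Proof.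
move=> HJ /(fits_sides _ _ HJ) [p1 p2 <- [_ /(all2_leK_cost d) c1 /(all2_leK_cost d') c2]].
rewrite -(geq_count_perm d p1) -(geq_count_perm d' p2).
by move: c1 c2; rewrite /cost; lia.
Qed.

(** The smallest weight a with which one side can be lifted, together with a threshold where
   the cost attains it. *)
Lemma side_need n (X : seq ('I_n * nat)) (w : seq 'I_n) : exists a d,
  [/\ (d <= n)%N, (cost d X = a + geq_count d w)%N &
    forall d', (d' <= n)%N -> (cost d' X <= a + geq_count d' w)%N].
Proof.
pose f (d : 'I_n.+1) := (cost d X - geq_count d w)%N.
have [d0 _ Hd] := @arg_maxnP _ ord_max xpredT f isT.
have {}Hd d' : (d' <= n)%N -> (cost d' X - geq_count d' w <= f d0)%N.
  by move=> dn; apply: (Hd (Ordinal (dn : d' < n.+1)%N) isT).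
have [f0|f1] := posnP (f d0).
  exists 0%N, n; split=> //.
    by have := Hd n (leqnn n); rewrite f0 geq_count_top; lia.
  by move=> d' /Hd; rewrite f0; lia.
exists (f d0), d0; split; first by rewrite -ltnS.
  by move: f1; rewrite /f; lia.
by move=> d' /Hd; lia.
Qed.

(** The two sides are lifted separately with their least weights; what remains of the weight
   of J is put on the first letter, which keeps it above E0. *)
Lemma fits_exists E0 J : is_J J -> (size J.2 <= size E0)%N ->
    (forall d d', (d <= p)%N -> (d' <= q)%N ->
      (cost d (take (size J.2) (map fst E0)) + cost d' (take (size J.2) (map snd E0)) <=
       J.1 + geq_count d (unzip1 J.2) + geq_count d' (unzip2 J.2))%N) ->
  exists F, fits E0 J F.
Proof.
move=> HJ sz H; have [J0 _ _] := is_J_sides HJ.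
have [a [d [dp da Ha]]] := side_need (take (size J.2) (map fst E0)) (unzip1 J.2).
have [b [d' [dq db Hb]]] := side_need (take (size J.2) (map snd E0)) (unzip2 J.2).
have s1 : size (take (size J.2) (map fst E0)) = size J.2 by rewrite size_takel ?size_map.
have s2 : size (take (size J.2) (map snd E0)) = size J.2 by rewrite size_takel ?size_map.
have [|s [Xs ps es]] := lifting_exists (w := unzip1 J.2) _ Ha; first by rewrite s1 size_map.
have [|t [Yt pt et]] := lifting_exists (w := unzip2 J.2) _ Hb; first by rewrite s2 size_map.
have ab : (a + b <= J.1)%N by have := H d d' dp dq; lia.
have : (0 < size s)%N by rewrite -(size_map fst) (perm_size ps) size_map.
case: s Xs ps es => [//|[u k] s] Xs ps es _.
pose s' := (u, (k + (J.1 - sumk ((u, k) :: s) - sumk t))%N) :: s.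
have szs : size s' = size t.
  by rewrite -(size_map fst t) (perm_size pt) -[size s'](size_map fst ((u, k) :: s)) (perm_size ps) !size_map.
exists (zip s' t); apply/fits_sides => //.
rewrite -/(unzip1 (zip s' t)) -/(unzip2 (zip s' t)) unzip1_zip ?szs // unzip2_zip ?szs //.
split=> //; first by rewrite /s' sumk_cons /=; move: es; rewrite sumk_cons /=; lia.
split=> //; case: (take _ _) Xs => [//|x X] /= /andP [xu ->]; rewrite andbT.
by apply: leK_trans xu _; rewrite leKE /= ltnn addn0 leq_addr.
Qed.

Lemma not_fits E J : is_J J -> (size J.2 <= size E)%N -> ~ (exists F, fits E J F) ->
  exists d d', [/\ (d <= p)%N, (d' <= q)%N &
    (J.1 + geq_count d (unzip1 J.2) + geq_count d' (unzip2 J.2) <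
     cost d (take (size J.2) (map fst E)) + cost d' (take (size J.2) (map snd E)))%N].
Proof.
move=> HJ sz H; apply: contrapT => N; apply: H; apply: fits_exists => // d d' dp dq.
by rewrite leqNgt; apply/negP => lt; apply: N; exists d, d'.
Qed.

Lemma calE_J_inj J J' F : in_calE J F -> in_calE J' F -> J = J'.
Proof. by case=> _ <- [_ <-]. Qed.

Section Greedy.
Variables (E0 E1 : Esym p q) (J1 : Jsym p q).
Hypothesis (HJ1 : is_J J1) (Hmax : largest (fits E0 J1) E1).

Lemma greedy_size : size E1 = size J1.2.
Proof. by case: Hmax => -[H _] _; apply: in_calE_size. Qed.

Lemma greedy_wt : wtE E1 = J1.1.
Proof. by case: Hmax => -[H _] _; apply: in_calE_wt. Qed.

Lemma below_size J : is_J J -> (size J1.2 < size J.2)%N -> below E0 E1 J.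
Proof.
move=> HJ lt; split=> // F [FJ _]; apply/orP; left.
by rewrite greedy_size (in_calE_size HJ FJ).
Qed.

Lemma below_wt J : is_J J -> size J.2 = size J1.2 -> (J.1 < J1.1)%N -> below E0 E1 J.
Proof.
move=> HJ sz lt; split=> // F [FJ _]; apply/orP; right.
by rewrite greedy_size (in_calE_size HJ FJ) sz eqxx greedy_wt (in_calE_wt FJ) lt.
Qed.

(** A refinement of J lifts to one of J1 of the same weight, with larger or equal indices
   and the same second components, which is a strictly larger element. *)
Lemma below_dominated J : is_J J -> size J.2 = size J1.2 -> J.1 = J1.1 -> J <> J1 ->
    (forall d, (geq_count d (unzip1 J.2) <= geq_count d (unzip1 J1.2))%N) ->
    (forall d, (geq_count d (unzip2 J.2) <= geq_count d (unzip2 J1.2))%N) ->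
  below E0 E1 J.
Proof.
move=> HJ sz eqn neJ dom1 dom2; split=> // F fF.
have [p1 p2 w [sF a1 a2]] := (fits_sides _ _ HJ).1 fF.
have [||s [Fs ps es]] := @lifting_exists _ (map fst F) (unzip1 J1.2) (sumk (map fst F)).
- by rewrite -(size_map fst) (perm_size p1) !size_map.
- by move=> d _; rewrite /cost (geq_count_perm d p1) leq_add2l.
have [||t [Ft pt et]] := @lifting_exists _ (map snd F) (unzip2 J1.2) (sumk (map snd F)).
- by rewrite -(size_map fst) (perm_size p2) !size_map.
- by move=> d _; rewrite /cost (geq_count_perm d p2) leq_add2l.
have ss : size s = size J1.2 by rewrite -(size_map fst) (perm_size ps) size_map.
have st : size t = size J1.2 by rewrite -(size_map fst) (perm_size pt) size_map.
have sums : sumk s = sumk (map fst F) by apply/eqP; rewrite eqn_leq es sumk_all2.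
have sumt : sumk t = sumk (map snd F) by apply/eqP; rewrite eqn_leq et sumk_all2.
have z1 : map fst (zip s t) = s by apply: unzip1_zip; rewrite ss st.
have z2 : map snd (zip s t) = t by apply: unzip2_zip; rewrite ss st.
have fF' : fits E0 J1 (zip s t).
  apply/(fits_sides _ _ HJ1); rewrite z1 z2 sums sumt w eqn; split=> //.
  by rewrite -sz; split=> //; [apply: all2_trans Fs | apply: all2_trans Ft] => //; apply: leK_trans.
have szF : size F = size (zip s t).
  by rewrite size_zip ss st minnn -sz -(size_map fst J.2) -(perm_size p1) !size_map.
have : leE F (zip s t).
  by rewrite leE_sides -szF leqnn z1 z2 !take_oversize ?size_map // Fs Ft.
case/leE_prec=> // [eF|lt].
  by case: neJ; apply: (@calE_J_inj _ _ F); [case: fF | rewrite eF; case: fF'].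
case: Hmax => _ /(_ _ fF') [<- //|]; exact: precE_trans lt.
Qed.

Let A := map fst E1.
Let B := map snd E1.
Let h := size E1.

Let fE1 : [/\ perm_eq (map fst A) (unzip1 J1.2), perm_eq (map fst B) (unzip2 J1.2),
      (sumk A + sumk B)%N = J1.1 &
    [/\ (h <= size E0)%N, all2 (@leK p) (take h (map fst E0)) A
      & all2 (@leK q) (take h (map snd E0)) B]].
Proof. by rewrite /h greedy_size; apply/fits_sides => //; case: Hmax. Qed.

Lemma greedy_no_better A' B' : size A' = h -> size B' = h ->
  perm_eq (map fst A') (map fst A) -> perm_eq (map fst B') (map fst B) ->
  (sumk A' + sumk B')%N = (sumk A + sumk B)%N ->
  all2 (@leK p) (take h (map fst E0)) A' -> all2 (@leK q) (take h (map snd E0)) B' ->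
  (word2 A B < word2 A' B')%O -> False.
Proof.
case: fE1 => p1 p2 w [sE a b] sA sB pA pB w' a' b' lt.
have z1 : map fst (zip A' B') = A' by apply: unzip1_zip; rewrite sA sB.
have z2 : map snd (zip A' B') = B' by apply: unzip2_zip; rewrite sA sB.
have fF' : fits E0 J1 (zip A' B').
  apply/(fits_sides _ _ HJ1); rewrite z1 z2 w' -greedy_size.
  by split; [exact: perm_trans p1 | exact: perm_trans p2 | exact: w | split].
have szF : size E1 = size (zip A' B') by rewrite size_zip sA sB minnn.
have lt1 : precE E1 (zip A' B').
  by rewrite /precE -szF ltnn eqxx /= !wtE_sides z1 z2 w' ltnn eqxx !wordE z1 z2 lt.
case: Hmax => _ /(_ _ fF') [e|/(precE_trans lt1)]; last by rewrite precE_irr.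
by rewrite e precE_irr in lt1.
Qed.

Lemma all2_cat (T1 T2 : Type) (r : T1 -> T2 -> bool) s1 s2 t1 t2 : size s1 = size t1 ->
  all2 r (s1 ++ s2) (t1 ++ t2) = all2 r s1 t1 && all2 r s2 t2.
Proof. by elim: s1 t1 => [|x s IH] [|y t] //= [/IH ->]; rewrite andbA. Qed.

Lemma all2_cat_take n (X : seq ('I_n * nat)) (L : seq ('I_n * nat)) h' L1 L2 : (h' <= size L)%N ->
  all2 (@leK n) (take (size L) X) L -> all2 (@leK n) (take h' X) L1 ->
  all2 (@leK n) (drop h' L) L2 -> all2 (@leK n) (take (size L) X) (L1 ++ L2).
Proof.
move=> hL; rewrite -(take_takel X hL); move: (take _ X) => Y YL Y1 L12.
rewrite -[Y](cat_take_drop h') all2_cat; last by move: Y1; rewrite all2E => /andP [/eqP].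
rewrite Y1; apply: all2_trans L12; first exact: leK_trans.
have : all2 (@leK n) (take h' Y ++ drop h' Y) (take h' L ++ drop h' L) by rewrite !cat_take_drop.
rewrite all2_cat; first by case/andP.
by rewrite !size_take; move: YL; rewrite all2E => /andP [/eqP ->].
Qed.

(** The hypotheses of [greedy_gap] hold for each side of E1, as changing one side only gives
   another refinement of J1 above E0. *)
Lemma greedy_gaps h' : (h' < h)%N ->
  (forall c, (c <= p)%N -> exists2 d, (d <= p)%N &
    (d <= c)%N && (cost c (take h' A) + geq_count d (unzip1 J1.2) <=
                   cost d (take h' (map fst E0)) + geq_count c (unzip1 J1.2))%N
    \/ (c <= d)%N && (cost c (take h' A) + (h - geq_count c (unzip1 J1.2)) +
                      geq_count d (unzip1 J1.2) <= cost d (take h' (map fst E0)) + h')%N) /\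
  (forall c, (c <= q)%N -> exists2 d, (d <= q)%N &
    (d <= c)%N && (cost c (take h' B) + geq_count d (unzip2 J1.2) <=
                   cost d (take h' (map snd E0)) + geq_count c (unzip2 J1.2))%N
    \/ (c <= d)%N && (cost c (take h' B) + (h - geq_count c (unzip2 J1.2)) +
                      geq_count d (unzip2 J1.2) <= cost d (take h' (map snd E0)) + h')%N).
Proof.
move=> lt; case: fE1 => p1 p2 w [sE a b].
have szA : size A = h by rewrite size_map.
have szB : size B = h by rewrite size_map.
have ltA : (h' <= size A)%N by rewrite szA ltnW.
have ltB : (h' <= size B)%N by rewrite szB ltnW.
have ltA0 : (h' <= size (map fst E0))%N by rewrite size_map (leq_trans (ltnW lt)).
have ltB0 : (h' <= size (map snd E0))%N by rewrite size_map (leq_trans (ltnW lt)).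
have [_ so1 so2] := is_J_sides HJ1.
split=> c cn.
  have := @greedy_gap p h' (take h' (map fst E0)) (take h' A) (drop h' A) _ _ _ _ _ _ c cn.
  rewrite cat_take_drop size_map szA -(geq_count_perm c p1) => G.
  have [||||||d dp H] := G.
  - exact: size_takel.
  - exact: size_takel.
  - by have := all2_take h' a; rewrite take_takel // ltnW.
  - by rewrite -size_eq0 size_drop szA subn_eq0 -ltnNge.
  - by rewrite (perm_uniq p1) sorted_ltn_uniq.
  - move=> f r f1 r1 ne pr ss; apply: (@greedy_no_better (f ++ r) B) => //.
    + by rewrite -(size_map fst) (perm_size pr) size_map.
    + by rewrite ss.
    + by rewrite -szA; apply: (all2_cat_take ltA _ f1 r1); rewrite szA.
    + have fs : size (take h' A) = size f.
        have := f1; rewrite all2E => /andP [/eqP <- _].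
        by rewrite (size_takel ltA) (size_takel ltA0).
      rewrite -{1}(cat_take_drop h' A); exact: (word2_ltl _ _ fs r1 ne).
  by exists d => //; rewrite /cost -!(geq_count_perm d p1).
have := @greedy_gap q h' (take h' (map snd E0)) (take h' B) (drop h' B) _ _ _ _ _ _ c cn.
rewrite cat_take_drop size_map szB -(geq_count_perm c p2) => G.
have [||||||d dp H] := G.
- exact: size_takel.
- exact: size_takel.
- by have := all2_take h' b; rewrite take_takel // ltnW.
- by rewrite -size_eq0 size_drop szB subn_eq0 -ltnNge.
- by rewrite (perm_uniq p2) sorted_ltn_uniq.
- move=> f r f1 r1 ne pr ss; apply: (@greedy_no_better A (f ++ r)) => //.
  + by rewrite -(size_map fst) (perm_size pr) size_map.
  + by rewrite ss.
  + by rewrite -szB; apply: (all2_cat_take ltB _ f1 r1); rewrite szB.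
  + have fs : size (take h' B) = size f.
      have := f1; rewrite all2E => /andP [/eqP <- _].
      by rewrite (size_takel ltB) (size_takel ltB0).
    rewrite -{1}(cat_take_drop h' B); exact: (word2_ltr _ fs r1 ne).
by exists d => //; rewrite /cost -!(geq_count_perm d p2).
Qed.
End Greedy.
End Fitting.

(** * Exchangeable rows and columns *)

Section ExchangeData.
Variables p q : nat.
Implicit Types (E F : Esym p q) (J : Jsym p q).

(** A row u of the first symbol may move when [e u], a row of the second one when [~~ e u].
   Either the rows of the first symbol outside [d, c) are exchanged for rows of the second
   inside, or conversely. In both cases a move never decreases the number of rows of the
   first symbol that are at least d. *)
Definition exchange_kind (e : pred nat) (d : nat) : Prop := exists c,
  (d <= c)%N /\ (forall u, e u = ~~ (d <= u < c)%N) \/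
  (c <= d)%N /\ (forall u, e u = (c <= u < d)%N).

Definition fixed_count n (e : pred nat) (w w' : seq 'I_n) : nat :=
  (count (fun u : 'I_n => ~~ e u) w + count (fun u : 'I_n => e u) w')%N.

Lemma geq_count_interval n (d c : nat) (w : seq 'I_n) : (d <= c)%N ->
  (geq_count d w = geq_count c w + count (fun u : 'I_n => d <= u < c) w)%N.
Proof.
move=> dc; elim: w => //= u w; rewrite /geq_count /= => ->.
by case: (leqP d u) => du; case: (ltnP u c) => uc /=; lia.
Qed.

Lemma count_predCE (T : Type) (P : pred T) w : (count P w + count (fun u => ~~ P u) w = size w)%N.
Proof. exact: count_predC. Qed.

Lemma side_exchange n (c d : nat) (w w' : seq 'I_n) (x y h' : nat) : size w' = h' ->
    (d <= c)%N && (x + geq_count d w <= y + geq_count c w)%N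
    \/ (c <= d)%N && (x + (size w - geq_count c w) + geq_count d w <= y + h')%N ->
  exists2 e, exchange_kind e d &
    (x + geq_count d w' <= y + (h' - fixed_count e w w') + geq_count c w')%N.
Proof.
move=> sw' [/andP [dc H]|/andP [cd H]].
  exists (fun u => ~~ (d <= u < c)%N); first by exists c; left.
  rewrite /fixed_count; have := geq_count_interval w dc; have := geq_count_interval w' dc.
  have := count_predCE (fun u : 'I_n => d <= u < c)%N w'.
  have -> : count (fun u : 'I_n => ~~ ~~ (d <= u < c)%N) w = count (fun u : 'I_n => d <= u < c)%N w.
    by apply: eq_count => u; rewrite negbK.
  by rewrite sw'; lia.
exists (fun u => (c <= u < d)%N); first by exists c; right.
rewrite /fixed_count; have := geq_count_interval w cd; have := geq_count_interval w' cd.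
have := count_predCE (fun u : 'I_n => c <= u < d)%N w.
have := geq_count_size c w; have := geq_count_size c w'.
by rewrite sw'; lia.
Qed.

(** By [not_fits] the weight of J2 is too small at thresholds c and c' for its two sides;
   [greedy_gaps] turns these into thresholds for E0, with exchanges whose numbers of movable
   rows make up the difference. The bound fl is the cost of E0 at the new thresholds: a
   symbol of size h' under this bound has no refinement above E0. For h' = h the thresholds
   are at the top and fl is the weight of J1: a symbol of the same size and smaller weight
   precedes. *)
Lemma exchange_data E0 E1 J1 J2 : is_J J1 -> is_J J2 -> largest (fits E0 J1) E1 ->
    (size J2.2 <= size J1.2)%N -> ~ (exists F, fits E1 J2 F) ->
  exists ea da eb db fl, [/\ exchange_kind ea da, exchange_kind eb db,
    (J2.1 + geq_count da (unzip1 J2.2) + geq_count db (unzip2 J2.2) <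
      fl + (size J2.2 - fixed_count ea (unzip1 J1.2) (unzip1 J2.2)) +
           (size J2.2 - fixed_count eb (unzip2 J1.2) (unzip2 J2.2)))%N &
    forall J, is_J J -> size J.2 = size J2.2 ->
      (J.1 + geq_count da (unzip1 J.2) + geq_count db (unzip2 J.2) < fl)%N -> below E0 E1 J].
Proof.
move=> HJ1 HJ2 Hmax sz nf.
have szE1 := greedy_size HJ1 Hmax.
have [|c [c' [cp cq lt]]] := not_fits HJ2 _ nf; first by rewrite szE1.
have s1 : size (unzip1 J2.2) = size J2.2 by rewrite size_map.
have s2 : size (unzip2 J2.2) = size J2.2 by rewrite size_map.
move: sz; rewrite leq_eqVlt => /orP [/eqP eqs|lts].
  have fE1 := (fits_sides _ _ HJ1).1 (proj1 Hmax).
  case: fE1 => p1 p2 w _.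
  have [|ea ka Ha] := @side_exchange p c p (unzip1 J1.2) (unzip1 J2.2)
    (geq_count c (unzip1 J1.2)) 0 (size J2.2) s1.
    (* Equal sizes: the threshold is p, and all rows from c on are exchangeable. *)
    right; rewrite cp /= geq_count_top eqs -(size_map fst J1.2).
    by have := geq_count_size c (unzip1 J1.2); rewrite /unzip1; lia.
  have [|eb kb Hb] := @side_exchange q c' q (unzip2 J1.2) (unzip2 J2.2)
    (geq_count c' (unzip2 J1.2)) 0 (size J2.2) s2.
    right; rewrite cq /= geq_count_top eqs -(size_map snd J1.2).
    by have := geq_count_size c' (unzip2 J1.2); rewrite /unzip2; lia.
  exists ea, p, eb, q, J1.1; split=> //.
    move: Ha Hb lt; rewrite !geq_count_top -w !take_oversize ?size_map ?szE1 ?eqs //.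
    by rewrite /cost (geq_count_perm c p1) (geq_count_perm c' p2); lia.
  move=> J HJ sJ; rewrite !geq_count_top !addn0 => wJ.
  by apply: (below_wt HJ1 Hmax HJ) => //; rewrite sJ.
have [|ga gb] := greedy_gaps HJ1 Hmax (h' := size J2.2); first by rewrite szE1.
have [d dp Hd] := ga c cp; have [d' dq Hd'] := gb c' cq.
have [|ea ka Ha] := @side_exchange p c d (unzip1 J1.2) (unzip1 J2.2)
    (cost c (take (size J2.2) (map fst E1))) (cost d (take (size J2.2) (map fst E0))) (size J2.2) s1.
  by move: Hd; rewrite szE1 size_map.
have [|eb kb Hb] := @side_exchange q c' d' (unzip2 J1.2) (unzip2 J2.2)
    (cost c' (take (size J2.2) (map snd E1))) (cost d' (take (size J2.2) (map snd E0))) (size J2.2) s2.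
  by move: Hd'; rewrite szE1 size_map.
exists ea, d, eb, d', (cost d (take (size J2.2) (map fst E0)) + cost d' (take (size J2.2) (map snd E0)))%N.
split=> //; first by move: Ha Hb lt; lia.
move=> J HJ sJ wJ; split=> // F fF.
by have := fits_bound d d' HJ fF; rewrite sJ leqNgt wJ.
Qed.
End ExchangeData.

(** * Products of symbols and their bigrading *)

Section SymbolMinors.
Variables p q : nat.
Implicit Types J : Jsym p q.

(** The generating series of the symbols dbar^n (u | v), n >= 0, with the rows and columns
   of J. *)
Definition Jseries (R : comNzRingType) (X : 'M[fps R]_(p, q)) J : fps R :=
  minor (fun i => (tnth (in_tuple J.2) i).1) (fun j => (tnth (in_tuple J.2) j).2) X.

Lemma injective_perm (h n : nat) (u u' : 'I_h -> 'I_n) :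
  injective u' -> (forall i, u' i \in codom u) -> exists s : 'S_h, forall i, u' i = u (s i).
Proof.
move=> inj H; have injf : injective (fun i => iinv (H i)).
  by move=> i j /(congr1 u); rewrite !f_iinv => /inj.
by exists (perm injf) => i; rewrite permE f_iinv.
Qed.

Lemma minor_perm (R : comNzRingType) (h : nat) (u u' : 'I_h -> 'I_p) (v v' : 'I_h -> 'I_q)
    (s t : 'S_h) (X : 'M[R]_(p, q)) : (forall i, u' i = u (s i)) -> (forall i, v' i = v (t i)) ->
  minor u' v' X = (-1) ^+ (odd_perm s (+) odd_perm t) * minor u v X.
Proof.
move=> us vt; rewrite /minor.
have -> : mxsub u' v' X = row_perm s (col_perm t (mxsub u v X)).
  by apply/matrixP=> i j; rewrite !mxE us vt.
rewrite row_permE col_permE !det_mulmx !det_perm odd_permV signr_addb.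
by rewrite -mulrA; congr (_ * _); rewrite mulrC.
Qed.

Lemma minor_row_rep (R : comNzRingType) (h : nat) (u : 'I_h -> 'I_p) (v : 'I_h -> 'I_q)
    (X : 'M[R]_(p, q)) : ~ injective u -> minor u v X = 0.
Proof.
move=> ni; have [i [j [ne e]]] : exists i j, i != j /\ u i = u j.
  apply: contrapT => N; apply: ni => i j e; apply/eqP; apply: contraT => ne.
  by case: N; exists i, j.
apply: (determinant_alternate ne) => k; by rewrite !mxE e.
Qed.

Lemma minor_col_rep (R : comNzRingType) (h : nat) (u : 'I_h -> 'I_p) (v : 'I_h -> 'I_q)
    (X : 'M[R]_(p, q)) : ~ injective v -> minor u v X = 0.
Proof.
move=> ni; have [i [j [ne e]]] : exists i j, i != j /\ v i = v j.
  apply: contrapT => N; apply: ni => i j e; apply/eqP; apply: contraT => ne.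
  by case: N; exists i, j.
rewrite /minor -det_tr; apply: (determinant_alternate ne) => k; by rewrite !mxE e.
Qed.

Definition sort_ord n (w : seq 'I_n) := sort (fun i j : 'I_n => (i <= j)%N) w.

Lemma sort_ord_lt n (w : seq 'I_n) : uniq w -> sorted (fun i j : 'I_n => (i < j)%N) (sort_ord w).
Proof.
move=> uw; rewrite /sort_ord.
rewrite -[sorted _ _]/(sorted (relpre (@nat_of_ord n) ltn) (sort (fun i j : 'I_n => (i <= j)%N) w)).
rewrite -sorted_map ltn_sorted_uniq_leq.
rewrite map_inj_uniq ?sort_uniq ?uw; last exact: val_inj.
by rewrite sorted_map; apply: sort_sorted => a b; apply: leq_total.
Qed.

Lemma sorted_zip n m (s : seq 'I_n) (t : seq 'I_m) : size s = size t ->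
  sorted (fun i j : 'I_n => (i < j)%N) s -> sorted (fun i j : 'I_m => (i < j)%N) t ->
  sorted (fun a b : 'I_n * 'I_m => (a.1 < b.1)%N && (a.2 < b.2)%N) (zip s t).
Proof.
case: s t => [|x s] [|y t] //= [].
by elim: s x t y => [|x' s IH] x [|y' t] y //= [sz] /andP [-> /IH] H /andP [-> /H] ->.
Qed.

(** One sign for all matrices: the symbol has the sorted rows and columns, the permutations
   being those of the index functions. *)
Lemma minor_symbol (n h : nat) (u : 'I_h -> 'I_p) (v : 'I_h -> 'I_q) : (0 < h)%N ->
    injective u -> injective v ->
  exists J (b : bool), [/\ is_J J, J.1 = n, size J.2 = h, perm_eq (unzip1 J.2) (codom u) &
    perm_eq (unzip2 J.2) (codom v) /\
    forall (R : comNzRingType) (X : 'M[fps R]_(p, q)), minor u v X = (-1) ^+ b * Jseries X J].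
Proof.
move=> h0 iu iv; pose us := sort_ord (codom u); pose vs := sort_ord (codom v).
have su : size us = h by rewrite size_sort size_codom card_ord.
have sv : size vs = h by rewrite size_sort size_codom card_ord.
have sz : size (zip us vs) = h by rewrite size_zip su sv minnn.
have uu : uniq (codom u) by rewrite map_inj_uniq ?enum_uniq.
have uv : uniq (codom v) by rewrite map_inj_uniq ?enum_uniq.
have z1 : unzip1 (zip us vs) = us by rewrite unzip1_zip ?su ?sv.
have z2 : unzip2 (zip us vs) = vs by rewrite unzip2_zip ?su ?sv.
have pu : perm_eq us (codom u) by rewrite perm_sort.
have pv : perm_eq vs (codom v) by rewrite perm_sort.
have HJ : is_J ((n, zip us vs) : Jsym p q).
  rewrite /is_J /= sz h0 /=; apply: sorted_zip; rewrite ?su ?sv //; exact: sort_ord_lt.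
exists (n, zip us vs).
suff [b Hb] : exists b : bool, forall (R : comNzRingType) (X : 'M[fps R]_(p, q)),
    minor u v X = (-1) ^+ b * Jseries X (n, zip us vs).
  by exists b; split=> //=; rewrite ?z1 ?z2.
rewrite /Jseries /=; move: (zip us vs) sz z1 z2 => z sz z1 z2.
move: u v iu iv us vs su sv uu uv pu pv z1 z2 {HJ}; subst h => u v iu iv us vs su sv uu uv pu pv z1 z2.
have mem1 i : u i \in codom (fun i => (tnth (in_tuple z) i).1).
  have : u i \in unzip1 z by rewrite z1 (perm_mem pu) codom_f.
  case/mapP=> x /(tnthP (in_tuple z)) [k ->] ->; exact: (codom_f (fun i => (tnth (in_tuple z) i).1)).
have mem2 i : v i \in codom (fun i => (tnth (in_tuple z) i).2).
  have : v i \in unzip2 z by rewrite z2 (perm_mem pv) codom_f.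
  case/mapP=> x /(tnthP (in_tuple z)) [k ->] ->; exact: (codom_f (fun i => (tnth (in_tuple z) i).2)).
have [s Hs] := injective_perm iu mem1; have [t Ht] := injective_perm iv mem2.
exists (odd_perm s (+) odd_perm t) => R X; exact: minor_perm.
Qed.

Lemma Jseries_map (A B : comNzRingType) (f : {rmorphism A -> B}) (X : 'M[fps A]_(p, q)) J :
  Jseries (map_mx (fps_map f) X) J = fps_map f (Jseries X J).
Proof. exact: map_arc_minor. Qed.

End SymbolMinors.

Lemma fps_signM (R : comNzRingType) (b : bool) (f : fps R) n :
  ((-1) ^+ b * f) n = (-1) ^+ b * f n.
Proof. by case: b; rewrite ?expr0 ?mul1r // expr1 !mulN1r. Qed.

Definition jetpoly (K : fieldType) (p q : nat) : comNzRingType :=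
  {malg K[{cmonom var p q}]}.

Section Generic.
Variables (K : fieldType) (p q : nat).
Local Notation PP := (jetpoly K p q).
Implicit Types (J : Jsym p q) (Js Ls : seq (Jsym p q)) (f g : PP).

Definition genX : 'M[fps PP]_(p, q) := \matrix_(i, j) Fps (fun k => << ucm (i, j, k) >>).

Definition Jpoly J : PP := Jseries genX J J.1.

Definition Jprod Js : PP := \prod_(J <- Js) Jpoly J.

Lemma Jprod_cat Js Ls : Jprod (Js ++ Ls) = Jprod Js * Jprod Ls.
Proof. by rewrite /Jprod big_cat. Qed.

Lemma Jprod_perm Js Ls : perm_eq Js Ls -> Jprod Js = Jprod Ls.
Proof. exact: perm_big. Qed.

(** Linear combinations of the products satisfying Q; the inductive form makes replacing
   each product by a combination a plain induction. *)
Inductive spanned (Q : seq (Jsym p q) -> Prop) : PP -> Prop :=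
| spanned0 : spanned Q 0
| spannedS c Js f : Q Js -> spanned Q f -> spanned Q (c%:MP * Jprod Js + f).

Lemma spannedD Q f g : spanned Q f -> spanned Q g -> spanned Q (f + g).
Proof.
move=> Hf Hg; elim: Hf => [|c Js f' QJ _ IH]; first by rewrite add0r.
by rewrite -addrA; apply: spannedS.
Qed.

Lemma spannedZ Q c f : spanned Q f -> spanned Q (c%:MP * f).
Proof.
elim=> [|d Js g QJ _ IH]; first by rewrite mulr0; apply: spanned0.
by rewrite mulrDr mulrA -mpolyCM; apply: spannedS.
Qed.

Lemma spanned_gen (Q : seq (Jsym p q) -> Prop) Js : Q Js -> spanned Q (Jprod Js).
Proof.
by move=> QJ; rewrite -[Jprod Js]mul1r -(mpolyC1E _ K) -[_ * _]addr0; apply/spannedS/spanned0.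
Qed.

Lemma spannedN Q f : spanned Q f -> spanned Q (- f).
Proof.
move=> Hf; rewrite -mulN1r.
have -> : -1 = (-1)%:MP :> PP by rewrite rmorphN rmorph1.
exact: spannedZ.
Qed.

Lemma spanned_sign Q (b : bool) f : spanned Q f -> spanned Q ((-1) ^+ b * f).
Proof. by case: b; rewrite ?expr0 ?mul1r // expr1 mulN1r; apply: spannedN. Qed.

Lemma spanned_sum (I : Type) (r : seq I) (P : pred I) (F : I -> PP) Q :
  (forall i, P i -> spanned Q (F i)) -> spanned Q (\sum_(i <- r | P i) F i).
Proof. by move=> H; apply: big_ind => //; [exact: spanned0 | exact: spannedD]. Qed.

Lemma spanned_bind (Q Q' : seq (Jsym p q) -> Prop) f :
  (forall Js, Q Js -> spanned Q' (Jprod Js)) -> spanned Q f -> spanned Q' f.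
Proof.
move=> H; elim=> [|c Js g QJ _ IH]; first exact: spanned0.
by apply: spannedD => //; apply/spannedZ/H.
Qed.

Lemma spanned_mono (Q Q' : seq (Jsym p q) -> Prop) f :
  (forall Js, Q Js -> Q' Js) -> spanned Q f -> spanned Q' f.
Proof. by move=> H; apply: spanned_bind => Js /H; apply: spanned_gen. Qed.

Lemma spanned_mulr (Q Q' : seq (Jsym p q) -> Prop) f Ls :
  (forall Js, Q Js -> Q' (Js ++ Ls)) -> spanned Q f -> spanned Q' (f * Jprod Ls).
Proof.
move=> H; elim=> [|c Js g QJ _ IH]; first by rewrite mul0r; apply: spanned0.
by rewrite mulrDl -mulrA -Jprod_cat; apply: spannedS => //; apply: H.
Qed.

Lemma Jpoly_var (w : var p q) : Jpoly (w.2, [:: w.1]) = << ucm w >>.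
Proof.
case: w => [[i j] k]; by rewrite /Jpoly /Jseries /minor /= det_mx11 !mxE.
Qed.

Definition sz_sum Js : nat := (\sum_(J <- Js) size J.2)%N.
Definition wt_sum Js : nat := (\sum_(J <- Js) J.1)%N.

Lemma sz_sum_cat Js Ls : sz_sum (Js ++ Ls) = (sz_sum Js + sz_sum Ls)%N.
Proof. by rewrite /sz_sum big_cat. Qed.
Lemma wt_sum_cat Js Ls : wt_sum (Js ++ Ls) = (wt_sum Js + wt_sum Ls)%N.
Proof. by rewrite /wt_sum big_cat. Qed.

Lemma all_spanned f : spanned (fun Js => forall J, J \in Js -> is_J J) f.
Proof.
elim/malg_ind: f => [|f g|c m]; [exact: spanned0 | exact: spannedD |].
apply: spannedZ; elim/cmonom_ind: m => [|w m IH].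
  have -> : << mone >> = Jprod [::] :> PP by rewrite /Jprod big_nil; exact: mpolyC1E.
  exact: spanned_gen.
have -> : << mmul (ucm w) m >> = << m >> * Jprod [:: (w.2, [:: w.1])] :> PP.
  by rewrite /Jprod big_seq1 Jpoly_var mulrC; exact: malgUM.
apply: spanned_mulr IH => Js HJs J; rewrite mem_cat => /orP [/HJs //|].
by rewrite inE => /eqP ->.
Qed.

Local Notation PPyz := {poly {poly PP}}.
Definition grade_const : {rmorphism PP -> PPyz} := (@polyC {poly PP} \o @polyC PP)%FUN.
Definition grade_var (w : var p q) : PPyz := 'X * ('X^(w.2))%:P * grade_const << ucm w >>.
(** The substitution of y z^k x_ij^(k) for x_ij^(k); y and z record the size and the weight. *)
Definition grade : {rmorphism PP -> PPyz} :=
  eval grade_var (grade_const \o @malgC {cmonom var p q} K)%FUN.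

Definition homog (D N : nat) f : Prop := grade f = 'X^D * ('X^N)%:P * grade_const f.

Lemma homogM D N D' N' f g : homog D N f -> homog D' N' g -> homog (D + D') (N + N') (f * g).
Proof.
move=> Hf Hg; rewrite /homog rmorphM Hf Hg !exprD polyCM (rmorphM grade_const).
by rewrite mulrACA; congr (_ * _); rewrite mulrACA.
Qed.

Lemma homog0 D N : homog D N 0.
Proof. by rewrite /homog !rmorph0 mulr0. Qed.

Lemma homogD D N f g : homog D N f -> homog D N g -> homog D N (f + g).
Proof. by rewrite /homog !rmorphD /= mulrDr => -> ->. Qed.

Lemma homogN D N f : homog D N f -> homog D N (- f).
Proof. by rewrite /homog !rmorphN /= => ->; rewrite mulrN. Qed.

Lemma homog_sum D N (I : Type) (r : seq I) (P : pred I) (F : I -> PP) :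
  (forall i, P i -> homog D N (F i)) -> homog D N (\sum_(i <- r | P i) F i).
Proof. by move=> H; apply: (big_ind (homog D N)); [apply: homog0 | apply: homogD | apply: H]. Qed.

Lemma homogMn D N f k : homog D N f -> homog D N (f *+ k).
Proof.
move=> Hf; elim: k => [|k IH]; first by rewrite mulr0n; apply: homog0.
by rewrite mulrS; apply: homogD.
Qed.

Lemma homog_sign D N (b : bool) f : homog D N f -> homog D N ((-1) ^+ b * f).
Proof.
move=> Hf; case: b; first by rewrite expr1 mulN1r; apply: homogN.
by rewrite expr0 mul1r; apply: Hf.
Qed.

Lemma homogC c : homog 0 0 c%:MP.
Proof. by rewrite /homog /grade /= eval_const !expr0 !mul1r. Qed.

(** Multiplying X by y multiplies its h-minors by y^h, and substituting z t for t multiplies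
   the coefficient of t^n by z^n. *)
Lemma homog_minor h (u : 'I_h -> 'I_p) (v : 'I_h -> 'I_q) n : homog h n (minor u v genX n).
Proof.
rewrite /homog -[LHS]/(fps_map grade (minor u v genX) n) -map_arc_minor.
have -> : map_mx (fps_map grade) genX =
    \matrix_(i, j) (fpsC 'X * map_mx (fps_ev grade_const ('X%:P)) genX i j).
  apply/matrixP=> i j; rewrite !mxE; apply/fpsP=> k; rewrite fpsCM /= /grade /= eval_var.
  by rewrite /grade_var rmorphXn /= -mulrA [_ ^+ k * _]mulrC.
rewrite /minor.
have -> : mxsub u v (\matrix_(i, j) (fpsC 'X * map_mx (fps_ev grade_const ('X%:P)) genX i j)) =
    \matrix_(i, j) (fpsC 'X * map_mx (fps_ev grade_const ('X%:P)) (mxsub u v genX) i j * 1).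
  by apply/matrixP=> i j; rewrite !mxE mulr1.
rewrite det_scale big1_eq mulr1 prodr_const card_ord det_map_mx -rmorphXn fpsCM /=.
by rewrite -mulrA rmorphXn /= [_ ^+ n * _]mulrC.
Qed.

Lemma homog_Jpoly J : homog (size J.2) J.1 (Jpoly J).
Proof. exact: homog_minor. Qed.

Lemma homog_Jprod Js : homog (sz_sum Js) (wt_sum Js) (Jprod Js).
Proof.
rewrite /sz_sum /wt_sum /Jprod; elim: Js => [|J Js IH].
  by rewrite !big_nil -(mpolyC1E _ K); apply: homogC.
by rewrite !big_cons; apply: homogM; [apply: homog_Jpoly | apply: IH].
Qed.

Definition component (D N : nat) f : PP := (grade f)`_D`_N.

Lemma component_homog D N D' N' f : homog D' N' f ->
  component D N f = if (D == D') && (N == N') then f else 0.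
Proof.
rewrite /component => ->; rewrite -mulrA coefXnM.
case: ltngtP => [_|lt|->]; first by rewrite coef0.
  by rewrite -polyCM coefC subn_eq0 leqNgt lt /= coef0.
rewrite subnn -polyCM coefC eqxx coefXnM /=.
case: ltngtP => [_|lt|->]; last by rewrite subnn coefC eqxx.
  by [].
by rewrite coefC subn_eq0 leqNgt lt.
Qed.

Lemma componentD D N f g : component D N (f + g) = component D N f + component D N g.
Proof. by rewrite /component rmorphD /= !coefD. Qed.
End Generic.

(** * Windows of binomial moments *)

Section Window.
Variables (V : zmodType) (P : V -> Prop).
Hypotheses (P0 : P 0) (PB : forall x y, P x -> P y -> P (x - y)).

Let PN x : P x -> P (- x). Proof. by move=> Hx; rewrite -sub0r; apply: PB. Qed.
Let PD x y : P x -> P y -> P (x + y).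
Proof. by move=> Hx Hy; rewrite -[y]opprK; apply: PB => //; apply: PN. Qed.
Let PMn x k : P x -> P (x *+ k).
Proof. by move=> Hx; elim: k => [|k IH]; rewrite ?mulr0n // mulrS; apply: PD. Qed.
Let Psum (I : Type) (r : seq I) (Q : pred I) (F : I -> V) :
  (forall i, Q i -> P (F i)) -> P (\sum_(i <- r | Q i) F i).
Proof. by move=> H; apply: (big_ind P). Qed.

(** Pascal's rule reduces to s = 0, where the matrix of binomial coefficients is
   unitriangular. *)
Lemma binomial_moments k (b : 'I_k -> V) (s : nat) :
  (forall i, (i < k)%N -> P (\sum_(j < k) b j *+ 'C(s + j, i))) -> forall j, P (b j).
Proof.
elim: s => [|s IH] H.
  (* Downward induction on j: the moment of order j involves only the unknowns from j on. *)
  have D m : forall j : 'I_k, (k - j <= m)%N -> P (b j).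
    elim: m => [|m IHm] j; first by have := ltn_ord j; lia.
    move=> kj; have := H j (ltn_ord j); rewrite (bigD1 j) //= binn mulr1n => Hj.
    have -> : b j = (b j + \sum_(i < k | i != j) b i *+ 'C(i, j)) - \sum_(i < k | i != j) b i *+ 'C(i, j).
      by rewrite addrK.
    apply: PB => //; apply: Psum => i ne.
    case: (ltngtP i j) => [lt|lt|/val_inj e]; last by rewrite e eqxx in ne.
      by rewrite bin_small // mulr0n.
    by apply/PMn/IHm; lia.
  by move=> j; apply: (D k); rewrite leq_subr.
apply: IH; elim=> [|i IHi] ik; first by
  have := H 0%N ik; congr P; apply: eq_bigr => j _; rewrite !bin0.
have -> : \sum_(j < k) b j *+ 'C(s + j, i.+1) =
    \sum_(j < k) b j *+ 'C(s.+1 + j, i.+1) - \sum_(j < k) b j *+ 'C(s + j, i).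
  by rewrite -sumrB; apply: eq_bigr => j _; rewrite addSn binS mulrnDr addrK.
by apply: PB; [apply: H | apply: IHi; lia].
Qed.

(** The values outside the window can be subtracted from the moments, which leaves k
   unknowns and k equations with an invertible integral matrix. *)
Lemma moment_window (N k fl : nat) (a : nat -> V) :
    (forall i, (i < k)%N -> P (\sum_(m < N.+1) a m *+ 'C(m, i))) ->
    (forall m, (m <= N)%N -> (m < fl)%N || (fl + k <= m)%N -> P (a m)) ->
  forall m, (m <= N)%N -> P (a m).
Proof.
move=> H Hout; pose b m := if (m <= N)%N then a m else 0.
have Hb (j : 'I_k) : P (b (fl + j)%N).
  apply: (binomial_moments (b := fun j : 'I_k => b (fl + j)%N) (s := fl)) => i ik.
  have -> : \sum_(j < k) b (fl + j)%N *+ 'C(fl + j, i) =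
      \sum_(m < N.+1) a m *+ 'C(m, i) -
      \sum_(m < N.+1 | (m < fl)%N || (fl + k <= m)%N) a m *+ 'C(m, i).
    rewrite [X in _ = X - _](bigID (fun m : 'I_N.+1 => (m < fl)%N || (fl + k <= m)%N)) /=.
    rewrite addrAC subrr add0r.
    rewrite -(big_mkord (fun m => ~~ ((m < fl)%N || (fl + k <= m)%N)) (fun m => a m *+ 'C(m, i))).
    rewrite -(big_mkord xpredT (fun j => b (fl + j)%N *+ 'C(fl + j, i))).
    have -> : \sum_(0 <= j < k) b (fl + j)%N *+ 'C(fl + j, i) =
        \sum_(fl <= m < fl + k) b m *+ 'C(m, i).
      have := big_addn 0 (fl + k) fl xpredT (fun m => b m *+ 'C(m, i)).
      by rewrite add0n addKn => ->; apply: eq_bigr => j' _; rewrite addnC.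
    have fkM : (fl + k <= fl + k + N.+1)%N by rewrite leq_addr.
    have NM : (N.+1 <= fl + k + N.+1)%N by rewrite leq_addl.
    rewrite (big_nat_widen _ _ _ _ _ fkM) (big_nat_widenl fl 0) // (big_nat_widen _ _ _ _ _ NM).
    rewrite big_mkcond [RHS]big_mkcond; apply: eq_bigr => m _ /=.
    rewrite negb_or -leqNgt -ltnNge /b ltnS andbC.
    by case: (leqP m N) => _; rewrite ?andbT ?andbF // mul0rn if_same.
  by apply: PB; [apply: H | apply: Psum => m Hm; apply/PMn/Hout => //; rewrite -ltnS].
move=> m mN; case: (ltnP m fl) => mf; first by apply: Hout => //; rewrite mf.
case: (leqP (fl + k) m) => mk; first by apply: Hout => //; rewrite mk orbT.
have jk : (m - fl < k)%N by lia.
by have := Hb (Ordinal jk); rewrite /= subnKC // /b mN.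
Qed.
End Window.

(** * Distributing rows over two minors *)

Section ShuffleSide.
Variables (n h h' : nat) (w : h.-tuple 'I_n) (w' : h'.-tuple 'I_n).
Local Notation I := 'I_(h + h').
Implicit Types (S : {set I}) (e : pred nat) (Q : pred 'I_n).

(** The rows of both symbols in one sequence; they may contain repetitions, which is why
   index sets and not sets of rows are distributed. *)
Definition joint (i : I) : 'I_n :=
  match split i with inl j => tnth w j | inr j => tnth w' j end.

Lemma joint_l j : joint (lshift h' j) = tnth w j.
Proof. by rewrite /joint (unsplitK (inl _ j)). Qed.
Lemma joint_r j : joint (rshift h j) = tnth w' j.
Proof. by rewrite /joint (unsplitK (inr _ j)). Qed.

Definition kept_left e : pred I := fun i =>
  match split i with inl _ => true | inr j => ~~ e (tnth w' j) end.
Definition kept_right e : pred I := fun i =>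
  match split i with inl j => e (tnth w j) | inr _ => true end.

Lemma kept_or e i : kept_left e i || kept_right e i.
Proof. by rewrite /kept_left /kept_right; case: split => j; rewrite ?orbT. Qed.

Lemma card_split (P : pred I) :
  #|P| = (#|[pred j | P (lshift h' j)]| + #|[pred j | P (rshift h j)]|)%N.
Proof. by rewrite -!sum1_card big_mkcond big_split_ord /= -!big_mkcond. Qed.

Lemma count_tnth m (t : m.-tuple 'I_n) Q : #|[pred j | Q (tnth t j)]| = count Q t.
Proof.
by rewrite -sum1_card -sum1_count big_tuple; apply: eq_bigl => j; rewrite inE.
Qed.

Lemma fixed_countE e : #|[predC predI (kept_left e) (kept_right e)]| = fixed_count e w w'.
Proof.
rewrite card_split /fixed_count -!count_tnth; congr (_ + _)%N; apply: eq_card => j.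
  by rewrite !inE /kept_left /kept_right (unsplitK (inl _ j)).
by rewrite !inE /kept_left /kept_right (unsplitK (inr _ j)) andbT negbK.
Qed.

Lemma codom_perm_enum k (f : 'I_k -> I) (A : {set I}) : injective f -> (forall i, f i \in A) ->
  #|A| = k -> perm_eq (codom f) (enum A).
Proof.
move=> inj fA cA; have su : uniq (codom f) by rewrite map_inj_uniq ?enum_uniq.
have sub : {subset codom f <= enum A} by move=> x /codomP [i ->]; rewrite mem_enum.
have sz : (size (enum A) <= size (codom f))%N by rewrite size_codom card_ord -cardE cA.
apply: uniq_perm; [exact: su | exact: enum_uniq |].
by have [_] := uniq_min_size su sub sz.
Qed.

Lemma codom_selL S : #|S| = h -> perm_eq (codom (@selL h h' S)) (enum S).
Proof.
move=> cS; apply: codom_perm_enum => // [i j E|i]; last exact: selL_in.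
have := @sel_inj h h' S cS (lshift h' i) (lshift h' j).
by rewrite /glue !(unsplitK (inl _ _)) => /(_ E) /(@lshift_inj h h').
Qed.

Lemma codom_selR S : #|S| = h -> perm_eq (codom (@selR h h' S)) (enum (~: S)).
Proof.
move=> cS; apply: codom_perm_enum => [i j E|i|]; last 1 first.
- by have := cardsC S; rewrite card_ord cS => /addnI.
- have := @sel_inj h h' S cS (rshift h i) (rshift h j).
  by rewrite /glue !(unsplitK (inr _ _)) => /(_ E) /(@rshift_inj h h').
- by rewrite in_setC selR_in.
Qed.

Definition left_part S : seq 'I_n := codom (joint \o @selL h h' S).
Definition right_part S : seq 'I_n := codom (joint \o @selR h h' S).

Lemma codom_comp (m k : nat) (f : 'I_m -> 'I_k) (g : 'I_k -> 'I_n) :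
  codom (g \o f) = map g (codom f).
Proof. by rewrite /codom /image_mem -map_comp. Qed.

Lemma count_enum (A : {set I}) (P : pred I) : count P (enum A) = #|[pred i in A | P i]|.
Proof. by rewrite -sum1_count -sum1_card big_enum_cond; apply: eq_bigl => i; rewrite inE. Qed.

Lemma geq_left S d : #|S| = h -> geq_count d (left_part S) = #|[pred i in S | (d <= joint i)%N]|.
Proof.
move=> cS; rewrite /geq_count /left_part codom_comp count_map.
by rewrite (seq.permP (codom_selL cS)) count_enum.
Qed.

Lemma geq_right S d : #|S| = h ->
  geq_count d (right_part S) = #|[pred i | (i \notin S) && (d <= joint i)%N]|.
Proof.
move=> cS; rewrite /geq_count /right_part codom_comp count_map.
by rewrite (seq.permP (codom_selR cS)) count_enum; apply: eq_card => i; rewrite !inE.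
Qed.

Lemma geq_total S d : #|S| = h ->
  (geq_count d (left_part S) + geq_count d (right_part S) = geq_count d w + geq_count d w')%N.
Proof.
move=> cS; rewrite geq_left // geq_right // /geq_count -!count_tnth.
have -> : (#|[pred j | d <= tnth w j]| + #|[pred j | d <= tnth w' j]|)%N = #|[pred i | (d <= joint i)%N]|.
  by rewrite card_split; congr (_ + _)%N; apply: eq_card => j; rewrite !inE ?joint_l ?joint_r.
rewrite -(cardID (mem S) [pred i | (d <= joint i)%N]); congr (_ + _)%N; apply: eq_card => i;
  by rewrite !inE andbC.
Qed.

(** The distribution that gives back the two original factors. *)
Definition unmoved : {set I} := [set lshift h' j | j : 'I_h].

Lemma mem_unmoved_l j : lshift h' j \in unmoved. Proof. by apply/imsetP; exists j. Qed.
Lemma mem_unmoved_r j : rshift h j \notin unmoved.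
Proof. by apply/imsetP => -[i _ /eqP]; rewrite eq_sym eq_lrshift. Qed.
Lemma card_unmoved : #|unmoved| = h.
Proof. by rewrite card_imset ?card_ord //; apply: lshift_inj. Qed.

Lemma left_part_unmoved : perm_eq (left_part unmoved) w.
Proof.
rewrite /left_part codom_comp (perm_trans (perm_map _ (codom_selL card_unmoved))) //.
have -> : w = map joint (map (@lshift h h') (enum 'I_h)) :> seq _.
  by rewrite -map_comp -[LHS]map_tnth_enum; apply: eq_map => j /=; rewrite joint_l.
have un : uniq (map (@lshift h h') (enum 'I_h)) by rewrite (map_inj_uniq (@lshift_inj h h')) enum_uniq.
apply: perm_map; apply: uniq_perm; [exact: enum_uniq | exact: un |].
by move=> i; rewrite mem_enum; apply/imsetP/mapP => -[j _ ->]; exists j => //; rewrite mem_enum.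
Qed.

Lemma right_part_unmoved : perm_eq (right_part unmoved) w'.
Proof.
rewrite /right_part codom_comp (perm_trans (perm_map _ (codom_selR card_unmoved))) //.
have -> : w' = map joint (map (@rshift h h') (enum 'I_h')) :> seq _.
  by rewrite -map_comp -[LHS]map_tnth_enum; apply: eq_map => j /=; rewrite joint_r.
have un : uniq (map (@rshift h h') (enum 'I_h')) by rewrite (map_inj_uniq (@rshift_inj h h')) enum_uniq.
apply: perm_map; apply: uniq_perm; [exact: enum_uniq | exact: un |].
move=> i; rewrite mem_enum in_setC; apply/idP/mapP => [|[j _ ->]]; last exact: mem_unmoved_r.
rewrite -{1}(splitK i); case: (split i) (splitK i) => j <-; first by rewrite mem_unmoved_l.
by exists j => //; rewrite mem_enum.
Qed.

Lemma allowed_unmoved e : allowed (kept_left e) (kept_right e) unmoved.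
Proof.
rewrite /allowed card_unmoved eqxx /=; apply/forallP => i; rewrite -(splitK i).
case: (split i) => j /=; rewrite ?mem_unmoved_l ?(negPf (mem_unmoved_r j));
  by rewrite /kept_left /kept_right ?(unsplitK (inl _ j)) ?(unsplitK (inr _ j)).
Qed.

(** As many rows leave the first symbol as enter it. For the first shape the rows entering
   lie in [d, c), those leaving do not; for the second the rows leaving lie in [c, d), those
   entering do not. So no more of the rows that are at least d leave than enter. If as many
   do, then for the first shape all rows leaving are at least c, for the second all rows
   entering are below c; either way rows are replaced by smaller ones only. *)
Lemma allowed_left e d S : exchange_kind e d -> allowed (kept_left e) (kept_right e) S ->
  (geq_count d w <= geq_count d (left_part S))%N /\
  (geq_count d (left_part S) = geq_count d w ->
    (forall x, (geq_count x (left_part S) <= geq_count x w)%N) /\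
    ((forall x, geq_count x (left_part S) = geq_count x w) -> S = unmoved)).
Proof.
move=> ke /andP [/eqP cS /forallP okS].
(* The rows at least x that leave, resp. enter, the first factor. *)
pose out x := #|[pred j : 'I_h | (lshift h' j \notin S) && (x <= tnth w j)%N]|.
pose inn x := #|[pred j : 'I_h' | (rshift h j \in S) && (x <= tnth w' j)%N]|.
have LE x : (geq_count x (left_part S) + out x = geq_count x w + inn x)%N.
  rewrite geq_left // card_split /geq_count -count_tnth -/(inn x).
  rewrite -(cardID [pred j | lshift h' j \in S] [pred j | (x <= tnth w j)%N]).
  have -> : #|[pred j : 'I_h | [pred i in S | (x <= joint i)%N] (lshift h' j)]| =
      #|[predI [pred j | (x <= tnth w j)%N] & [pred j | lshift h' j \in S]]|.
    by apply: eq_card => j; rewrite !inE joint_l andbC.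
  have -> : #|[pred j : 'I_h' | [pred i in S | (x <= joint i)%N] (rshift h j)]| = inn x.
    by apply: eq_card => j; rewrite !inE joint_r.
  have -> : #|[predD [pred j | (x <= tnth w j)%N] & [pred j | lshift h' j \in S]]| = out x.
    by apply: eq_card => j; rewrite !inE.
  by rewrite -!addnA; congr (_ + _)%N; rewrite addnC.
have out_e j : lshift h' j \notin S -> e (tnth w j).
  by move=> jS; have := okS (lshift h' j); rewrite (negPf jS) /kept_right (unsplitK (inl _ j)).
have inn_e j : rshift h j \in S -> ~~ e (tnth w' j).
  by move=> jS; have := okS (rshift h j); rewrite jS /kept_left (unsplitK (inr _ j)).
have out_anti x y : (x <= y)%N -> (out y <= out x)%N.
  move=> xy; apply/subset_leq_card/subsetP => j; rewrite !inE => /andP [-> /(leq_trans xy)].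
  by [].
have inn_anti x y : (x <= y)%N -> (inn y <= inn x)%N.
  move=> xy; apply/subset_leq_card/subsetP => j; rewrite !inE => /andP [-> /(leq_trans xy)].
  by [].
have eq0 : out 0%N = inn 0%N.
  have := LE 0%N; rewrite !geq_count0 size_tuple size_codom card_ord; exact: addnI.
have fin : out 0%N = 0%N -> S = unmoved.
  move=> o0; apply/eqP; rewrite eq_sym eqEcard card_unmoved cS leqnn andbT.
  apply/subsetP => i /imsetP [j _ ->]; apply: contraT => jS.
  by have := card0_eq o0 j; rewrite !inE jS.
have out_eq x y : (x <= y)%N -> (forall j, lshift h' j \notin S -> (x <= tnth w j)%N -> (y <= tnth w j)%N) ->
    out x = out y.
  move=> xy H; apply/eqP; rewrite eqn_leq (out_anti _ _ xy) andbT.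
  by apply/subset_leq_card/subsetP => j; rewrite !inE => /andP [jS /(H j jS) ->]; rewrite jS.
have inn_eq x y : (x <= y)%N -> (forall j, rshift h j \in S -> (x <= tnth w' j)%N -> (y <= tnth w' j)%N) ->
    inn x = inn y.
  move=> xy H; apply/eqP; rewrite eqn_leq (inn_anti _ _ xy) andbT.
  by apply/subset_leq_card/subsetP => j; rewrite !inE => /andP [jS /(H j jS) ->]; rewrite jS.
case: ke => c [[dc eE]|[cd eE]].
  have o1 : out d = out c.
    by apply: out_eq => // j /out_e; rewrite eE negb_and -leqNgt => /orP [/negPf ->|//].
  have i1 : inn 0%N = inn d by apply: inn_eq => // j /inn_e; rewrite eE negbK => /andP [].
  have i2 : inn c = 0%N.
    apply: eq_card0 => j; rewrite !inE; apply/negP => /andP [/inn_e].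
    by rewrite eE negbK => /andP [_]; rewrite ltnNge => /negPf ->.
  split; first by have := LE d; have := out_anti 0%N d isT; lia.
  move=> Ed; have Ld := LE d; split.
    move=> x; have := LE x; case: (leqP x c) => xc.
      by have := out_anti x c xc; have := inn_anti 0%N x isT; lia.
    by have := inn_anti c x (ltnW xc); lia.
  by move=> E; apply: fin; have := LE c; rewrite E i2; lia.
have o1 : out 0%N = out c by apply: out_eq => // j /out_e; rewrite eE => /andP [].
have o2 : out d = 0%N.
  apply: eq_card0 => j; rewrite !inE; apply/negP => /andP [/out_e].
  by rewrite eE => /andP [_]; rewrite ltnNge => /negPf ->.
have i1 : inn c = inn d.
  by apply: inn_eq => // j /inn_e; rewrite eE negb_and -leqNgt => /orP [/negPf ->|//].
split; first by have := LE d; lia.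
move=> Ed; have Ld := LE d; split.
  move=> x; have := LE x; case: (leqP x c) => xc.
    by have := out_anti x c xc; have := inn_anti 0%N x isT; lia.
  by have := inn_anti c x (ltnW xc); lia.
by move=> E; apply: fin; have := LE c; rewrite E; lia.
Qed.
End ShuffleSide.

(** * The ideal of the larger minors *)

Section MinorIdeal.
Variables (K : fieldType) (p q h : nat).
Local Notation PP := (jetpoly K p q).
Implicit Types f g : PP.

Inductive minor_ideal : PP -> Prop :=
| minor_ideal0 : minor_ideal 0
| minor_idealS (u : 'I_h.+1 -> 'I_p) (v : 'I_h.+1 -> 'I_q) n g f :
    minor_ideal f -> minor_ideal (minor u v (genX K p q) n * g + f).

Lemma minor_idealD f g : minor_ideal f -> minor_ideal g -> minor_ideal (f + g).
Proof.
move=> Hf Hg; elim: Hf => [|u v n g' f' _ IH]; first by rewrite add0r.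
by rewrite -addrA; apply: minor_idealS.
Qed.

Lemma minor_idealM a f : minor_ideal f -> minor_ideal (a * f).
Proof.
elim=> [|u v n g f' _ IH]; first by rewrite mulr0; apply: minor_ideal0.
by rewrite mulrDr mulrCA; apply: minor_idealS.
Qed.

Definition in_minor_ideal : pred PP := fun f => `[< minor_ideal f >].

Definition eval0 : {rmorphism PP -> K} :=
  eval (fun _ : var p q => 0 : K) (idfun : {rmorphism K -> K}).

(** All the variables, hence all the minors, vanish at the origin; so the quotient is not
   the zero ring. *)
Lemma minor_ideal_proper f : minor_ideal f -> eval0 f = 0.
Proof.
elim=> [|u v n g f' _ IH]; first by rewrite rmorph0.
rewrite rmorphD rmorphM IH addr0; set ev := eval0.
suff -> : ev (minor u v (genX K p q) n) = 0 by rewrite mul0r.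
rewrite -[LHS]/(fps_map ev (minor u v (genX K p q)) n) -map_arc_minor.
suff -> : map_mx (fps_map ev) (genX K p q) = 0.
  rewrite /minor (expand_det_row _ ord0) fps_sumE big1 // => j _.
  by rewrite !mxE mul0r.
by apply/matrixP=> i j; rewrite !mxE; apply/fpsP=> k; rewrite /= /ev /eval0 /= eval_var.
Qed.

Fact in_minor_ideal_closed : idealr_closed in_minor_ideal.
Proof.
split=> [||a f g /asboolP Hf /asboolP Hg].
- by apply/asboolP; apply: minor_ideal0.
- apply/negP => /asboolP /minor_ideal_proper; rewrite rmorph1 => /eqP; by rewrite oner_eq0.
- by apply/asboolP/minor_idealD => //; apply: minor_idealM.
Qed.
HB.instance Definition _ := isIdealr.Build PP in_minor_ideal in_minor_ideal_closed.

Definition jet_ring : comNzRingType := {ideal_quot (in_minor_ideal : idealr PP)}.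
Definition jet_pi : {rmorphism PP -> jet_ring} := (\pi_{ideal_quot (in_minor_ideal : idealr PP)})%qT.

Lemma jet_pi0 f : jet_pi f = 0 -> minor_ideal f.
Proof.
move=> H; have : jet_pi f = jet_pi 0 by rewrite rmorph0.
move/eqP; rewrite -(Quotient.idealrBE (in_minor_ideal : idealr PP)) subr0.
by move/asboolP.
Qed.

Lemma jet_pi_minor (u : 'I_h.+1 -> 'I_p) (v : 'I_h.+1 -> 'I_q) n :
  jet_pi (minor u v (genX K p q) n) = 0.
Proof.
rewrite -(rmorph0 jet_pi); apply/eqP.
rewrite -(Quotient.idealrBE (in_minor_ideal : idealr PP)) subr0; apply/asboolP.
rewrite -[X in minor_ideal X]mulr1 -[X in minor_ideal X]addr0.
by apply/minor_idealS/minor_ideal0.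
Qed.

Definition graded (D N : nat) (C : Jsym p q -> Prop) (Js : seq (Jsym p q)) : Prop :=
  [/\ forall J, J \in Js -> is_J J, sz_sum Js = D, wt_sum Js = N & exists2 J, J \in Js & C J].

(** The coefficients of a member of the ideal are combinations of products of symbols; the
   part of the given degree of each term is the term itself or zero. *)
Lemma component_minor_ideal D N f : minor_ideal f ->
  spanned (graded D N (fun J => size J.2 = h.+1)) (component D N f).
Proof.
have c0 : component D N (0 : PP) = 0 by rewrite /component rmorph0 !coef0.
elim=> [|u v n g f' _ IH]; first by rewrite c0; apply: spanned0.
rewrite componentD; apply: spannedD IH.
elim: (all_spanned g) => [|c Js g' HJs _ IH]; first by rewrite mulr0 c0; apply: spanned0.
rewrite mulrDr componentD; apply: spannedD IH.
have hm := homogM (homog_minor K u v n) (homogM (homogC p q c) (homog_Jprod K Js)).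
rewrite (component_homog _ _ hm) !add0n.
case: andP => [[/eqP eD /eqP eN]|_]; last exact: spanned0.
rewrite mulrCA; apply: spannedZ.
case: (pselect (injective u)) => [iu|nu]; last first.
  by rewrite minor_row_rep // mul0r; apply: spanned0.
case: (pselect (injective v)) => [iv|nv]; last first.
  by rewrite minor_col_rep // mul0r; apply: spanned0.
have [J [b [HJ Jn Jh _ [_ ->]]]] := minor_symbol n (ltn0Sn h) iu iv.
rewrite fps_signM -{1}Jn -mulrA; apply: spanned_sign.
have -> : Jseries (genX K p q) J J.1 * Jprod K Js = Jprod K (J :: Js) by rewrite /Jprod big_cons.
apply: spanned_gen; split.
- by move=> J'; rewrite inE => /orP [/eqP -> //|/HJs].
- by rewrite eD /sz_sum big_cons Jh.
- by rewrite eN /wt_sum big_cons Jn.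
- by exists J; rewrite ?mem_head.
Qed.

Lemma homog_minor_ideal D N f : minor_ideal f -> homog D N f ->
  spanned (graded D N (fun J => size J.2 = h.+1)) f.
Proof.
move=> If Hf; have := component_minor_ideal D N If.
by rewrite (component_homog _ _ Hf) !eqxx.
Qed.
End MinorIdeal.

(** * Shuffles of two symbols *)

Section Shift.
Variable R : comNzRingType.
Definition fpsX : fps R := Fps (fun n => (n == 1%N)%:R).

Lemma fpsXM (f : fps R) n : (fpsX * f) n = if n is n'.+1 then f n' else 0.
Proof.
case: n => [|n] /=; first by rewrite big_ord1 mul0r.
rewrite big_ord_recl mul0r add0r big_ord_recl /= mul1r subn1 /= big1 ?addr0 // => i _.
by rewrite mul0r.
Qed.

Lemma fpsXnM k (f : fps R) n : (fpsX ^+ k * f) n = if (n < k)%N then 0 else f (n - k)%N.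
Proof.
elim: k n => [|k IH] n; first by rewrite expr0 mul1r subn0.
by rewrite exprS -mulrA fpsXM; case: n => [|n] //; rewrite IH ltnS subSS.
Qed.
End Shift.

Lemma Jprod2 (K : fieldType) p q (J J' : Jsym p q) : Jprod K [:: J; J'] = Jpoly K J * Jpoly K J'.
Proof. by rewrite /Jprod big_cons big_seq1. Qed.

Lemma map_fpsX (A B : comNzRingType) (f : {rmorphism A -> B}) : fps_map f (fpsX A) = fpsX B.
Proof. by apply/fpsP=> n /=; rewrite rmorph_nat. Qed.

Lemma sum_geq (h n d : nat) (x : 'I_h -> 'I_n) :
  (\sum_(i < h) (d <= x i)%N = geq_count d (codom x))%N.
Proof.
rewrite /geq_count /codom /image_mem -sum1_count big_map [RHS]big_mkcond big_enum /=.
by apply: eq_bigr => i _; case: leqP.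
Qed.

Section Shuffled.
Variables (p q h h' : nat) (wa : h.-tuple 'I_p) (wa' : h'.-tuple 'I_p).
Variables (wb : h.-tuple 'I_q) (wb' : h'.-tuple 'I_q) (da db : nat).
Local Notation I := 'I_(h + h').
Implicit Types (S T : {set I}).

(** Multiplying the rows and columns beyond the thresholds by t raises the degree at which a
   symbol occurs in a minor by the number of its rows and columns beyond them, so that the
   degree combines the weight with these two counts. *)
Definition shifted (R : comNzRingType) (X : 'M[fps R]_(p, q)) : 'M[fps R]_(h + h') :=
  \matrix_(i, j) (fpsX R ^+ (da <= joint wa wa' i)%N * X (joint wa wa' i) (joint wb wb' j) *
                  fpsX R ^+ (db <= joint wb wb' j)%N).

Lemma det_shifted (R : comNzRingType) (X : 'M[fps R]_(p, q)) k (f g : 'I_k -> I) :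
  \det (mxsub f g (shifted X)) =
  fpsX R ^+ (geq_count da (codom (joint wa wa' \o f)) + geq_count db (codom (joint wb wb' \o g))) *
  minor (joint wa wa' \o f) (joint wb wb' \o g) X.
Proof.
have -> : mxsub f g (shifted X) = \matrix_(i, j)
    (fpsX R ^+ (da <= joint wa wa' (f i))%N *
     mxsub (joint wa wa' \o f) (joint wb wb' \o g) X i j * fpsX R ^+ (db <= joint wb wb' (g j))%N).
  by apply/matrixP=> i j; rewrite !mxE.
by rewrite det_scale !prodrXr !(sum_geq, exprD) /minor -!sum_geq.
Qed.

Lemma det_shifted_coef (R : comNzRingType) (X : 'M[fps R]_(p, q)) k (f g : 'I_k -> I) n
    (w := (geq_count da (codom (joint wa wa' \o f)) + geq_count db (codom (joint wb wb' \o g)))%N) :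
  \det (mxsub f g (shifted X)) n =
  if (n < w)%N then 0 else minor (joint wa wa' \o f) (joint wb wb' \o g) X (n - w)%N.
Proof. by rewrite det_shifted fpsXnM. Qed.

Lemma det_shifted_coef_le (R : comNzRingType) (X : 'M[fps R]_(p, q)) k (f g : 'I_k -> I) n :
  (geq_count da (codom (joint wa wa' \o f)) + geq_count db (codom (joint wb wb' \o g)) <= n)%N ->
  \det (mxsub f g (shifted X)) n = minor (joint wa wa' \o f) (joint wb wb' \o g) X
    (n - (geq_count da (codom (joint wa wa' \o f)) + geq_count db (codom (joint wb wb' \o g))))%N.
Proof. by rewrite det_shifted_coef ltnNge => ->. Qed.

Lemma map_shifted (A B : comNzRingType) (f : {rmorphism A -> B}) (X : 'M[fps A]_(p, q)) :
  map_mx (fps_map f) (shifted X) = shifted (map_mx (fps_map f) X).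
Proof. by apply/matrixP=> i j; rewrite !mxE !rmorphM !rmorphXn /= map_fpsX. Qed.

Variable K : fieldType.
Local Notation gX := (genX K p q).

Definition shuffle_term S T n m :=
  \det (mxsub (@selL h h' S) (@selL h h' T) (shifted gX)) n *
  \det (mxsub (@selR h h' S) (@selR h h' T) (shifted gX)) m.

Local Notation WL := (left_part wa wa').
Local Notation WR := (right_part wa wa').
Local Notation ZL := (left_part wb wb').
Local Notation ZR := (right_part wb wb').

Local Opaque Jseries genX minor geq_count left_part right_part.

Definition shuffle_symbols S T n m : Prop := exists JL JR (b : bool),
  [/\ is_J JL /\ is_J JR, size JL.2 = h /\ size JR.2 = h',
      (JL.1 + geq_count da (WL S) + geq_count db (ZL T))%N = n /\
      (JR.1 + geq_count da (WR S) + geq_count db (ZR T))%N = m,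
      [/\ perm_eq (unzip1 JL.2) (WL S), perm_eq (unzip2 JL.2) (ZL T),
          perm_eq (unzip1 JR.2) (WR S) & perm_eq (unzip2 JR.2) (ZR T)] &
      shuffle_term S T n m = (-1) ^+ b * Jprod K [:: JL; JR]].

Lemma shuffle_term_inj S T n m : (0 < h)%N -> (0 < h')%N ->
  (geq_count da (WL S) + geq_count db (ZL T) <= n)%N ->
  (geq_count da (WR S) + geq_count db (ZR T) <= m)%N ->
  injective (joint wa wa' \o @selL h h' S) -> injective (joint wb wb' \o @selL h h' T) ->
  injective (joint wa wa' \o @selR h h' S) -> injective (joint wb wb' \o @selR h h' T) ->
  shuffle_symbols S T n m.
Proof.
move=> h0 h0' nL mR i1 i2 i3 i4.
have aux (a b x y : nat) : x = (y - (a + b))%N -> (a + b <= y)%N -> (x + a + b)%N = y by lia.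
have E : shuffle_term S T n m =
    minor (joint wa wa' \o @selL h h' S) (joint wb wb' \o @selL h h' T) gX
      (n - (geq_count da (WL S) + geq_count db (ZL T)))%N *
    minor (joint wa wa' \o @selR h h' S) (joint wb wb' \o @selR h h' T) gX
      (m - (geq_count da (WR S) + geq_count db (ZR T)))%N.
  exact: (congr2 *%R (@det_shifted_coef_le _ gX _ (@selL h h' S) (@selL h h' T) n nL)
    (@det_shifted_coef_le _ gX _ (@selR h h' S) (@selR h h' T) m mR)).
have [JL [b [HL nJL sL pL1 [pL2 eL]]]] :=
  minor_symbol (n - (geq_count da (WL S) + geq_count db (ZL T))) h0 i1 i2.
have [JR [b' [HR nJR sR pR1 [pR2 eR]]]] :=
  minor_symbol (m - (geq_count da (WR S) + geq_count db (ZR T))) h0' i3 i4.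
exists JL, JR, (b (+) b').
split; [exact: conj | exact: conj | | exact: And4 |].
  exact: conj (aux _ _ _ _ nJL nL) (aux _ _ _ _ nJR mR).
have eA : minor (joint wa wa' \o @selL h h' S) (joint wb wb' \o @selL h h' T) gX
      (n - (geq_count da (WL S) + geq_count db (ZL T)))%N = (-1) ^+ b * Jpoly K JL.
  rewrite eL fps_signM /Jpoly nJL; reflexivity.
have eB : minor (joint wa wa' \o @selR h h' S) (joint wb wb' \o @selR h h' T) gX
      (m - (geq_count da (WR S) + geq_count db (ZR T)))%N = (-1) ^+ b' * Jpoly K JR.
  rewrite eR fps_signM /Jpoly nJR; reflexivity.
rewrite E; apply: (etrans (congr2 *%R eA eB)).
rewrite mulrACA -signr_addb Jprod2; reflexivity.
Qed.

Lemma shuffle_termP S T n m : (0 < h)%N -> (0 < h')%N ->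
  shuffle_term S T n m = 0 \/ shuffle_symbols S T n m.
Proof.
move=> h0 h0'.
case: (leqP (geq_count da (WL S) + geq_count db (ZL T)) n) => [nL|lt]; last first.
  by left; rewrite /shuffle_term det_shifted_coef lt mul0r.
case: (leqP (geq_count da (WR S) + geq_count db (ZR T)) m) => [mR|lt]; last first.
  by left; rewrite /shuffle_term [X in _ * X]det_shifted_coef lt mulr0.
have L0 : minor (joint wa wa' \o @selL h h' S) (joint wb wb' \o @selL h h' T) gX = 0 ->
    shuffle_term S T n m = 0.
  by rewrite /shuffle_term det_shifted => ->; rewrite mulr0 mul0r.
have R0 : minor (joint wa wa' \o @selR h h' S) (joint wb wb' \o @selR h h' T) gX = 0 ->
    shuffle_term S T n m = 0.
  by rewrite /shuffle_term [X in _ * fps_coef X _]det_shifted => ->; rewrite mulr0 mulr0.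
case: (pselect (injective (joint wa wa' \o @selL h h' S))) => [i1|ni]; last first.
  by left; apply/L0/minor_row_rep.
case: (pselect (injective (joint wb wb' \o @selL h h' T))) => [i2|ni]; last first.
  by left; apply/L0/minor_col_rep.
case: (pselect (injective (joint wa wa' \o @selR h h' S))) => [i3|ni]; last first.
  by left; apply/R0/minor_row_rep.
case: (pselect (injective (joint wb wb' \o @selR h h' T))) => [i4|ni]; last first.
  by left; apply/R0/minor_col_rep.
by right; apply: shuffle_term_inj.
Qed.

Lemma shuffle_term_homog S T n m D : (0 < h)%N -> (0 < h')%N -> #|S| = h -> #|T| = h ->
  (n + m)%N = (D + (geq_count da wa + geq_count da wa') + (geq_count db wb + geq_count db wb'))%N ->
  homog (h + h') D (shuffle_term S T n m).
Proof.
move=> h0 h0' cS cT E; case: (shuffle_termP S T n m h0 h0') => [->|]; first exact: homog0.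
case=> JL [JR [b [_ [sL sR] [nL nR] _ ->]]]; apply: homog_sign.
have := homog_Jprod K [:: JL; JR]; rewrite /sz_sum /wt_sum !big_cons !big_nil !addn0 sL sR.
have -> : D = (JL.1 + JR.1)%N.
  by have := geq_total wa wa' da cS; have := geq_total wb wb' db cT; move: E; rewrite -nL -nR; lia.
exact.
Qed.

(** The relation of [moment_relation] holds modulo the (h+1)-minors, for the image of the
   generic matrix in the quotient ring. *)
Lemma shuffle_moments (ea eb : pred nat) : exists sg : {set I} -> {set I} -> bool, forall N i,
  (i < (h' - fixed_count ea wa wa') + (h' - fixed_count eb wb wb'))%N ->
  minor_ideal h (\sum_(m < N.+1)
    (\sum_(S | allowed (kept_left wa' ea) (kept_right wa ea) S)
     \sum_(T | allowed (kept_left wb' eb) (kept_right wb eb) T)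
       (-1) ^+ sg S T * shuffle_term S T (N - m) m) *+ 'C(m, i)).
Proof.
pose pi := jet_pi K p q h; pose X := map_mx (fps_map pi) gX.
have X0 (u v : 'I_h.+1 -> I) : \det (mxsub u v (shifted X)) = 0.
  rewrite det_shifted /X map_arc_minor.
  suff -> : fps_map pi (minor (joint wa wa' \o u) (joint wb wb' \o v) gX) = 0 by rewrite mulr0.
  by apply/fpsP=> n /=; rewrite /pi jet_pi_minor.
have [sg Hsg] := moment_relation (kept_or wa wa' ea) (kept_or wb wb' eb) X0.
exists sg => N i ik; apply: jet_pi0.
have := Hsg N i; rewrite !fixed_countE => /(_ ik) <-.
rewrite rmorph_sum; apply: eq_bigr => m _; rewrite rmorphMn /shuffle; congr (_ *+ _).
rewrite rmorph_sum; apply: eq_bigr => S _; rewrite rmorph_sum; apply: eq_bigr => T _.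
rewrite rmorphM rmorph_sign /shuffle_term rmorphM -map_shifted.
by rewrite -!map_mxsub !det_map_mx.
Qed.
End Shuffled.

(** * Straightening a pair of symbols *)

Lemma codom_uniq_inj (m n : nat) (f : 'I_m -> 'I_n) : uniq (codom f) -> injective f.
Proof. by move=> u; apply/injectiveP. Qed.

Lemma is_J_eq p q (J J' : Jsym p q) : is_J J -> is_J J' -> J.1 = J'.1 ->
  perm_eq (unzip1 J.2) (unzip1 J'.2) -> perm_eq (unzip2 J.2) (unzip2 J'.2) -> J = J'.
Proof.
move=> /is_J_sides [_ s1 s2] /is_J_sides [_ s1' s2'] e p1 p2.
have srt n (w w' : seq 'I_n) : sorted (fun i j : 'I_n => (i < j)%N) w ->
    sorted (fun i j : 'I_n => (i < j)%N) w' -> perm_eq w w' -> w = w'.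
  by move=> sw sw' pw; rewrite -(ord_sort_sorted sw (perm_refl w)) -(ord_sort_sorted sw' pw).
case: J J' e p1 p2 s1 s2 s1' s2' => [n s] [n' s'] /= <- p1 p2 s1 s2 s1' s2'.
by rewrite -(zip_unzip s) -(zip_unzip s') (srt _ _ _ s1 s1' p1) (srt _ _ _ s2 s2' p2).
Qed.

Lemma isolate_term (V : zmodType) (P : V -> Prop) (I J : finType) (A : pred I) (B : pred J)
    (F : I -> J -> V) i0 j0 : P 0 -> (forall x y, P x -> P y -> P (x - y)) -> A i0 -> B j0 ->
  P (\sum_(i | A i) \sum_(j | B j) F i j) ->
  (forall i j, A i -> B j -> (i, j) != (i0, j0) -> P (F i j)) -> P (F i0 j0).
Proof.
move=> P0 PB Ai Bj; rewrite (bigD1 i0) //= (bigD1 j0) //= -addrA => H HF.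
have PD x y : P x -> P y -> P (x + y).
  by move=> Px Py; rewrite -[y]opprK -[- y]sub0r; apply: (PB) => //; apply: (PB).
rewrite -[F i0 j0](addrK (\sum_(j | B j && (j != j0)) F i0 j +
  \sum_(i | A i && (i != i0)) \sum_(j | B j) F i j)).
apply: (PB) => //; apply: (PD); first apply: (big_ind P) => // j /andP [Bj' ne].
  by apply: HF => //; apply: contraNneq ne => -[->].
apply: (big_ind P) => // i /andP [Ai' ne]; apply: (big_ind P) => // j Bj'.
by apply: HF => //; apply: contraNneq ne => -[->].
Qed.

Section Pair.
Variables (K : fieldType) (p q : nat).
Implicit Types (E F : Esym p q) (J : Jsym p q).

(** When J2 is larger than J1 it precedes by size. Otherwise the thresholds of
   [exchange_data] give a relation between the sums a_m. A term with first factor in degree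
   n < nh has a first symbol of smaller weight than J1, as by [allowed_left] it has at least
   as many rows and columns beyond the thresholds; a term with second factor in degree m <
   fl has a second symbol without refinement above E0. The other a_m form a window of length
   k, which contains the one with J1 J2. In the latter the remaining terms have a first
   symbol that precedes J1 by domination. *)
Lemma straighten_pair E0 E1 J1 J2 : is_J J1 -> is_J J2 -> largest (fits E0 J1) E1 ->
    ~ (exists F, fits E1 J2 F) ->
  spanned (graded (size J1.2 + size J2.2) (J1.1 + J2.1) (below E0 E1)) (Jprod K [:: J1; J2]).
Proof.
move=> HJ1 HJ2 Hmax nf; set P := spanned _.
have szs JL JR : sz_sum [:: JL; JR] = (size JL.2 + size JR.2)%N.
  by rewrite /sz_sum !big_cons big_nil addn0.
have wts JL JR : wt_sum [:: JL; JR] = (JL.1 + JR.1)%N.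
  by rewrite /wt_sum !big_cons big_nil addn0.
have pairP JL JR : is_J JL -> is_J JR -> (size JL.2 + size JR.2 = size J1.2 + size J2.2)%N ->
    (JL.1 + JR.1 = J1.1 + J2.1)%N -> below E0 E1 JL \/ below E0 E1 JR -> P (Jprod K [:: JL; JR]).
  move=> HL HR eS eW HB; apply: spanned_gen; split; rewrite ?szs ?wts //.
    by move=> J; rewrite !inE => /orP [/eqP -> | /eqP ->].
  by case: HB => HB; [exists JL | exists JR]; rewrite ?inE ?eqxx ?orbT.
case: (ltnP (size J1.2) (size J2.2)) => [lt|le].
  by apply: pairP => //; right; apply: (below_size HJ1 Hmax).
have [h0 so1 so2] := is_J_sides HJ1; have [h0' so1' so2'] := is_J_sides HJ2.
have [ea [da [eb [db [fl [ka kb ineq floor]]]]]] := exchange_data HJ1 HJ2 Hmax le nf.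
pose wa : (size J1.2).-tuple 'I_p := map_tuple fst (in_tuple J1.2).
pose wb : (size J1.2).-tuple 'I_q := map_tuple snd (in_tuple J1.2).
pose wa' : (size J2.2).-tuple 'I_p := map_tuple fst (in_tuple J2.2).
pose wb' : (size J2.2).-tuple 'I_q := map_tuple snd (in_tuple J2.2).
have ewa : tval wa = unzip1 J1.2 by [].
have ewb : tval wb = unzip2 J1.2 by [].
have ewa' : tval wa' = unzip1 J2.2 by [].
have ewb' : tval wb' = unzip2 J2.2 by [].
pose G := (geq_count da wa + geq_count da wa' + (geq_count db wb + geq_count db wb'))%N.
pose nh := (J1.1 + geq_count da wa + geq_count db wb)%N.
pose mh := (J2.1 + geq_count da wa' + geq_count db wb')%N.
pose k := ((size J2.2 - fixed_count ea wa wa') + (size J2.2 - fixed_count eb wb wb'))%N.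
have mhk : (mh < fl + k)%N by move: ineq; rewrite /mh /k ewa ewb ewa' ewb' addnA.
pose term := shuffle_term wa wa' wb wb' da db K.
pose okA := allowed (kept_left wa' ea) (kept_right wa ea).
pose okB := allowed (kept_left wb' eb) (kept_right wb eb).
(* All the terms that involve an earlier symbol, by weight, by cost, or by domination. *)
have termP S T n m : okA S -> okB T -> (n + m = J1.1 + J2.1 + G)%N ->
    (n < nh)%N || (m < fl)%N ||
    [&& n == nh & (S, T) != (unmoved _ _, unmoved _ _)] -> P (term S T n m).
  move=> oS oT nm cond.
  have cS : #|S| = size J1.2 by case/andP: oS => /eqP.
  have cT : #|T| = size J1.2 by case/andP: oT => /eqP.
  case: (shuffle_termP wa wa' wb wb' da db K S T n m h0 h0') => [e|].
    by rewrite /term e; apply: spanned0.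
  case=> JL [JR [b [[HL HR] [sL sR] [nL nR] [p1 p2 p3 p4] e]]].
  rewrite /term e; clear e; apply: spanned_sign.
  have tA := geq_total wa wa' da cS; have tB := geq_total wb wb' db cT.
  have wsum : (JL.1 + JR.1 = J1.1 + J2.1)%N.
    by move: nm tA tB; rewrite -nL -nR /G; clear; lia.
  apply: (pairP _ _ HL HR _ wsum); first by rewrite sL sR.
  have [gA HA] := allowed_left ka oS; have [gB HB] := allowed_left kb oT.
  case: (ltnP JL.1 J1.1) => [lt|geL]; first by left; apply: (below_wt HJ1 Hmax).
  have nge : (n < nh)%N = false.
    by apply/negbTE; rewrite -leqNgt -nL /nh; move: gA gB geL; clear; lia.
  move: cond; rewrite nge /= => /orP [mf|/andP [/eqP en neST]].
    by right; apply: floor => //; rewrite (geq_count_perm da p3) (geq_count_perm db p4) nR.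
  left.
  have eA : geq_count da (left_part wa wa' S) = geq_count da wa by move: en gA gB geL; rewrite -nL /nh; clear; lia.
  have eB : geq_count db (left_part wb wb' T) = geq_count db wb by move: en gA gB geL; rewrite -nL /nh; clear; lia.
  have e1 : JL.1 = J1.1 by move: en gA gB geL; rewrite -nL /nh; clear; lia.
  have [domA unA] := HA eA; have [domB unB] := HB eB.
  apply: (below_dominated HJ1 Hmax HL sL e1).
  - move=> eJ; case/negP: neST; apply/eqP; congr pair.
      by apply: unA => x; rewrite -(geq_count_perm x p1) eJ.
    by apply: unB => x; rewrite -(geq_count_perm x p2) eJ.
  - by move=> x; rewrite (geq_count_perm x p1) -ewa; apply: domA.
  - by move=> x; rewrite (geq_count_perm x p2) -ewb; apply: domB.
have [sg moments] := shuffle_moments wa wa' wb wb' da db K ea eb.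
pose N := (J1.1 + J2.1 + G)%N.
pose a m : jetpoly K p q := \sum_(S | okA S) \sum_(T | okB T) (-1) ^+ sg S T * term S T (N - m)%N m.
have aP m : (m <= N)%N -> P (a m).
  apply: (@moment_window _ P _ _ N k fl) => [||i ik|m' mN Hm].
  - exact: spanned0.
  - by move=> x y Px Py; apply: spannedD => //; apply: spannedN.
  - have := moments N i ik => /homog_minor_ideal HI.
    have : spanned (graded (size J1.2 + size J2.2) (J1.1 + J2.1)
        (fun J => size J.2 = (size J1.2).+1)) (\sum_(m < N.+1) a m *+ 'C(m, i)).
      apply: HI; apply: homog_sum => m' _; apply: homogMn.
      apply: homog_sum => S oS; apply: homog_sum => T oT; apply: homog_sign.
      apply: shuffle_term_homog => //; [by case/andP: oS => /eqP | by case/andP: oT => /eqP |].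
      rewrite subnK; last by rewrite -ltnS ltn_ord.
      exact: addnA.
    apply: spanned_mono => Js [H1 H2 H3 [J JJs sJ]]; split=> //; exists J => //.
    by apply: (below_size HJ1 Hmax); [exact: H1 | rewrite sJ].
  - apply: spanned_sum => S oS; apply: spanned_sum => T oT; apply: spanned_sign.
    apply: termP => //; first by rewrite subnK.
    case/orP: Hm => [->|Hm]; first by rewrite orbT.
    apply/orP; left; apply/orP; left; rewrite /nh.
    by move: mhk; rewrite /mh /N /G; lia.
have mhN : (mh <= N)%N by rewrite /mh /N /G; lia.
have NmE : (N - mh)%N = nh by rewrite /mh /N /G /nh; lia.
have oU : okA (unmoved _ _) by apply: allowed_unmoved.
have oV : okB (unmoved _ _) by apply: allowed_unmoved.
(* In the sum that contains J1 J2, every other term already has an earlier symbol. *)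
have main : P (term (unmoved _ _) (unmoved _ _) nh mh).
  have PB (x y : jetpoly K p q) : P x -> P y -> P (x - y).
    by move=> Px Py; apply: spannedD => //; apply: spannedN.
  have H0 := aP mh mhN.
  have : P ((-1) ^+ sg (unmoved _ _) (unmoved _ _) * term (unmoved _ _) (unmoved _ _) nh mh).
    apply: (@isolate_term _ P _ _ okA okB (fun S T => (-1) ^+ sg S T * term S T nh mh)
      _ _ (spanned0 _ _) PB oU oV).
      by move: H0; rewrite /a NmE.
    move=> S T oS oT ne; apply: spanned_sign; apply: termP => //.
      by rewrite -NmE subnK.
    by rewrite eqxx ne orbT.
  move/(spanned_sign (sg (unmoved _ _) (unmoved _ _))).
  by rewrite signrMK.
have pA := left_part_unmoved wa wa'; have pB := left_part_unmoved wb wb'.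
have pA' := right_part_unmoved wa wa'; have pB' := right_part_unmoved wb wb'.
have [||||||JL [JR [b [[HL HR] [sL sR] [nL nR] [p1 p2 p3 p4] e]]]] :=
  @shuffle_term_inj _ _ _ _ wa wa' wb wb' da db K (unmoved _ _) (unmoved _ _) nh mh h0 h0'.
- by rewrite (geq_count_perm da pA) (geq_count_perm db pB) /nh; clear; lia.
- by rewrite (geq_count_perm da pA') (geq_count_perm db pB') /mh; clear; lia.
- by apply: codom_uniq_inj; rewrite (perm_uniq pA) ewa sorted_ltn_uniq.
- by apply: codom_uniq_inj; rewrite (perm_uniq pB) ewb sorted_ltn_uniq.
- by apply: codom_uniq_inj; rewrite (perm_uniq pA') ewa' sorted_ltn_uniq.
- by apply: codom_uniq_inj; rewrite (perm_uniq pB') ewb' sorted_ltn_uniq.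
(* The unmoved distribution gives J1 J2 up to sign. *)
have eL : JL = J1.
  apply: (is_J_eq HL HJ1); [|exact: perm_trans p1 pA | exact: perm_trans p2 pB].
  by move: nL; rewrite (geq_count_perm da pA) (geq_count_perm db pB) /nh; clear; lia.
have eR : JR = J2.
  apply: (is_J_eq HR HJ2); [|exact: perm_trans p3 pA' | exact: perm_trans p4 pB'].
  by move: nR; rewrite (geq_count_perm da pA') (geq_count_perm db pB') /mh; clear; lia.
move: main; rewrite /term e eL eR => /(spanned_sign b); rewrite signrMK.
exact.
Qed.
End Pair.

(** * Straightening a product *)

Section FiniteOrder.
Variables p q : nat.
Implicit Types (E F : Esym p q) (J : Jsym p q).

Definition small_letter (N : nat) : finType := (('I_p * 'I_N.+1) * ('I_q * 'I_N.+1))%type.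
Definition of_small N (x : small_letter N) : ('I_p * nat) * ('I_q * nat) :=
  ((x.1.1, x.1.2 : nat), (x.2.1, x.2.2 : nat)).
Definition to_small N (e : ('I_p * nat) * ('I_q * nat)) : small_letter N :=
  ((e.1.1, inord e.1.2), (e.2.1, inord e.2.2)).
Definition small_E (D N : nat) : seq (Esym p q) :=
  [seq map (@of_small N) (val s) | s : D.-bseq (small_letter N)].

Lemma small_E_mem D N E : (size E <= D)%N -> (wtE E <= N)%N -> E \in small_E D N.
Proof.
move=> sE wE; have sz : (size (map (@to_small N) E) <= D)%N by rewrite size_map.
apply/mapP; exists (Bseq sz); first by rewrite mem_enum.
rewrite /= -map_comp -[LHS]map_id; apply/eq_in_map => -[[u k] [v l]] eE /=.
have lt : (k + l <= N)%N.
  by apply: leq_trans wE; rewrite /wtE (big_rem _ eE) /= leq_addr.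
by rewrite /of_small /= !inordK ?ltnS //; lia.
Qed.

(** As the order on refinements of bounded size and weight is finite, this number serves as
   a measure for well-founded induction. *)
Definition rank D N E : nat := count (fun F => precE F E) (small_E D N).

Lemma rank_lt D N E F : E \in small_E D N -> precE E F -> (rank D N E < rank D N F)%N.
Proof.
move=> EL EF; rewrite /rank.
have sub G : precE G E -> precE G F by move=> H; apply: precE_trans EF.
elim: (small_E D N) EL => //= G L IH; rewrite inE => /orP [/eqP <-|/IH lt].
  rewrite precE_irr EF add0n add1n ltnS; apply: sub_count => G' /=; exact: sub.
by case: (boolP (precE G E)) => [/sub ->|_] //; rewrite add0n; apply: leq_trans lt _; rewrite leq_addl.
Qed.

Lemma largest_exists E0 J F : is_J J -> fits E0 J F -> exists E, largest (fits E0 J) E.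
Proof.
move=> HJ fF; pose L := [seq G <- small_E (size J.2) J.1 | `[< fits E0 J G >]].
have mem G : fits E0 J G -> G \in L.
  move=> fG; rewrite mem_filter; apply/andP; split; first exact/asboolP.
  by case: fG => cG _; apply: small_E_mem; rewrite ?(in_calE_size HJ cG) ?(in_calE_wt cG).
have L0 : L != [::] by apply/eqP => L0; have := mem F fF; rewrite L0.
have [E] := seq_max_key (rank (size J.2) J.1) L0.
rewrite mem_filter => /andP [/asboolP fE _] Emax; exists E; split=> // G fG.
case: (precE_total G E) => [->|[lt|lt]]; [by left | by right |].
have := Emax G (mem G fG); rewrite leqNgt rank_lt //.
by case: fE => cE _; apply: small_E_mem; rewrite ?(in_calE_size HJ cE) ?(in_calE_wt cE).
Qed.
End FiniteOrder.

Section Straightening.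
Variables (K : fieldType) (p q : nat).
Implicit Types (E F : Esym p q) (J : Jsym p q) (Js : seq (Jsym p q)).

Fixpoint std_from E0 Js : Prop :=
  if Js is J :: Js' then is_J J /\ exists2 E, largest (fits E0 J) E & std_from E Js' else True.

Definition stuck E0 J : Prop := ~ exists F, fits E0 J F.

(** The alternative for a product that is not standard from E0: a factor that no element
   above E0 refines. *)
Definition straight E0 D N Js : Prop := [/\ forall J, J \in Js -> is_J J,
  sz_sum Js = D, wt_sum Js = N & std_from E0 Js \/ exists2 J, J \in Js & stuck E0 J].

Lemma sz_sum_perm Js Ls : perm_eq Js Ls -> sz_sum Js = sz_sum Ls.
Proof. exact: perm_big. Qed.
Lemma wt_sum_perm Js Ls : perm_eq Js Ls -> wt_sum Js = wt_sum Ls.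
Proof. exact: perm_big. Qed.

(** The cofactor of J1 has smaller size, so it straightens from E1. If it becomes standard,
   J1 in front completes a product standard from E0. Otherwise it contains a symbol with no
   refinement above E1, and [straighten_pair] replaces its product with J1 by products that
   contain a symbol whose greedy refinement precedes E1, to which induction applies. *)
Lemma straighten_below D N E0 :
  (forall D' N' E0' Ls, (D' < D)%N -> (forall J, J \in Ls -> is_J J) ->
    sz_sum Ls = D' -> wt_sum Ls = N' -> spanned (straight E0' D' N') (Jprod K Ls)) ->
  forall m E1 Js J1, (rank D N E1 < m)%N -> (forall J, J \in Js -> is_J J) ->
    sz_sum Js = D -> wt_sum Js = N -> J1 \in Js -> largest (fits E0 J1) E1 ->
    spanned (straight E0 D N) (Jprod K Js).
Proof.
move=> IHD; elim=> // m IHm E1 Js J1 rk HJs eD eN J1Js Hmax.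
have HJ1 := HJs _ J1Js; have [J10 _ _] := is_J_sides HJ1.
have pJs := perm_to_rem J1Js; set rest := rem J1 Js in pJs.
have Hrest J : J \in rest -> is_J J by move=> /mem_rem /HJs.
have eD' : D = (size J1.2 + sz_sum rest)%N by rewrite -eD (sz_sum_perm pJs) /sz_sum big_cons.
have eN' : N = (J1.1 + wt_sum rest)%N by rewrite -eN (wt_sum_perm pJs) /wt_sum big_cons.
have ltD : (sz_sum rest < D)%N by rewrite eD' -add1n leq_add2r.
have HR := IHD _ _ E1 rest ltD Hrest erefl erefl.
have -> : Jprod K Js = Jprod K rest * Jprod K [:: J1].
  by rewrite -Jprod_cat; apply: Jprod_perm; rewrite (permPl pJs) perm_sym perm_catC.
apply: spanned_bind (spanned_mulr (Q' := fun Ls => exists2 Js', straight E1 (sz_sum rest) (wt_sum rest) Js' &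
    Ls = Js' ++ [:: J1]) _ HR); last by move=> Js' H; exists Js'.
move=> _ [Js' [HJs' sJs' wJs' Hor] ->].
have pc : perm_eq (Js' ++ [:: J1]) (J1 :: Js') by rewrite perm_catC.
(* Either E1 starts a standard product, or J1 and the stuck J2 are straightened together. *)
case: Hor => [std|[J2 J2Js stk]].
  rewrite (Jprod_perm K pc); apply: spanned_gen; split.
  - by move=> J; rewrite inE => /orP [/eqP -> //|/HJs'].
  - by rewrite /sz_sum big_cons -/(sz_sum Js') sJs' eD'.
  - by rewrite /wt_sum big_cons -/(wt_sum Js') wJs' eN'.
  - by left; split=> //; exists E1.
have pJ2 := perm_to_rem J2Js; set rest' := rem J2 Js' in pJ2.
have sJ2 : sz_sum Js' = (size J2.2 + sz_sum rest')%N by rewrite (sz_sum_perm pJ2) /sz_sum big_cons.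
have wJ2 : wt_sum Js' = (J2.1 + wt_sum rest')%N by rewrite (wt_sum_perm pJ2) /wt_sum big_cons.
have -> : Jprod K (Js' ++ [:: J1]) = Jprod K [:: J1; J2] * Jprod K rest'.
  by rewrite -Jprod_cat; apply: Jprod_perm; rewrite (permPl pc) perm_cons.
have HJ2 := HJs' _ J2Js.
apply: spanned_bind (spanned_mulr (Q' := fun Ls => exists2 Ks,
    graded (size J1.2 + size J2.2) (J1.1 + J2.1) (below E0 E1) Ks & Ls = Ks ++ rest') _
  (straighten_pair K HJ1 HJ2 Hmax stk)); last by move=> Ks H; exists Ks.
move=> _ [Ks [HKs sKs wKs [J JKs [HJ Jbelow]]] ->].
have HL J' : J' \in Ks ++ rest' -> is_J J'.
  by rewrite mem_cat => /orP [/HKs //|/mem_rem /HJs'].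
have sL : sz_sum (Ks ++ rest') = D by rewrite sz_sum_cat sKs eD' -sJs' sJ2 addnA.
have wL : wt_sum (Ks ++ rest') = N by rewrite wt_sum_cat wKs eN' -wJs' wJ2 addnA.
have JL : J \in Ks ++ rest' by rewrite mem_cat JKs.
case: (pselect (exists F, fits E0 J F)) => [[F fF]|nf]; last first.
  by apply: spanned_gen; split=> //; right; exists J.
have [E Emax] := largest_exists HJ fF.
apply: (IHm E _ J) => //; apply: leq_trans (_ : rank D N E1 <= m)%N; last by rewrite -ltnS.
case: Emax => fE _; apply: rank_lt; last exact: Jbelow.
case: fE => cE _; apply: small_E_mem.
  by rewrite (in_calE_size HJ cE) -sL /sz_sum (big_rem _ JL) leq_addr.
by rewrite (in_calE_wt cE) -wL /wt_sum (big_rem _ JL) leq_addr.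
Qed.

Lemma straighten D N E0 Js : (forall J, J \in Js -> is_J J) -> sz_sum Js = D -> wt_sum Js = N ->
  spanned (straight E0 D N) (Jprod K Js).
Proof.
have [m] := ubnP D; elim: m D N E0 Js => // m IH D N E0 Js ltD HJs eD eN.
case: Js HJs eD eN => [|J1 Js] HJs eD eN.
  by apply: spanned_gen; split=> //; left.
have J1in : J1 \in J1 :: Js by rewrite mem_head.
have HJ1 := HJs _ J1in.
case: (pselect (exists F, fits E0 J1 F)) => [[F fF]|nf]; last first.
  by apply: spanned_gen; split=> //; right; exists J1.
have [E1 Hmax] := largest_exists HJ1 fF.
apply: (@straighten_below D N E0 _ (rank D N E1).+1 E1 _ J1) => //.
by move=> D' N' E0' Ls lt HLs eD' eN'; apply: IH => //; apply: leq_trans lt _; rewrite -ltnS.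
Qed.

Lemma all_straight E0 (f : jetpoly K p q) :
  spanned (fun Js => (forall J, J \in Js -> is_J J) /\
    (std_from E0 Js \/ exists2 J, J \in Js & stuck E0 J)) f.
Proof.
apply: spanned_bind (all_spanned f) => Js HJs.
by apply: spanned_mono (straighten E0 HJs erefl erefl) => Ls [].
Qed.
End Straightening.

(** * Chains of refinements and their monomials *)

Section MonomialsOfLists.
Variable V : choiceType.
Implicit Types (s t : seq V) (w : V).

Definition mon s : {cmonom V} := foldr (fun w m => mmul (ucm w) m) mone s.

Lemma monE s w : mon s w = count_mem w s.
Proof. by elim: s => [|v s IH] /=; rewrite ?cm1 // cmM cmU IH. Qed.

Lemma mon_cat s t : mon (s ++ t) = mmul (mon s) (mon t).
Proof. by elim: s => [|v s IH] /=; rewrite ?mul1m // IH mulmA. Qed.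

Lemma mon_eq s t : mon s = mon t <-> perm_eq s t.
Proof.
split=> [e|/seq.permP st]; last by apply/eqP/cmP => w; rewrite !monE.
by apply/allP => w _; rewrite /= -!monE e.
Qed.

Lemma mon_flatten (T : Type) (r : seq T) (f : T -> seq V) (R : comNzRingType) :
  << mon (flatten (map f r)) >> = \prod_(i <- r) << mon (f i) >> :> {malg R[{cmonom V}]}.
Proof.
elim: r => [|i r IH]; first by rewrite big_nil; exact: mpolyC1E.
by rewrite big_cons -IH /= mon_cat; exact: malgUM.
Qed.
End MonomialsOfLists.

Section Chains.
Variables p q : nat.
Implicit Types (E F : Esym p q) (J : Jsym p q) (Es Fs : seq (Esym p q)).

(** The variables a_uj^(k) and b_jv^(l), as ((u, k), j) and ((v, l), j). The columns j are
   natural numbers, so that the ring does not depend on their number r. *)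
Definition fvar : choiceType := (('I_p * nat) * nat + ('I_q * nat) * nat)%type.
Implicit Types (w : fvar) (s : seq fvar).

Fixpoint tvars_from (j : nat) E : seq fvar :=
  if E is e :: E' then inl (e.1, j) :: inr (e.2, j) :: tvars_from j.+1 E' else [::].
Definition tvars E := tvars_from 0 E.
Definition tvars_all Es := flatten (map tvars Es).

(** Extends the order from refinements to single variables: in column j, the j-th letters of
   E are compared with the variable. *)
Definition dom E w : bool :=
  match w with
  | inl (a, j) => if onth E j is Some e then leK e.1 a else false
  | inr (b, j) => if onth E j is Some e then leK e.2 b else false
  end.

Definition col w : nat := match w with inl x => x.2 | inr x => x.2 end.

Lemma dom_col E w : dom E w -> (col w < size E)%N.
Proof.
case: w => [[a j]|[b j]] /=; case e: (onth E j) => [x|] // _.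
  by rewrite -onthTE e.
by rewrite -onthTE e.
Qed.

Lemma leE_refl E : leE E E.
Proof.
by rewrite /leE leqnn take_size /=; elim: E => //= e E ->; rewrite !lexx.
Qed.

Lemma dom_tvars E F : all (dom E) (tvars F) = leE E F.
Proof.
suff H j : all (dom E) (tvars_from j F) = leE (drop j E) F by rewrite /tvars H drop0.
elim: F j => [|f F IH] j /=; first by rewrite /leE /= take0.
rewrite IH andbA; case e: (onth E j) => [x|]; last first.
  have le : (size E <= j)%N by rewrite -onthNE e.
  by rewrite (drop_oversize le).
have lt : (j < size E)%N by rewrite -onthTE e.
have -> : drop j E = x :: drop j.+1 E.
  by rewrite (drop_nth x) //; congr (_ :: _); rewrite -odflt_onth e.
by rewrite /leE /= ltnS; case: leqP; rewrite ?andbF.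
Qed.

Fixpoint chain E0 Es : bool := if Es is E :: Es' then leE E0 E && chain E Es' else true.

Lemma chain_le E0 Es E : chain E0 Es -> E \in Es -> leE E0 E.
Proof.
elim: Es E0 => // F Es IH E0 /= /andP [le /IH H].
by rewrite inE => /orP [/eqP ->|/H le'] //; apply: leE_trans le'.
Qed.

Lemma chain_dom E Es : chain E Es -> all (dom E) (tvars_all Es).
Proof.
move=> ch; apply/allP => w /flatten_mapP [F FEs wF].
by have := chain_le ch FEs; rewrite -dom_tvars => /allP ->.
Qed.

(** A monomial in the expansion of J uses as many columns as J has rows; if these are the
   first ones, it comes from a refinement of J. *)
Definition jterm J s : Prop :=
  (exists2 w, w \in s & (size J.2 <= col w)%N) \/ exists2 F, in_calE J F & perm_eq s (tvars F).

(** All variables of the chain dominate E1', hence so do those of s, which divides its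
   monomial. So either s has a column beyond the size of J and E1' is larger than J, or s
   comes from a refinement F of J with E1' <= F; then E0 <= F, and F precedes or equals the
   greedy E1. *)
Lemma leading_term E0 J E1 E1' Es' s s' : is_J J -> largest (fits E0 J) E1 ->
  chain E0 (E1' :: Es') -> is_E E1' -> jterm J s -> perm_eq (tvars_all (E1' :: Es')) (s ++ s') ->
  precE E1' E1 \/ E1' = E1 /\ perm_eq s (tvars E1).
Proof.
move=> HJ [[cE1 _] Hmax] /= /andP [le0 ch] _ Hs pe.
have sE1 := in_calE_size HJ cE1.
have ds : all (dom E1') s.
  have : all (dom E1') (s ++ s').
    by rewrite -(perm_all _ pe) all_cat dom_tvars leE_refl chain_dom.
  by rewrite all_cat => /andP [].
case: Hs => [[w ws le]|[F cF pF]].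
  left; rewrite /precE sE1 (leq_ltn_trans le) //; apply: dom_col.
  exact: (allP ds).
have leF : leE E1' F by rewrite -dom_tvars -(perm_all _ pF).
have sF := in_calE_size HJ cF.
have := leE_size leF; rewrite leq_eqVlt => /orP [/eqP sz|lt]; last first.
  by left; rewrite /precE sE1 -sF lt.
have FE1 : F = E1 \/ precE F E1.
  by apply: Hmax; split=> //; apply: leE_trans leF.
case: (leE_prec leF (esym sz)) => [e|lt].
  by rewrite e; case: FE1 => [e1|]; [right; rewrite -e1 | left].
by left; case: FE1 => [<- //|]; apply: precE_trans lt.
Qed.
End Chains.

(** * Supports of polynomials *)

Definition malgpoly (K : fieldType) (V : choiceType) : comNzRingType := {malg K[{cmonom V}]}.

Section Supports.
Variables (K : fieldType) (V : choiceType).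
Local Notation M := (malgpoly K V).
Implicit Types (f g : M) (Q : seq V -> Prop) (s t : seq V).

Lemma mon_surj (m : {cmonom V}) : exists s, m = mon s.
Proof.
elim/cmonom_ind: m => [|w m [s ->]]; first by exists [::].
by exists (w :: s).
Qed.

(** Monomials are lists of variables up to permutation; Q need hold for one of these lists
   only. *)
Definition termed Q f : Prop := forall s, f@_(mon s) != 0 -> exists2 t, perm_eq s t & Q t.

Lemma termed0 Q : termed Q 0.
Proof. by move=> s; rewrite mcoeff0 eqxx. Qed.

Lemma termedD Q f g : termed Q f -> termed Q g -> termed Q (f + g).
Proof.
move=> Hf Hg s; rewrite mcoeffD; case: (eqVneq f@_(mon s) 0) => [->|/Hf //].
by rewrite add0r => /Hg.
Qed.

Lemma termed_sum Q (I : Type) (r : seq I) (P : pred I) (F : I -> M) :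
  (forall i, P i -> termed Q (F i)) -> termed Q (\sum_(i <- r | P i) F i).
Proof. by move=> H; apply: (big_ind (termed Q)) => //; [exact: termed0 | exact: termedD]. Qed.

Lemma termed_sign Q (b : bool) f : termed Q f -> termed Q ((-1) ^+ b * f).
Proof.
move=> Hf s; case: b; last by rewrite expr0 mul1r; apply: Hf.
by rewrite expr1 mulN1r mcoeffN oppr_eq0; apply: Hf.
Qed.

Lemma termedU Q s : Q s -> termed Q << mon s >>.
Proof.
move=> Qs t; rewrite mcoeffU1; case: (eqVneq (mon s) (mon t)) => [/mon_eq st _|]; last by rewrite eqxx.
by exists s => //; rewrite perm_sym.
Qed.

Lemma mcoeffM_supp f g s : (f * g)@_(mon s) != 0 ->
  exists s1 s2, [/\ f@_(mon s1) != 0, g@_(mon s2) != 0 & perm_eq s (s1 ++ s2)].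
Proof.
rewrite mcoeff_neq0 => /msuppM_le [m1 [m2 [H1 H2 e]]].
have [s1 e1] := mon_surj m1; have [s2 e2] := mon_surj m2.
exists s1, s2; rewrite !mcoeff_neq0 -e1 -e2; split=> //.
by apply/mon_eq; rewrite mon_cat -e1 -e2.
Qed.

Lemma termedM Q1 Q2 Q f g : (forall s t, Q1 s -> Q2 t -> Q (s ++ t)) ->
  termed Q1 f -> termed Q2 g -> termed Q (f * g).
Proof.
move=> H Hf Hg s /mcoeffM_supp [s1 [s2 [/Hf [t1 p1 q1] /Hg [t2 p2 q2] pe]]].
exists (t1 ++ t2); last exact: H.
by rewrite (permPl pe); apply: perm_cat.
Qed.

(** If in f only the monomial of s1 can contribute to that of s1 ++ s2, the remaining terms
   of f may be dropped. *)
Lemma mcoeffM_unique f g s1 s2 :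
  (forall t1 t2, f@_(mon t1) != 0 -> perm_eq (s1 ++ s2) (t1 ++ t2) -> perm_eq t1 s1) ->
  (f * g)@_(mon (s1 ++ s2)) = f@_(mon s1) * g@_(mon s2).
Proof.
move=> H; set c := f@_(mon s1).
have -> : f = << c *g mon s1 >> + (f - << c *g mon s1 >>) by rewrite addrC subrK.
rewrite mulrDl mcoeffD [X in _ + X](_ : _ = 0) ?addr0.
  rewrite -malgCU -mulrA mcoeffCM; congr (_ * _).
  rewrite malgM_def fgmulUg raddf_sum /= [in RHS](monalgE g) raddf_sum /=.
  apply: eq_bigr => m _; rewrite mul1r !mcoeffU mon_cat; congr (_ *+ nat_of_bool _).
  apply/eqP/eqP => e; last by rewrite e.
  by apply/eqP/cmP => w; have := congr1 (fun x : {cmonom V} => x w) e; rewrite !cmM => /addnI.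
apply/eqP; apply: contraT => /mcoeffM_supp [t1 [t2 [n1 n2 pe]]].
move: n1; rewrite mcoeffB mcoeffU; case: (eqVneq (mon s1) (mon t1)) => [<-|ne].
  by rewrite subrr eqxx.
rewrite subr0 => n1; have /mon_eq e := H _ _ n1 pe.
by rewrite e eqxx in ne.
Qed.

(** Setting the variables outside S to zero does not change the coefficients of the
   monomials in the variables of S. *)
Definition kill (S : seq V) : {rmorphism M -> M} :=
  eval (fun w => if w \in S then << ucm w >> else 0 : M) (@malgC {cmonom V} K).

Lemma kill_mon S s : kill S << mon s >> = if all (mem S) s then << mon s >> else 0.
Proof.
elim: s => [|w s IH] /=; first exact: rmorph1.
have -> : << mmul (ucm w) (mon s) >> = << ucm w >> * << mon s >> :> M by exact: malgUM.
rewrite (rmorphM (kill S)).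
rewrite [X in _ * X]IH.
have -> : kill S << ucm w >> = if w \in S then << ucm w >> else 0 by exact: eval_var.
case: (w \in S) => /=; last exact: mul0r.
by case: (all _ _); rewrite ?mulr0.
Qed.

Lemma mcoeff_kill S f s : all (mem S) s -> (kill S f)@_(mon s) = f@_(mon s).
Proof.
move=> sS; elim/malg_ind: f => [|f g IHf IHg|c m].
- by rewrite rmorph0.
- rewrite (rmorphD (kill S)).
  have D (a b : M) : (a + b)@_(mon s) = a@_(mon s) + b@_(mon s) by exact: mcoeffD.
  rewrite D [RHS]D.
  congr (_ + _); [exact: IHf | exact: IHg].
have [t ->] := mon_surj m; rewrite (rmorphM (kill S)) [X in _ * X]kill_mon.
have -> : kill S c%:MP = c%:MP by exact: eval_const.
have D (a : M) : (c%:MP * a)@_(mon s) = c * a@_(mon s) by exact: mcoeffCM.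
rewrite [LHS]D; apply: (etrans _ (esym (D _))); congr (_ * _); case: ifP => // nt.
rewrite mcoeff0 mcoeffU1; case: (eqVneq (mon t) (mon s)) => // /mon_eq e.
by move: nt; rewrite (perm_all _ e) sS.
Qed.
End Supports.

(** * The factorization X = A B *)

(** The functions f that are not injective give a determinant with two equal rows. *)
Lemma det_mul_expand (R : comNzRingType) (h r : nat) (A : 'M[R]_(h, r)) (B : 'M[R]_(r, h)) :
  \det (A *m B) = \sum_(f : {ffun 'I_h -> 'I_r} | injectiveb f)
    \sum_(s : 'S_h) (-1) ^+ s * \prod_i (A i (f i) * B (f i) (s i)).
Proof.
transitivity (\sum_(f : {ffun 'I_h -> 'I_r})
    \sum_(s : 'S_h) (-1) ^+ s * \prod_i (A i (f i) * B (f i) (s i))).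
  rewrite exchange_big /=; apply: eq_bigr => s _; rewrite -big_distrr /=; congr (_ * _).
  rewrite -(bigA_distr_bigA (fun i j => A i j * B j (s i))).
  by apply: eq_bigr => i _; rewrite !mxE.
rewrite (bigID (fun f : {ffun 'I_h -> 'I_r} => injectiveb f)) /= [X in _ + X]big1 ?addr0 // => f nf.
transitivity (\prod_i A i (f i) * \det (\matrix_(i, j) B (f i) j)).
  rewrite big_distrr; apply: eq_bigr => s _; rewrite big_split mulrCA; do 2!congr (_ * _).
  by apply: eq_bigr => i _; rewrite mxE.
have [i [j [ne e]]] : exists i j, i != j /\ f i = f j.
  case/injectivePn: nf => i [j ij e]; by exists i, j.
by rewrite (determinant_alternate ne) ?mulr0 // => k; rewrite !mxE e.
Qed.

Section Factorization.
Variables (K : fieldType) (p q r : nat).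
Local Notation W := (fvar p q).
Local Notation M := (malgpoly K W).
Implicit Types (E F : Esym p q) (J : Jsym p q) (w : W) (s : seq W).

Definition facA : 'M[fps M]_(p, r) :=
  \matrix_(i, j) Fps (fun k => << ucm (inl ((i, k), j : nat) : W) >>).
Definition facB : 'M[fps M]_(r, q) :=
  \matrix_(j, i) Fps (fun k => << ucm (inr ((i, k), j : nat) : W) >>).
Definition facX : 'M[fps M]_(p, q) := facA *m facB.

Definition tcols E (c : seq nat) : seq W :=
  flatten [seq [:: inl (x.1.1, x.2); inr (x.1.2, x.2)] | x <- zip E c].

Lemma tvars_tcols E : tvars E = tcols E (iota 0 (size E)).
Proof.
rewrite /tvars /tcols; elim: E 0%N => //= e E IH j; by rewrite IH.
Qed.

Lemma entry_termed (u : 'I_p) (v : 'I_q) (c : 'I_r) n :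
  termed (fun s => exists k l, (k + l)%N = n /\
    s = [:: inl ((u, k), c : nat); inr ((v, l), c : nat)]) ((facA u c * facB c v) n).
Proof.
apply: termed_sum => k _; apply: (@termedM _ _ (fun s => s = [:: inl ((u, k : nat), c : nat)])
  (fun s => s = [:: inr ((v, (n - k)%N), c : nat)])).
- by move=> _ _ -> ->; exists k, (n - k)%N; rewrite subnKC // -ltnS.
- rewrite mxE /=; have -> : ucm (inl (u, k : nat, c : nat) : W) = mon [:: inl (u, k : nat, c : nat)].
    by rewrite /= mulm1.
  exact: termedU.
- rewrite mxE /=; have -> : ucm (inr (v, (n - k)%N, c : nat) : W) = mon [:: inr (v, (n - k)%N, c : nat)].
    by rewrite /= mulm1.
  exact: termedU.
Qed.

Definition product_term (u : seq 'I_p) (v : seq 'I_q) (c : seq nat) n s : Prop :=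
  exists E, [/\ map fst (map fst E) = u, map fst (map snd E) = v, wtE E = n & s = tcols E c].

Lemma product_termed (I : Type) (x : seq I) (u : I -> 'I_p) (v : I -> 'I_q) (c : I -> 'I_r) n :
  termed (product_term (map u x) (map v x) (map (fun i => c i : nat) x) n)
    ((\prod_(i <- x) (facA (u i) (c i) * facB (c i) (v i))) n).
Proof.
elim: x n => [|i x IH] n.
  rewrite big_nil /=; case: n => [|n] /=; last exact: termed0.
  have -> : 1 = << mon [::] >> :> M by apply/esym; exact: mpolyC1E.
  by apply: termedU; exists [::]; rewrite /wtE big_nil.
rewrite big_cons; apply: termed_sum => m _.
apply: (@termedM _ _ _ _ _ _ _ _ (@entry_termed _ _ _ _) (IH _)) => _ t [k [l [kl ->]]] [E [uE vE wE ->]].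
exists (((u i, k), (v i, l)) :: E); split; rewrite /= ?uE ?vE //.
by rewrite /wtE big_cons -/(wtE E) wE /= kl subnKC // -ltnS.
Qed.

(** Sorting the pairs by their columns turns a term whose columns are the first h ones into
   a refinement. *)
Lemma sort_columns (h : nat) E (c : seq nat) : size E = h -> perm_eq c (iota 0 h) ->
  exists2 F, perm_eq E F & perm_eq (tcols E c) (tvars F).
Proof.
move=> sE pc; have sc : size c = h by rewrite (perm_size pc) size_iota.
pose L := sort (fun x y : (('I_p * nat) * ('I_q * nat)) * nat => x.2 <= y.2)%N (zip E c).
have pL : perm_eq (zip E c) L by rewrite perm_sym perm_sort.
have e2 : unzip2 L = iota 0 h.
  apply: (sorted_eq leq_trans anti_leq).
  - by rewrite sorted_map; apply: sort_sorted => a b; apply: leq_total.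
  - exact: iota_sorted.
  - by rewrite -(permPr pc) -(unzip2_zip (s := E) (t := c)) ?sE ?sc // perm_map // perm_sym.
have sL : size L = h by rewrite size_sort size_zip sE sc minnn.
exists (unzip1 L).
  by rewrite -{1}(unzip1_zip (s := E) (t := c)) ?sE ?sc //; apply: perm_map.
rewrite tvars_tcols size_map sL -e2 /tcols zip_unzip; exact: (perm_flatten (perm_map _ pL)).
Qed.

Lemma jterm_product (h : nat) J E (c : seq nat) : is_J J -> size J.2 = h -> size E = h ->
  perm_eq (map fst (map fst E)) (unzip1 J.2) -> perm_eq (map fst (map snd E)) (unzip2 J.2) ->
  wtE E = J.1 -> uniq c -> size c = h -> exists2 t, perm_eq (tcols E c) t & jterm J t.
Proof.
move=> HJ sJ sE p1 p2 wE uc sc; case: (boolP (all (fun j => j < h)%N c)) => [lt|/allPn [j jc nlt]].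
  have pc : perm_eq c (iota 0 h).
    apply: uniq_perm => //; first exact: iota_uniq.
    have := uniq_min_size uc (_ : {subset c <= iota 0 h}); rewrite size_iota sc => H.
    by case: H => // x xc; rewrite mem_iota /= add0n (allP lt).
  have [F pF pt] := sort_columns sE pc; exists (tvars F) => //; right; exists F => //.
  apply/in_calE_sides => //; rewrite -wtE_sides; split.
  - by apply: perm_trans p1; rewrite perm_sym; do 2!apply: perm_map.
  - by apply: perm_trans p2; rewrite perm_sym; do 2!apply: perm_map.
  - by rewrite -wE; apply: perm_big; rewrite perm_sym.
exists (tcols E c) => //; left; have /(nthP 0%N) [k lk e] := jc.
case: (J) => n z in HJ sJ p1 p2 wE *.
have [x xE] : exists x, x \in zip E c /\ x.2 = j.
  move: jc; rewrite -{1}(unzip2_zip (s := E) (t := c)) ?sE ?sc // => /mapP [x xz ->].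
  by exists x.
exists (inl (x.1.1, j)); last by rewrite /= sJ leqNgt.
by apply/flatten_mapP; exists x; [case: xE | rewrite -(proj2 xE) mem_head].
Qed.

(** By [det_mul_expand] each term uses pairwise distinct columns. *)
Lemma facX_termed J : is_J J -> termed (jterm J) (Jseries facX J J.1).
Proof.
move=> HJ; have [J0 s1 s2] := is_J_sides HJ.
pose z := in_tuple J.2; pose u := fun i => (tnth z i).1; pose v := fun i => (tnth z i).2.
have -> : Jseries facX J = \det (rowsub u facA *m colsub v facB).
  rewrite /Jseries /minor; congr (\det _); apply/matrixP => i j; rewrite !mxE.
  by apply: eq_bigr => k _; rewrite !mxE.
rewrite det_mul_expand fps_sumE; apply: termed_sum => f /injectiveP fi.
rewrite fps_sumE; apply: termed_sum => s _; rewrite fps_signM; apply: termed_sign.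
have -> : \prod_i (rowsub u facA i (f i) * colsub v facB (f i) (s i)) =
    \prod_(i <- enum 'I_(size J.2)) (facA (u i) (f i) * facB (f i) (v (s i))).
  by rewrite big_enum; apply: eq_bigr => i _; rewrite !mxE.
move=> t /product_termed [t' tt' [E [uE vE wE e]]].
have sE : size E = size J.2 by rewrite -(size_map fst) -(size_map fst) uE size_map size_enum_ord.
have [|||||||t2 p2 jt] := @jterm_product (size J.2) J E [seq f i : nat | i <- enum 'I_(size J.2)] HJ _ _ _ _ _ _ _.
- by [].
- exact: sE.
- rewrite uE /u /z -/(codom _); have -> : unzip1 J.2 = [seq (tnth z i).1 | i <- enum 'I_(size J.2)].
    by rewrite [RHS](map_comp fst (tnth z)) map_tnth_enum.
  exact: perm_refl.
- rewrite vE; have -> : unzip2 J.2 = [seq v i | i <- enum 'I_(size J.2)].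
    by rewrite [RHS](map_comp snd (tnth z)) map_tnth_enum.
  rewrite (map_comp v s); apply: perm_map; apply: uniq_perm; rewrite ?enum_uniq //.
    by rewrite map_inj_uniq ?enum_uniq //; exact: perm_inj.
  move=> i; rewrite mem_enum; apply/mapP; exists (s^-1%g i); rewrite ?mem_enum //.
  by rewrite permKV.
- exact: wE.
- by rewrite map_inj_uniq ?enum_uniq // => i j /val_inj /fi.
- by rewrite size_map size_enum_ord.
by exists t2 => //; apply: perm_trans tt' _; rewrite e.
Qed.

Lemma facX_in_D : in_D r.+1 facX.
Proof.
move=> u v _ _; have -> : minor u v facX = \det (rowsub u facA *m colsub v facB).
  rewrite /minor; congr (\det _); apply/matrixP => i j; rewrite !mxE.
  by apply: eq_bigr => k _; rewrite !mxE.
rewrite det_mul_expand big1 // => f /injectiveP fi.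
by have := max_card (mem (codom f)); rewrite card_codom // !card_ord ltnn.
Qed.
End Factorization.

(** * Leading coefficients *)

Section LeadingCoefficient.
Variables (K : fieldType) (p q r : nat).
Local Notation W := (fvar p q).
Local Notation M := (malgpoly K W).
Implicit Types (E F : Esym p q) (J : Jsym p q) (w : W) (s : seq W).

Lemma mem_tvarsl E a j :
  ((inl (a, j) : W) \in tvars E) = if onth E j is Some e then e.1 == a else false.
Proof.
suff H i : ((inl (a, j) : W) \in tvars_from i E) = (i <= j)%N &&
    (if onth E (j - i) is Some e then e.1 == a else false) by rewrite /tvars H subn0.
elim: E i => [|e E IH] i; first by rewrite /= onth0n andbF.
rewrite /= !inE IH.
have -> : (inl (a, j) == inl (e.1, i) :> W) = (e.1 == a) && (i == j).
  by rewrite [e.1 == _]eq_sym [i == j]eq_sym.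
case: (ltngtP i j) => [lt|//|->]; rewrite ?andbF //; first by rewrite -(subnSK lt).
by rewrite subnn /= !andbT !orbF.
Qed.

Lemma mem_tvarsr E b j :
  ((inr (b, j) : W) \in tvars E) = if onth E j is Some e then e.2 == b else false.
Proof.
suff H i : ((inr (b, j) : W) \in tvars_from i E) = (i <= j)%N &&
    (if onth E (j - i) is Some e then e.2 == b else false) by rewrite /tvars H subn0.
elim: E i => [|e E IH] i; first by rewrite /= onth0n andbF.
rewrite /= !inE IH.
have -> : (inr (b, j) == inr (e.2, i) :> W) = (e.2 == b) && (i == j).
  by rewrite [e.2 == _]eq_sym [i == j]eq_sym.
case: (ltngtP i j) => [lt|//|->]; rewrite ?andbF //; first by rewrite -(subnSK lt).
by rewrite subnn /= !andbT !orbF.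
Qed.

Lemma onth_tnth (T : Type) (E : seq T) (i : 'I_(size E)) : onth E i = Some (tnth (in_tuple E) i).
Proof. by rewrite onthE (tnth_nth (tnth (in_tuple E) i)) (nth_map (tnth (in_tuple E) i)). Qed.

Lemma kill_var (S : seq W) w : kill K S << ucm w >> = if w \in S then << ucm w >> else 0.
Proof. exact: eval_var. Qed.

Lemma fps_monom (k : nat) (c : M) n : (fpsX M ^+ k * fpsC c) n = if n == k then c else 0.
Proof.
rewrite fpsXnM; case: ltngtP => // lt; last by rewrite lt subnn.
by have -> : (n - k)%N = (n - k).-1.+1 by lia.
Qed.

Section Refinement.
Variable E : Esym p q.
Hypothesis (EE : is_E E).
Let e i := tnth (in_tuple E) i.
Let u (i : 'I_(size E)) := (e i).1.1.
Let v (i : 'I_(size E)) := (e i).2.1.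
Let var1 (i : 'I_(size E)) : M := << ucm (inl ((e i).1, i : nat) : W) >>.
Let var2 (i : 'I_(size E)) : M := << ucm (inr ((e i).2, i : nat) : W) >>.

Lemma refinement_rows_inj : injective u /\ injective v.
Proof.
have en x (k : 'I_(size E)) : nth x E k = e k by rewrite /e (tnth_nth x).
case/and3P: EE => _ u1 u2; split=> i j eq; apply: ord_inj; apply/eqP.
  rewrite -(nth_uniq (u i) _ _ u1) ?size_map //; apply/eqP.
  by rewrite !(nth_map (e i)) // !en.
rewrite -(nth_uniq (v i) _ _ u2) ?size_map //; apply/eqP.
by rewrite !(nth_map (e i)) // !en.
Qed.

Lemma kill_row i (c : 'I_r) : fps_map (kill K (tvars E)) (facA K p q r (u i) c) =
  if (c == i :> nat) then fpsX M ^+ (e i).1.2 * fpsC (var1 i) else 0.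
Proof.
apply/fpsP=> n; rewrite mxE /= kill_var mem_tvarsl.
case: eqP => [->|ne].
  rewrite onth_tnth fps_monom -/(e i) /var1 /u; case: (e i) => -[u' k] b /=.
  rewrite xpair_eqE eqxx andTb [n == _]eq_sym; case: eqP => [->|_]; reflexivity.
case: (ltnP c (size E)) => lt; last by rewrite onth_default.
rewrite (onth_tnth (Ordinal lt)); case: eqP => // /(congr1 fst) eu.
by have /(congr1 (@nat_of_ord _)) /= := refinement_rows_inj.1 (Ordinal lt) i eu.
Qed.

Lemma kill_col i (c : 'I_r) : fps_map (kill K (tvars E)) (facB K p q r c (v i)) =
  if (c == i :> nat) then fpsX M ^+ (e i).2.2 * fpsC (var2 i) else 0.
Proof.
apply/fpsP=> n; rewrite mxE /= kill_var mem_tvarsr.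
case: eqP => [->|ne].
  rewrite onth_tnth fps_monom -/(e i) /var2 /v; case: (e i) => a [v' l] /=.
  rewrite xpair_eqE eqxx andTb [n == _]eq_sym; case: eqP => [->|_]; reflexivity.
case: (ltnP c (size E)) => lt; last by rewrite onth_default.
rewrite (onth_tnth (Ordinal lt)); case: eqP => // /(congr1 fst) eu.
by have /(congr1 (@nat_of_ord _)) /= := refinement_rows_inj.2 (Ordinal lt) i eu.
Qed.

(** With all variables but those of E set to zero, column j of A and row j of B have one
   nonzero entry each, in the j-th row and column of E. The minor of X on these rows and
   columns is then diagonal. *)
Lemma kill_minor n : (size E <= r)%N ->
  kill K (tvars E) (minor u v (facX K p q r) n) = if n == wtE E then << mon (tvars E) >> else 0.
Proof.
move=> sEr; rewrite -[LHS]/(fps_map (kill K (tvars E)) (minor u v (facX K p q r)) n) -map_arc_minor.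
have -> : minor u v (map_mx (fps_map (kill K (tvars E))) (facX K p q r)) =
    \det (diag_mx (\row_i (fpsX M ^+ ((e i).1.2 + (e i).2.2) * fpsC (var1 i * var2 i)))).
  rewrite /minor; congr (\det _); apply/matrixP=> i j; rewrite /facX map_mxM !mxE.
  have io : (i < r)%N by apply: leq_trans sEr.
  rewrite (bigD1 (Ordinal io)) //= big1 ?addr0 => [|c ne].
    rewrite mxE [X in _ * X]mxE kill_row kill_col /= eqxx.
    case: (eqVneq i j) => [->|ne]; last first.
      by rewrite mulr0n ifN ?mulr0.
    rewrite eqxx mulr1n exprD.
    rewrite (rmorphM (@fpsC M)).
    exact: mulrACA.
  rewrite mxE kill_row ifN ?mul0r //.
rewrite det_diag.
have -> : \prod_i (\row_i (fpsX M ^+ ((e i).1.2 + (e i).2.2) * fpsC (var1 i * var2 i))) 0 i =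
    fpsX M ^+ (wtE E) * fpsC (\prod_i (var1 i * var2 i)).
  under eq_bigr do rewrite mxE.
  rewrite big_split -rmorph_prod; congr (_ * _).
  rewrite -(expr_sum (fpsX M)); congr (_ ^+ _).
  by rewrite /wtE (big_tnth _ _ E).
rewrite fps_monom; case: (n == wtE E); last reflexivity.
have zE : zip E (iota 0 (size E)) = [seq (e i, i : nat) | i <- enum 'I_(size E)].
  have <- := zip_map e (@nat_of_ord _) (enum 'I_(size E)).
  by rewrite map_tnth_enum (val_enum_ord (size E)).
rewrite tvars_tcols /tcols zE -map_comp mon_flatten big_enum /=.
have UU w w' : << mmul (ucm w) (mmul (ucm w') mone) >> = << ucm w >> * << ucm w' >> :> M.
  rewrite mulm1; exact: malgUM.
apply: eq_bigr => i _; apply: esym; exact: UU.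
Qed.
End Refinement.

(** The coefficient is 1 or -1, according to the order of the rows and columns in E. *)
Lemma facX_coef J E : is_J J -> in_calE J E -> (size E <= r)%N ->
  (Jseries (facX K p q r) J J.1)@_(mon (tvars E)) != 0.
Proof.
move=> HJ cE sEr; have sE := in_calE_size HJ cE; have EE := cE.1.
have [ui vi] := refinement_rows_inj EE.
have E0 : (0 < size E)%N by case/and3P: EE.
have [J' [b [HJ' J'1 _ pu [pv H]]]] := minor_symbol J.1 E0 ui vi.
have eJ : J' = J.
  apply: (@calE_J_inj _ _ J' J E) => //; apply/in_calE_sides => //; rewrite -wtE_sides.
  rewrite (in_calE_wt cE) J'1; split=> //.
    rewrite perm_sym (permPl pu) -[X in perm_eq _ (map fst (map fst X))](map_tnth_enum (in_tuple E)).
    have -> (w : seq 'I_(size E)) : map fst (map fst (map (tnth (in_tuple E)) w)) =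
        [seq (tnth (in_tuple E) i).1.1 | i <- w] by elim: w => //= i w ->.
    exact: perm_refl.
  rewrite perm_sym (permPl pv) -[X in perm_eq _ (map fst (map snd X))](map_tnth_enum (in_tuple E)).
  have -> (w : seq 'I_(size E)) : map fst (map snd (map (tnth (in_tuple E)) w)) =
      [seq (tnth (in_tuple E) i).2.1 | i <- w] by elim: w => //= i w ->.
  exact: perm_refl.
rewrite eJ in H; have := kill_minor EE J.1 sEr.
rewrite H fps_signM (in_calE_wt cE) eqxx.
set f := Jseries _ _ _ => kf.
have ev : (kill K (tvars E) ((-1) ^+ b * f))@_(mon (tvars E)) = 1 by rewrite kf mcoeffUU.
rewrite mcoeff_kill in ev; last exact/allP.
apply/eqP => f0; move: ev; case: (b); rewrite ?expr0 ?mul1r ?expr1 ?mulN1r.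
  by rewrite mcoeffN f0 oppr0 => /esym /eqP; rewrite oner_eq0.
by rewrite f0 => /esym /eqP; rewrite oner_eq0.
Qed.
End LeadingCoefficient.

(** * Linear independence *)

Section ChainOrder.
Variables p q : nat.
Implicit Types (E F : Esym p q) (J : Jsym p q) (Js : seq (Jsym p q)) (Es Fs : seq (Esym p q)).

(** Chains of different lengths are comparable only when they differ before the shorter one
   ends. *)
Fixpoint lexprec Es Fs : bool :=
  match Es, Fs with
  | E :: Es', F :: Fs' => precE E F || (E == F) && lexprec Es' Fs'
  | _, _ => false
  end.

Lemma lexprec_irr Es : lexprec Es Es = false.
Proof. by elim: Es => //= E Es ->; rewrite precE_irr andbF. Qed.

Lemma lexprec_trans Fs Es Gs : lexprec Es Fs -> lexprec Fs Gs -> lexprec Es Gs.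
Proof.
elim: Es Fs Gs => [|E Es IH] [|F Fs] [|G Gs] //= /orP [EF|/andP [/eqP -> lt]].
  case/orP => [FG|/andP [/eqP <- _]]; last by rewrite EF.
  by rewrite (precE_trans EF FG).
by case/orP => [->//|/andP [-> lt']]; rewrite (IH Fs) ?orbT.
Qed.

Lemma maximal_exists (T : eqType) (R : rel T) (s : seq T) : irreflexive R -> transitive R ->
  s != [::] -> exists2 x, x \in s & forall y, y \in s -> ~~ R x y.
Proof.
move=> irr tr; elim: s => // x [|y s] IH _.
  by exists x => [|z]; rewrite inE // => /eqP ->; rewrite irr.
have [//|z zs zmax] := IH; case: (boolP (R z x)) => [zx|nzx].
  exists x; first exact: mem_head.
  move=> t; rewrite inE => /orP [/eqP ->|ts]; first by rewrite irr.
  by apply: contra (zmax t ts) => /(tr _ _ _ zx).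
exists z; first by rewrite inE zs orbT.
by move=> t; rewrite inE => /orP [/eqP ->|/zmax].
Qed.

Fixpoint std_chain E0 Js Es : Prop :=
  match Js, Es with
  | [::], [::] => True
  | J :: Js', E :: Es' => [/\ is_J J, largest (fits E0 J) E & std_chain E Js' Es']
  | _, _ => False
  end.

Lemma std_fromP E0 Js : std_from E0 Js <-> exists Es, std_chain E0 Js Es.
Proof.
elim: Js E0 => [|J Js IH] E0 /=; first by split=> // _; exists [::].
split=> [[HJ [E lE /IH [Es H]]]|[[|E Es] // [HJ lE H]]]; first by exists (E :: Es).
by split=> //; exists E => //; apply/IH; exists Es.
Qed.

Lemma std_chain_chain E0 Js Es : std_chain E0 Js Es -> chain E0 Es.
Proof.
elim: Js E0 Es => [|J Js IH] E0 [|E Es] //= [_ [[_ ->] _] /IH //].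
Qed.

Lemma std_chain_is_E E0 Js Es : std_chain E0 Js Es -> all (@is_E p q) Es.
Proof.
elim: Js E0 Es => [|J Js IH] E0 [|E Es] //= [_ [[[-> _] _] _] /IH //].
Qed.

Lemma std_chain_norm E0 Js Es : std_chain E0 Js Es -> map (@normE p q) Es = Js.
Proof.
by elim: Js E0 Es => [|J Js IH] E0 [|E Es] //= [_ [[[_ ->] _] _] /IH ->].
Qed.
End ChainOrder.

Section Independence.
Variables (K : fieldType) (p q r : nat).
Local Notation W := (fvar p q).
Local Notation M := (malgpoly K W).
Implicit Types (E F : Esym p q) (J : Jsym p q) (Js : seq (Jsym p q)) (Es Fs : seq (Esym p q)).

Definition facprod Js : M := \prod_(J <- Js) Jseries (facX K p q r) J J.1.

Lemma jterm_neq0 J s : is_J J -> jterm J s -> s != [::].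
Proof.
move=> HJ [[w ws _]|[F cF pF]]; apply/eqP => s0; first by rewrite s0 in ws.
have : F != [::] by case: cF.1 => /andP [+ _]; case: (F).
by move: pF; rewrite s0; case: (F) => // e F'; rewrite perm_sym => /perm_size.
Qed.

(** Induction by [leading_term], cancelling the first elements as long as the two chains
   agree. *)
Lemma facprod_support E0 Js Es Es' : std_chain E0 Js Es -> chain E0 Es' -> all (@is_E p q) Es' ->
  (facprod Js)@_(mon (tvars_all Es')) != 0 -> Es' = Es \/ lexprec Es' Es.
Proof.
elim: Js E0 Es Es' => [|J Js IH] E0 [|E Es] Es' //=.
  move=> _ _ EE; rewrite /facprod big_nil mcoeff1.
  case: Es' EE => [|E' Es'] /=; first by left.
  case/andP => /and3P [+ _ _] _; case: E' => // e E' _ /=.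
  have -> : (mmul (ucm (inl (e.1, 0%N) : W)) (mmul (ucm (inr (e.2, 0%N) : W))
     (mon (tvars_from 1 E' ++ tvars_all Es'))) == mone) = false.
    by rewrite cmM_eq1 cm1_eq1.
  by rewrite eqxx.
case=> HJ lE ch chE' EE'; rewrite /facprod big_cons -/(facprod Js).
case/mcoeffM_supp => s1 [s2 [/(facX_termed HJ) [t st jt] n2 pe]].
have t0 := jterm_neq0 HJ jt.
case: Es' EE' chE' pe => [|E' Es'] EE' chE' pe.
  move: t0; have := perm_size pe; rewrite size_cat (perm_size st) /=.
  by case: (t).
have pe' : perm_eq (tvars_all (E' :: Es')) (t ++ s2).
  by rewrite (permPl pe); apply: perm_cat.
have [EE1 EE2] := andP EE'.
case: (leading_term HJ lE chE' EE1 jt pe') => [lt|[e pt]]; first by right; rewrite /= lt.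
have ps : perm_eq (tvars_all Es') s2.
  by rewrite -(perm_cat2l (tvars E)) -{1}e; rewrite (permPl pe') perm_cat2r.
rewrite -((mon_eq _ _).2 ps) in n2.
have [_ chE''] := andP chE'; rewrite e in chE''.
case: (IH _ _ _ ch chE'' EE2 n2) => [->|lt]; first by left; rewrite e.
by right; rewrite /= e eqxx lt orbT.
Qed.

(** By [leading_term] the monomial of the first element must come from the first factor. *)
Lemma facprod_lead E0 Js Es : (size E0 <= r)%N -> std_chain E0 Js Es ->
  (facprod Js)@_(mon (tvars_all Es)) != 0.
Proof.
elim: Js E0 Es => [|J Js IH] E0 [|E Es] //= sr.
  by rewrite /facprod big_nil mcoeff1 eqxx oner_eq0.
case=> HJ lE ch; have [[cE le] _] := lE; have sEr := leq_trans (leE_size le) sr.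
rewrite /facprod big_cons -/(facprod Js) -[tvars_all _]/(tvars E ++ tvars_all Es).
rewrite mcoeffM_unique; first by rewrite mulf_neq0 ?(IH E) // (facX_coef K HJ cE sEr).
move=> t1 t2 /(facX_termed HJ) [t tt jt] pe.
have pe' : perm_eq (tvars_all (E :: Es)) (t ++ t2).
  by rewrite (permPl pe); apply: perm_cat.
have chE : chain E0 (E :: Es) by rewrite /= le (std_chain_chain ch).
case: (leading_term HJ lE chE cE.1 jt pe') => [|[_ pt]]; first by rewrite precE_irr.
exact: perm_trans pt.
Qed.

(** In a relation, the monomial of a maximal chain among those with nonzero coefficient
   occurs in one product only. *)
Lemma facprod_indep E0 (s : seq (seq (Jsym p q))) (c : seq (Jsym p q) -> K) : (size E0 <= r)%N ->
  uniq s -> (forall Js, Js \in s -> std_from E0 Js) ->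
  \sum_(Js <- s) (c Js)%:MP * facprod Js = 0 -> forall Js, Js \in s -> c Js = 0.
Proof.
move=> sr us std rel.
have exch Js : exists Es, std_from E0 Js -> std_chain E0 Js Es.
  case: (pselect (std_from E0 Js)) => [H|nH]; last by exists [::].
  by have [Es HEs] := (std_fromP _ _).1 H; exists Es.
have [ch Hch] := boolp.choice exch.
have chinj Js Ls : Js \in s -> Ls \in s -> ch Js = ch Ls -> Js = Ls.
  by move=> /std/Hch/std_chain_norm e1 /std/Hch/std_chain_norm e2 e; rewrite -e1 -e2 e.
(* Only the products with nonzero coefficient. *)
pose s' := [seq Js <- s | c Js != 0].
case: (eqVneq s' [::]) => [e0 Js Jss|ne0].
  apply/eqP; apply: contraT => nc.
  have Js' : Js \in s' by rewrite mem_filter nc.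
  by rewrite e0 in Js'.
have [||Js] := @maximal_exists _ (fun Js Ls => lexprec (ch Js) (ch Ls)) s' _ _ ne0.
- by move=> Js; apply: lexprec_irr.
- by move=> Js Ls Ks; apply: lexprec_trans.
rewrite mem_filter => /andP [nc Jss] Jmax.
have std_J := Hch _ (std _ Jss).
have := congr1 (mcoeff (mon (tvars_all (ch Js)))) rel.
rewrite raddf_sum mcoeff0 (bigD1_seq Js) //= big_seq_cond big1 ?addr0.
  by rewrite mcoeffCM => /eqP; rewrite mulf_eq0 (negbTE nc) (negbTE (facprod_lead sr std_J)).
move=> Ls /andP [Lss ne]; rewrite mcoeffCM; apply/eqP; rewrite mulf_eq0.
case: (eqVneq (c Ls) 0) => //= ncL; apply: contraT => nz.
have := facprod_support (Hch _ (std _ Lss)) (std_chain_chain std_J) (std_chain_is_E std_J) nz.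
case=> [/(chinj _ _ Jss Lss) e|lt]; first by rewrite e eqxx in ne.
by have := Jmax Ls; rewrite mem_filter ncL Lss lt => /(_ isT).
Qed.
End Independence.

(** * Symbols as Taylor coefficients *)

Section HasseDerivatives.
Variables p q : nat.
Local Notation R := (diffring p q).
Implicit Types (f g : R).

Lemma diffring_mulrn_inj f g n : (0 < n)%N -> f *+ n = g *+ n -> f = g.
Proof.
move=> n0 e; apply/malgP => m; have := congr1 (mcoeff m) e.
by rewrite !mcoeffMn => /(Num.Theory.pmulrnI n0).
Qed.

Lemma dbarP f n x : iter n (@der p q) f = x *+ n`! -> dbar n f = x.
Proof. by move=> e; apply: (@diffring_mulrn_inj _ _ n`!); rewrite ?fact_gt0 // dbarE. Qed.

Lemma dbar0 f : dbar 0 f = f.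
Proof. exact: dbarP. Qed.

Lemma der_dbar n f : der (dbar n f) = dbar n.+1 f *+ n.+1.
Proof.
apply: (@diffring_mulrn_inj _ _ n`!); first exact: fact_gt0.
have e1 := derMn (dbar n f) n`!.
have e2 : dbar n.+1 f *+ n.+1 *+ n`! = dbar n.+1 f *+ n.+1`!.
  by rewrite factS mulrnA.
rewrite dbarE in e1.
rewrite dbarE in e2.
exact: (etrans (esym e1) (esym e2)).
Qed.

Lemma dbarD n f g : dbar n (f + g) = dbar n f + dbar n g.
Proof.
apply: dbarP; apply: etrans (esym (mulrnDl _ _ _)).
apply: (etrans _ (esym (congr2 +%R (dbarE n f) (dbarE n g)))).
elim: n => [|n IH]; first reflexivity.
rewrite [LHS]iterS IH; exact: derD.
Qed.

(** By induction from the Leibniz rule for der: the derivative of dbar n is n + 1 times dbar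
   n.+1, and multiplication by n + 1 is injective on integer polynomials. *)
Lemma dbarM n f g : dbar n (f * g) = \sum_(i < n.+1) dbar i f * dbar (n - i) g.
Proof.
elim: n => [|n IH]; first by rewrite big_ord1 !dbar0.
apply: (@diffring_mulrn_inj _ _ n.+1) => //.
rewrite -der_dbar IH (big_morph (@der p q) (@derD p q) (der_nat p q 0)).
have cauchy (F : nat -> R) : (\sum_(i < n.+2) F i) *+ n.+1 =
    \sum_(i < n.+1) (F i.+1 *+ i.+1 + F i *+ (n.+1 - i)).
  transitivity (\sum_(i < n.+2) (F i *+ i + F i *+ (n.+1 - i))).
    rewrite -sumrMnl; apply: eq_bigr => i _.
    by rewrite -mulrnDr subnKC // -ltnS.
  rewrite !big_split /= [X in X + _ = _]big_ord_recl mulr0n add0r.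
  by rewrite [X in _ + X = _]big_ord_recr /= subnn mulr0n addr0.
rewrite (cauchy (fun i => dbar i f * dbar (n.+1 - i) g)); apply: eq_bigr => i _.
have le : (i <= n)%N by rewrite -ltnS.
apply: etrans (derM _ _) _; rewrite subSS subSn //; congr (_ + _).
  apply: etrans (mulrnAl _ _ _); congr (_ * _); exact: der_dbar.
apply: etrans (mulrnAr _ _ _); congr (_ * _); exact: der_dbar.
Qed.

(** The ring homomorphism f |-> sum_n dbar^n(f) t^n, which sends x_ij^(0) to the (i, j)
   entry of the generic arc. *)
Definition taylor f : fps R := Fps (fun n => dbar n f).

Fact taylor_is_zmod_morphism : zmod_morphism taylor.
Proof.
move=> f g; apply/fpsP=> n /=; apply: (addIr (dbar n g)).
apply: etrans (esym (dbarD _ _ _)) _; rewrite [f - g + g]subrK.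
exact: (esym (subrK _ _)).
Qed.
Fact taylor_is_monoid_morphism : monoid_morphism taylor.
Proof.
split=> [|f g]; apply/fpsP=> n /=; last exact: dbarM.
case: n => [|n]; first exact: dbar0.
apply: dbarP; apply: (etrans _ (esym (mul0rn _ _))).
elim: n => [|n IH]; first exact: (der_nat p q 1).
rewrite iterS IH; exact: (der_nat p q 0).
Qed.
HB.instance Definition _ := GRing.isZmodMorphism.Build R (fps R) taylor taylor_is_zmod_morphism.
HB.instance Definition _ := GRing.isMonoidMorphism.Build R (fps R) taylor taylor_is_monoid_morphism.

Lemma dbar_var i j n : dbar n (xvar (i, j, 0%N) : R) = xvar (i, j, n).
Proof.
elim: n => [|n IH]; first exact: dbar0.
apply: (@diffring_mulrn_inj _ _ n.+1) => //.
apply: etrans (esym (der_dbar _ _)) _; rewrite IH; exact: der_var.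
Qed.

(** Taylor expansion commutes with determinants. *)
Lemma Jelt_series (J : Jsym p q) :
  Jelt J = Jseries (\matrix_(i, j) Fps (fun k => xvar (i, j, k)) : 'M[fps R]_(p, q)) J J.1.
Proof.
rewrite /Jelt /Jseries; set u := fun i => _; set v := fun j => _.
set X := \matrix_(i, j) _; set Y := \matrix_(i, j) _.
have -> : Y = map_mx taylor X.
  by apply/matrixP=> i j; rewrite !mxE; apply/fpsP=> n /=; rewrite dbar_var.
rewrite /minor -map_mxsub det_map_mx; reflexivity.
Qed.
End HasseDerivatives.

Lemma arc_eval_Jelt (B : comNzRingType) (p q : nat) (U : 'M[fps B]_(p, q)) J :
  arc_eval U (Jelt J) = Jseries U J J.1.
Proof.
rewrite Jelt_series.
pose ev : {rmorphism diffring p q -> B} := eval (arc_coef U) ( *~%R 1).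
rewrite -[LHS]/(fps_map ev (Jseries _ J) J.1) -Jseries_map.
congr (Jseries _ J J.1); apply/matrixP=> i j; rewrite !mxE; apply/fpsP=> k.
exact: (eval_var (arc_coef U) _ (i, j, k)).
Qed.

Lemma arc_eval_monomial (B : comNzRingType) (p q : nat) (U : 'M[fps B]_(p, q)) Js :
  arc_eval U (monomial Js) = \prod_(J <- Js) Jseries U J J.1.
Proof.
pose ev : {rmorphism diffring p q -> B} := eval (arc_coef U) ( *~%R 1).
rewrite -[LHS]/(ev _) rmorph_prod; apply: eq_bigr => J _; exact: arc_eval_Jelt.
Qed.

(** * Standard monomials as greedy chains *)

Section Bottom.
Variables (p q r : nat) (hp : (0 < p)%N) (hq : (0 < q)%N).
Implicit Types (E F : Esym p q) (J : Jsym p q) (Js : seq (Jsym p q)) (Es : seq (Esym p q)).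

(** Every refinement with at most r pairs lies above this one, so the greedy procedure from
   it has no constraint at its beginning. *)
Definition bottom : Esym p q := nseq r ((Ordinal hp, 0%N), (Ordinal hq, 0%N)).

Lemma bottom_le F : leE bottom F = (size F <= r)%N.
Proof.
rewrite /leE size_nseq; case: leqP => //= sz.
rewrite /bottom take_nseq //; elim: F {sz} => //= f F ->; rewrite andbT.
have := leKE (Ordinal hp, 0%N) f.1; have := leKE (Ordinal hq, 0%N) f.2.
by rewrite /leK => -> -> /=; rewrite ?ltn0.
Qed.

Lemma refinement_exists J : is_J J -> exists F, in_calE J F.
Proof.
case: J => n z HJ; have [z0 _ _] := is_J_sides HJ; move: HJ z0.
case: z => [//|x z] HJ _.
exists (((x.1, n), (x.2, 0%N)) :: [seq ((y.1, 0%N), (y.2, 0%N)) | y <- z]).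
apply/in_calE_sides => //=; rewrite -!map_comp; split; try exact: perm_refl.
rewrite !sumk_cons /= /sumk !big_map; rewrite !big1 ?addn0 //.
Qed.

Lemma stuck_bottom J : is_J J -> stuck bottom J -> (r < size J.2)%N.
Proof.
move=> HJ st; rewrite ltnNge; apply/negP => le; apply: st.
have [F cF] := refinement_exists HJ; exists F; split=> //.
by rewrite bottom_le (in_calE_size HJ cF).
Qed.

Lemma largest_iff (P Q : Esym p q -> Prop) E : (forall F, P F <-> Q F) -> largest P E <-> largest Q E.
Proof.
by move=> PQ; split=> -[/PQ PE H]; split=> // F /PQ; apply: H.
Qed.

Lemma std_chain_nth E0 Es : (forall J, J \in map (@normE p q) Es -> is_J J) ->
  std_chain E0 (map (@normE p q) Es) Es <->
  forall a, (a < size Es)%N -> largest (fits (nth [::] (E0 :: Es) a)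
     (normE (nth [::] Es a))) (nth [::] Es a).
Proof.
elim: Es E0 => [|E Es IH] E0 HJ; first by split.
have HE : is_J (normE E) by apply: HJ; rewrite mem_head.
have HEs J : J \in map (@normE p q) Es -> is_J J.
  by move=> JEs; apply: HJ; rewrite inE JEs orbT.
split=> [[_ lE /(IH E HEs) H] [|a] //= lt|H]; first exact: H.
split=> //; first exact: (H 0%N).
by apply/(IH E HEs) => a lt; apply: (H a.+1).
Qed.

(** The first factor is unconstrained in the definition of standard, and constrained by the
   bottom element in the greedy procedure; this amounts to the bound r on its size, and so
   on all sizes. *)
Lemma standard_monomialP Js : standard_monomial_le r Js <-> std_from bottom Js.
Proof.
have first_iff J E : is_J J -> (size J.2 <= r)%N ->
    largest (in_calE J) E <-> largest (fits bottom J) E.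
  move=> HJ le; apply: largest_iff => F; split=> [cF|[]//]; split=> //.
  by rewrite bottom_le (in_calE_size HJ cF).
split=> [[[Es [[isE leEs E1 Es1] eJs]] HJs]|/std_fromP [Es ch]].
  apply/std_fromP; exists Es; rewrite -eJs in HJs *; apply/std_chain_nth => [J /HJs []//|[|a] lt].
    have [HJ le] : is_J (normE (nth [::] Es 0)) /\ (sz (normE (nth [::] Es 0)) <= r)%N.
      by apply: HJs; apply: map_f; apply: mem_nth.
    by apply/(first_iff _ _ HJ le)/E1.
  exact: Es1.
have eJs := std_chain_norm ch; have isE := std_chain_is_E ch; have le := std_chain_chain ch.
have HJ J : J \in Js -> is_J J.
  by elim: Js bottom Es ch {eJs isE le} => [|J' Js IH] E0 [|E Es] //= [HJ' _ ch]; rewrite inE => /orP [/eqP ->|/(IH _ _ ch)].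
have szJ J : J \in Js -> (size J.2 <= r)%N.
  rewrite -eJs => /mapP [E EEs ->].
  have HE : is_J (normE E) by apply: HJ; rewrite -eJs map_f.
  rewrite -(in_calE_size HE (E := E)) -?bottom_le; last by split=> //; apply: (allP isE).
  exact: chain_le EEs.
have H := ch; rewrite -eJs in H; move/std_chain_nth: H => H.
have {}H a := H (fun J JEs => HJ J (eq_ind _ (fun Ks => J \in Ks) JEs _ eJs)) a.
split; last by move=> J JJs; split; [exact: HJ | exact: szJ].
exists Es; split=> //; split.
- by move=> F FEs; apply: (allP isE).
- by move=> a lt; have [[_ ->] _] := H a.+1 lt.
- move=> lt; have mE : normE (nth [::] Es 0) \in Js by rewrite -eJs map_f ?mem_nth.
  by apply/(first_iff _ _ (HJ _ mE) (szJ _ mE)); exact: (H 0%N lt).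
- by move=> a lt; exact: (H a.+1 lt).
Qed.
End Bottom.

(** * The basis of the coordinate ring *)

Lemma Jseries_in_D (R : comNzRingType) (p q : nat) (X : 'M[fps R]_(p, q)) (J : Jsym p q) :
  is_J J -> in_D (size J.2) X -> Jseries X J = 0.
Proof.
move=> HJ DX; have [_ s1 s2] := is_J_sides HJ.
apply: DX => i j lt; have x0 := tnth (in_tuple J.2) i.
  have := sorted_ltn_nth (fun a b c : 'I_p => @ltn_trans a b c) x0.1 s1.
  move=> /(_ i j); rewrite !inE size_map !ltn_ord !(nth_map x0) // !(tnth_nth x0).
  by apply.
have := sorted_ltn_nth (fun a b c : 'I_q => @ltn_trans a b c) x0.2 s2.
move=> /(_ i j); rewrite !inE size_map !ltn_ord !(nth_map x0) // !(tnth_nth x0).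
by apply.
Qed.

(** Minors on arbitrary rows and columns reduce to increasing ones, and larger minors to
   smaller ones by expansion along a row. *)
Lemma large_symbol_vanishes (R : comNzRingType) (p q r : nat) (X : 'M[fps R]_(p, q)) (J : Jsym p q) :
  in_D r.+1 X -> (r < size J.2)%N -> Jseries X J = 0.
Proof.
move=> DX lt; rewrite /Jseries /minor; apply: minors_vanish_above lt _ _ => u v.
case: (pselect (injective u)) => [iu|nu]; last exact: (minor_row_rep _ _ nu).
case: (pselect (injective v)) => [iv|nv]; last exact: (minor_col_rep _ _ nv).
have [J' [b [HJ' _ sJ' _ [_ H]]]] := minor_symbol 0 (ltn0Sn r) iu iv.
rewrite -[LHS]/(minor u v X) H (Jseries_in_D HJ') ?mulr0 //.
by rewrite sJ'.
Qed.

Lemma fps_map_mx_comp (K : fieldType) (A B C : comAlgType K) (f : {lrmorphism A -> B})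
    (g : {lrmorphism B -> C}) (p q : nat) (X : 'M[fps A]_(p, q)) :
  map_mx (fps_map (g \o f : {lrmorphism A -> C})) X = map_mx (fps_map g) (map_mx (fps_map f) X).
Proof. by apply/matrixP=> i j; rewrite !mxE. Qed.

Section ArcRing.
Variables (K : fieldType) (p q r : nat) (B : comAlgType K) (U : 'M[fps B]_(p, q)).
Hypothesis hU : is_arc_ring r.+1 U.
Implicit Types (J : Jsym p q) (Js : seq (Jsym p q)).

(** Mapping B to the quotient constructed from polynomials and back fixes the universal arc,
   so by uniqueness it is the identity. *)
Lemma arc_polyeval_surj (b : B) : exists f : jetpoly K p q, b = arc_polyeval U f.
Proof.
have [f [fU _]] := hU.2 (arc_quot K p q r) (univ_arc K p q r) (@univ_arc_in_D K p q r).
have [g [gU gE]] : exists g : {lrmorphism arc_quot K p q r -> B},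
    map_mx (fps_map g) (univ_arc K p q r) = U /\ forall x, g x = arc_polyeval U (arc_repr x).
  by exists (arc_lift_of hU.1); split=> //; exact: arc_lift_univ.
pose gof : {lrmorphism B -> B} := (g \o f)%FUN.
have gfU : map_mx (fps_map gof) U = U.
  by rewrite fps_map_mx_comp fU.
have [k [_ kuniq]] := hU.2 B U hU.1.
have gfk := kuniq gof gfU.
have idU : map_mx (fps_map (idfun : {lrmorphism B -> B})) U = U.
  by apply/matrixP=> i j; rewrite mxE; apply/fpsP.
have idk := kuniq idfun idU.
exists (arc_repr (f b)); rewrite -gE; exact: (etrans (idk b) (esym (gfk b))).
Qed.

Lemma arc_polyeval_Jprod Js : arc_polyeval U (Jprod K Js) = \prod_(J <- Js) Jseries U J J.1.
Proof.
rewrite /Jprod rmorph_prod; apply: eq_bigr => J _; rewrite /Jpoly.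
rewrite -[LHS]/(fps_map (arc_polyeval U) (Jseries _ J) J.1) -Jseries_map.
congr (Jseries _ J J.1); apply/matrixP=> i j; rewrite !mxE; apply/fpsP=> k.
exact: (eval_var (arc_coef U) _ (i, j, k)).
Qed.

Lemma combination_add (I : eqType) (P : I -> Prop) (v : I -> B) (s : seq I) (c : I -> K) (d : K) j :
  uniq s -> (forall i, i \in s -> P i) -> P j -> exists (s' : seq I) (c' : I -> K),
    [/\ uniq s', forall i, i \in s' -> P i &
     d *: v j + \sum_(i <- s) c i *: v i = \sum_(i <- s') c' i *: v i].
Proof.
move=> us Ps Pj; pose c' i := (if i == j then d else 0) + (if i \in s then c i else 0).
case: (boolP (j \in s)) => js.
  exists s, c'; split=> //; rewrite !(bigD1_seq j) //= /c' eqxx js scalerDl addrA; congr (_ + _).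
  rewrite big_seq_cond [RHS]big_seq_cond; apply: eq_bigr => i /andP [is_ /negbTE ->].
  by rewrite is_ add0r.
exists (j :: s), c'; split; first by rewrite /= js.
  by move=> i; rewrite inE => /orP [/eqP ->|/Ps].
rewrite big_cons /c' eqxx (negbTE js) addr0; congr (_ + _).
apply: eq_big_seq => i is_; rewrite is_ (_ : (i == j) = false) ?add0r //.
by apply: contraNF js => /eqP <-.
Qed.

(** Products with a symbol that does not fit above the bottom element vanish on U. *)
Lemma standard_span (hp : (0 < p)%N) (hq : (0 < q)%N) (b : B) :
  exists (s : seq (seq (Jsym p q))) (c : seq (Jsym p q) -> K),
    [/\ uniq s, forall Js, Js \in s -> standard_monomial_le r Js &
      b = \sum_(Js <- s) c Js *: arc_eval U (monomial Js)].
Proof.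
have [f ->] := arc_polyeval_surj b.
elim: (all_straight (bottom r hp hq) f) => [|d Js g [HJs Hor] _ [s [c [us Ps es]]]].
  exists [::], (fun=> 0); split=> //; rewrite big_nil; exact: rmorph0.
have -> : arc_polyeval U (d%:MP * Jprod K Js + g) =
    d *: arc_eval U (monomial Js) + arc_polyeval U g.
  rewrite rmorphD rmorphM; congr (_ + _).
  have dE : arc_polyeval U d%:MP = d *: 1 by exact: eval_const.
  apply: etrans (congr2 *%R dE (arc_polyeval_Jprod Js)) _.
  by rewrite -arc_eval_monomial -scalerAl mul1r.
rewrite es; case: Hor => [std|[J JJs st]].
  by apply: combination_add => //; apply/standard_monomialP; exact: std.
exists s, c; split=> //; rewrite arc_eval_monomial (big_rem J) //=.
have HJ := HJs _ JJs.
rewrite (large_symbol_vanishes hU.1 (stuck_bottom HJ st)).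
by rewrite mul0r scaler0 add0r.
Qed.

(** Evaluate the relation at the arc X = A B. *)
Lemma standard_indep (hp : (0 < p)%N) (hq : (0 < q)%N)
    (s : seq (seq (Jsym p q))) (c : seq (Jsym p q) -> K) : uniq s ->
  (forall Js, Js \in s -> standard_monomial_le r Js) ->
  \sum_(Js <- s) c Js *: arc_eval U (monomial Js) = 0 -> forall Js, Js \in s -> c Js = 0.
Proof.
move=> us Ps rel.
pose A : comAlgType K := {malg K[{cmonom fvar p q}]}.
have [f [fU _]] := hU.2 A (facX K p q r) (@facX_in_D K p q r).
have fE Js : f (arc_eval U (monomial Js)) = facprod K r Js.
  rewrite arc_eval_monomial rmorph_prod; apply: eq_bigr => J _.
  by rewrite -fU Jseries_map.
apply: (@facprod_indep K p q r (bottom r hp hq)) => //.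
- by rewrite size_nseq.
- by move=> Js /Ps/standard_monomialP; apply.
have := congr1 f rel; rewrite raddf0 raddf_sum => e; rewrite -[RHS]e.
apply: eq_bigr => Js _; apply: esym; apply: etrans (linearZ _ _) _.
by rewrite /= fE; apply: esym; exact: mul_malgC.
Qed.
End ArcRing.

Theorem corollary1p7 (K : closedFieldType) (p q h : nat)
    (hp : (1 <= p)%N) (hq : (1 <= q)%N) (hh : (1 <= h)%N)
    (B : comAlgType K) (U : 'M[fps B]_(p, q)) (hU : is_arc_ring h U) :
  is_basis (fun Js : seq (Jsym p q) => standard_monomial_le h.-1 Js)
           (fun Js => arc_eval U (monomial Js)).
Proof.
case: h hh hU => // r _ hU; split.
  move=> s c us Ps rel; exact: (standard_indep hU hp hq us Ps rel).
move=> b; have [s [c [_ Ps ->]]] := standard_span hU hp hq b.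
by exists s, c.
Qed.
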